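(* For $\Delta>0$ let $\theta_\Delta(B)Z_n=\phi(B)Y_n^\Delta$ be the moving average representation of the filtered sampled process, where $\theta_\Delta$ is a polynomial of degree at most $p-1$ with $\theta_\Delta(0)=1$ and no zeroes in the open unit disc, and $(Z_n)_{n\in\mathbb{Z}}$ is zero-mean white noise with variance $\tau_\Delta^2$. Then, as $\Delta\downarrow0$: (a) If $p-q=1$, then $\theta_\Delta(z)\to(1-z)^q$ coefficientwise and $\tau_\Delta^2\sim\sigma^2\Delta$. (b) If $p-q=2$, then $\theta_\Delta(z)\to(1+\theta z)(1-z)^q$ coefficientwise, where $\theta=2-\sqrt3$, and $\tau_\Delta^2\sim\sigma^2\Delta^3(2+\sqrt3)/6$. (c) If $p-q=3$, then $\theta_\Delta(z)\to(1+\theta_1z+\theta_2z^2)(1-z)^q$ coefficientwise, where $$\theta_2=2\left(8+\sqrt{30}\right)-\sqrt{375+64\sqrt{30}},\qquad \theta_1=\frac{26\,\theta_2}{1+\theta_2}=13-\sqrt{135+4\sqrt{30}},$$ and $$\tau_\Delta^2\sim\frac{\left(2\left(8+\sqrt{30}\right)+\sqrt{375+64\sqrt{30}}\right)\Delta^5\sigma^2}{120}.$$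
   Context: Let $L=(L_t)_{t\in\mathbb{R}}$ be a (two-sided, real-valued) Lévy process with $E L_1=0$ and $E L_1^2=\sigma^2\in(0,\infty)$. Let $p,q$ be integers with $0\le q<p$, and let $a(z)=z^p+a_1z^{p-1}+\cdots+a_p$ and $b(z)=b_0+b_1z+\cdots+b_{p-1}z^{p-1}$ be real polynomials with $b_q=1$ and $b_j=0$ for $q<j<p$. Assume $a$ and $b$ have no common zeroes and all zeroes of $a$ have strictly negative real part. Denote the zeroes of $a$, repeated according to multiplicity, by $\lambda_1,\dots,\lambda_p$. The CARMA$(p,q)$ process $Y=(Y_t)_{t\in\mathbb{R}}$ is the strictly stationary process $$Y_t=\int_{-\infty}^\infty g(t-u)\,dL_u,\qquad g(t)=\sum_{\lambda}\mathrm{Res}_{z=\lambda}\Big(e^{zt}\frac{b(z)}{a(z)}\Big)\ (t>0),\quad g(t)=0\ (t\le 0),$$ the sum being over the distinct zeroes $\lambda$ of $a$. Equivalently, $Y$ is the unique strictly stationary solution of $Y_t=\mathbf b^\top \mathbf X_t$, $d\mathbf X_t=A\mathbf X_t\,dt+\mathbf e_p\,dL_t$, where $A$ is the companion matrix of $a$ (ones on the superdiagonal, last row $(-a_p,\dots,-a_1)$), $\mathbf b=(b_0,\dots,b_{p-1})^\top$, $\mathbf e_p=(0,\dots,0,1)^\top$. For $\Delta>0$ the sampled process is $Y^\Delta=(Y_{n\Delta})_{n\in\mathbb{Z}}$, $Y^\Delta_n=Y_{n\Delta}$; $B$ is the backward shift ($BY^\Delta_n=Y^\Delta_{n-1}$),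 and $\phi(B)=\prod_{j=1}^p(1-e^{\lambda_j\Delta}B)$. The process $(\phi(B)Y_n^\Delta)_{n\in\mathbb{Z}}$ is stationary with autocovariances $\gamma_{MA}(h)$ vanishing for $|h|>p-1$, so it is a moving average $\theta_\Delta(B)Z_n$ of order at most $p-1$ driven by an uncorrelated zero-mean sequence $(Z_n)$ with constant variance $\tau_\Delta^2$. Under the normalization $\theta_\Delta(0)=1$ and the condition that $\theta_\Delta$ has no zeroes in $\{|z|<1\}$, the polynomial $\theta_\Delta$ and $\tau^2_\Delta$ are uniquely determined by the autocovariances via $\frac{1}{2\pi}\sum_{h}\gamma_{MA}(h)e^{-ih\omega}=\frac{\tau_\Delta^2}{2\pi}|\theta_\Delta(e^{-i\omega})|^2$. ''Coefficientwise'' convergence means convergence of each coefficient of $z^j$, $0\le j\le p-1$. The notation $a(\Delta)\sim b(\Delta)$ means $\lim_{\Delta\downarrow0}a(\Delta)/b(\Delta)=1$. *)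

(* Defs.v *)
Set Warnings "-notation-overridden,-notation-incompatible-prefix,-ambiguous-paths".
From HB Require Import structures.
From mathcomp Require Export all_boot all_order all_algebra.
From mathcomp Require Export all_classical all_reals all_analysis.
From mathcomp Require Export complex.
Export Order.TTheory GRing.Theory Num.Theory numFieldNormedType.Exports.

Set Implicit Arguments.
Unset Strict Implicit.
Unset Printing Implicit Defensive.

Local Open Scope classical_set_scope.
Local Open Scope complex_scope.
Local Open Scope ring_scope.

Section ComplexAnalysis.
Variable R : realType.

Definition polyC_of (p : {poly R}) : {poly R[i]} := map_poly (real_complex R) p.

Definition expC (z : R[i]) : R[i] :=
  (expR (complex.Re z) * cos (complex.Im z))
    +i* (expR (complex.Re z) * sin (complex.Im z)).

(* Near z0, f has a Laurent expansion with finite principal part,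
   f z = \sum_(n >= 0) u n * (z - z0) ^ (n - (m + 1)),
   so that the coefficient of (z - z0) ^ -1 is u m. *)
Definition has_residue (f : R[i]^o -> R[i]^o) (z0 c : R[i]^o) : Prop :=
  exists (m : nat) (u : nat -> R[i]^o), u m = c /\
    \forall z \near z0^',
      series (fun n => u n * (z - z0) ^+ n) @ \oo --> (z - z0) ^+ m.+1 * f z.

(* Meant for functions that are holomorphic or have a pole at z0. *)
Definition residue (f : R[i]^o -> R[i]^o) (z0 : R[i]^o) : R[i] :=
  xget 0 [set c | has_residue f z0 c].

(* The sum of residues is real because the zeroes of a real polynomial come in
   conjugate pairs; Re only turns it into an element of R. *)
Definition carma_kernel (a b : {poly R}) (lam : seq R[i]) (t : R) : R :=
  if 0 < t then
    complex.Re (\sum_(l <- undup lam)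
      residue (fun z => expC (z * t%:C) * ((polyC_of b).[z] / (polyC_of a).[z])) l)
  else 0.

End ComplexAnalysis.

Section Processes.
Context {d : measure_display} {T : measurableType d} {R : realType}.
Variable P : probability T R.

Definition cadlag (x : R -> R) : Prop :=
  forall t, x s @[s --> t^'+] --> x t /\ exists l : R, x s @[s --> t^'-] --> l.

Definition independent_increments (L : R -> {RV P >-> R}) : Prop :=
  forall (n : nat) (t : nat -> R) (A : nat -> set R),
    (forall i, (i < n)%N -> t i < t i.+1) ->
    (forall i, (i < n)%N -> measurable (A i)) ->
    fine (P [set w | forall i, (i < n)%N -> A i (L (t i.+1) w - L (t i) w)])
    = \prod_(i < n) fine (P [set w | A i (L (t i.+1) w - L (t i) w)]).

Definition stationary_increments (L : R -> {RV P >-> R}) : Prop :=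
  forall (s t h : R) (A : set R), s <= t -> measurable A ->
    P [set w | A (L (t + h) w - L (s + h) w)] = P [set w | A (L t w - L s w)].

Definition stochastically_continuous (L : R -> {RV P >-> R}) : Prop :=
  forall (t e : R), 0 < e ->
    P [set w | e < `|L s w - L t w|] @[s --> t] --> 0%E.

Definition levy_process (L : R -> {RV P >-> R}) : Prop :=
  [/\ {ae P, forall w, L 0 w = 0},
      independent_increments L,
      stationary_increments L,
      stochastically_continuous L &
      {ae P, forall w, cadlag (fun t => L t w)}].

(* A list of (c, (s, t)) with s <= t encodes the step function
   \sum c * \1_]s, t]; its integral against L is \sum c * (L t - L s). *)
Definition step_fun (u : seq (R * (R * R))) (x : R) : R :=
  \sum_(k <- u) k.1 * \1_(`]k.2.1, k.2.2]) x.

Definition step_integral (L : R -> {RV P >-> R}) (u : seq (R * (R * R))) (w : T)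
    : R :=
  \sum_(k <- u) k.1 * (L k.2.2 w - L k.2.1 w).

(* X = \int f(u) dL_u for a deterministic f, in the L^2 sense: X is the
   L^2(P)-limit of the integrals of step functions converging to f in L^2(R). *)
Definition is_levy_integral (L : R -> {RV P >-> R}) (f : R -> R)
    (X : {RV P >-> R}) : Prop :=
  measurable_fun setT f /\
  exists u : nat -> seq (R * (R * R)),
    [/\ forall n, all (fun k => k.2.1 <= k.2.2) (u n),
        (\int[lebesgue_measure]_x ((f x - step_fun (u n) x) ^+ 2)%:E)%E
          @[n --> \oo] --> 0%E &
        'E_P[fun w => ((X w - step_integral L (u n) w) ^+ 2)%R]%E
          @[n --> \oo] --> 0%E].

Definition white_noise (Z : int -> {RV P >-> R}) (v : R) : Prop :=
  [/\ forall n, 'E_P[Z n]%E = 0%E,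
      forall n, 'E_P[fun w => (Z n w ^+ 2)%R]%E = v%:E%E &
      forall m n, m != n -> 'E_P[fun w => (Z m w * Z n w)%R]%E = 0%E].

(* q(B) x at time n, B being the backward shift. *)
Definition backshift (K : nzRingType) (q : {poly K}) (x : int -> K) (n : int) : K :=
  \sum_(j < size q) q`_j * x (n - j%:Z).

Definition carma_process (L : R -> {RV P >-> R}) (a b : {poly R})
    (lam : seq R[i]) (Y : R -> {RV P >-> R}) : Prop :=
  forall t, is_levy_integral L (fun u => carma_kernel a b lam (t - u)) (Y t).

Definition ar_poly (lam : seq R[i]) (D : R) : {poly R[i]} :=
  \prod_(l <- lam) (1 - (expC (l * D%:C))%:P * 'X).

(* The filter ar_poly has real coefficients that are only available as elements
   of R[i], hence the embedding of both sides in R[i]. *)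
Definition sampled_ma_representation (p : nat) (lam : seq R[i])
    (Y : R -> {RV P >-> R}) (D : R)
    (theta : {poly R}) (Z : int -> {RV P >-> R}) (tau2 : R) : Prop :=
  [/\ (size theta <= p)%N,
      theta.[0] = 1,
      forall z : R[i], `|z| < 1 -> ~~ root (polyC_of theta) z,
      white_noise Z tau2 &
      forall n : int, {ae P, forall w,
        (backshift theta (fun k => Z k w) n)%:C
        = backshift (ar_poly lam D) (fun k => (Y (k%:~R * D) w)%:C) n}].

End Processes.

Section Asymptotics.
Variable R : realType.

Definition cvg_coefs (p : nat) (theta : R -> {poly R}) (q : {poly R}) : Prop :=
  forall j, (j < p)%N -> (theta D)`_j @[D --> 0^'+] --> q`_j.

Definition equiv0 (f g : R -> R) : Prop :=
  f D / g D @[D --> 0^'+] --> (1 : R).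

End Asymptotics.

(* Main.v *)
(* Put k = p - q.  Applying phi(B) to Y gives the integral of L against the
   kernel obtained by applying the filter to g, which is supported in ]0, pD].
   Since g(t) ~ t^(k-1)/(k-1)! at 0, rescaling the time by D makes this kernel
   converge to the spline whose value at m + x, 0 < x <= 1, is the coefficient
   of z^m in
     (1-z)^p \sum_j (j+x)^(k-1)/(k-1)! z^j = (1-z)^q N_x(z),
   N_x being a polynomial in z of degree at most k - 1.  By the Levy isometry,
   tau2 theta(1/z) theta(z), divided by sigma^2 D^(2k-1), tends to
     ((1-1/z) (1-z))^q \int_0^1 N_x(1/z) N_x(z) dx,
   which can be factored explicitly for k = 1, 2, 3.  The polynomials theta of
   bounded degree without zeroes in the open disc and with theta(0) = 1 form a
   compact set, on which theta(1/z) theta(z) determines theta even up to a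
   constant factor; so convergence of the products forces that of theta and
   tau2. *)

Set Warnings "-notation-overridden,-notation-incompatible-prefix,-ambiguous-paths".
Require Import Defs.
From mathcomp Require Import measurable_realfun.
From mathcomp Require Import ring lra zify.

Set Implicit Arguments.
Unset Strict Implicit.
Unset Printing Implicit Defensive.

Local Open Scope classical_set_scope.
Local Open Scope complex_scope.
Local Open Scope ring_scope.

(** * Power series of complex functions *)

(** The behaviour of g at 0 is read off at infinity. A partial fraction c/(z-l)^(j+1) of b/a
    contributes c t^j/j! e^(lt) to g, and the coefficient of t^n of this term is 1/n! times the
    coefficient of z^-(n+1) in the fraction. As b/a behaves like z^-k at infinity, g starts with
    t^(k-1)/(k-1)!. The filtered kernel vanishes beyond pD because each factor 1 - e^(lD) B lowers
    the degree of the polynomial in front of e^(lt), so the filter kills g as soon as all shifted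
    arguments are positive. The isometry needs E L_t = 0 and E L_t^2 = sigma^2 t for all t >= 0,
    while moments are given at t = 1 only. Independence yields square-integrability of shorter
    increments, and Cauchy's functional equation yields linearity in t, with stochastic continuity
    controlling the mean near 0. For k = 2 and 3 the integral of N_x(1/z) N_x(z) has the
    coefficients 1, 4, 1 over 3! and 1, 26, 66, 26, 1 over 5!, the values at the integers of the
    cardinal B-spline of order 2k. The constants of the theorem come from its factorization with
    zeroes outside the disc. *)

Section Modulus.
Variable R : realType.
Implicit Types z w : R[i].

(** The norm of [R[i]] takes values in [R[i]], which is only partially ordered; a real-valued
    version brings estimates within reach of [lra] and [nra]. *)
Definition modulus z : R := complex.Re `|z|.

Lemma modulusE z : (modulus z)%:C = `|z|.
Proof. exact: (RRe_real (normr_real z)). Qed.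

Lemma modulus_ge0 z : 0 <= modulus z.
Proof. by rewrite -lecR modulusE normr_ge0. Qed.

Lemma modulus0 : modulus 0 = 0.
Proof. by rewrite /modulus normr0. Qed.

Lemma modulus1 : modulus 1 = 1.
Proof. by rewrite /modulus normr1. Qed.

Lemma modulus_eq0 z : (modulus z == 0) = (z == 0).
Proof. by rewrite -[z == 0]normr_eq0 -modulusE -(inj_eq (@complexI R)). Qed.

Lemma modulus_gt0 z : (0 < modulus z) = (z != 0).
Proof. by rewrite lt0r modulus_ge0 andbT modulus_eq0. Qed.

Lemma modulusM z w : modulus (z * w) = modulus z * modulus w.
Proof. by apply: complexI; rewrite rmorphM /= !modulusE normrM. Qed.

Lemma modulusX z n : modulus (z ^+ n) = modulus z ^+ n.
Proof. by apply: complexI; rewrite rmorphXn /= !modulusE normrX. Qed.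

Lemma modulusV z : modulus z^-1 = (modulus z)^-1.
Proof. by apply: complexI; rewrite fmorphV /= !modulusE normfV. Qed.

Lemma modulusN z : modulus (- z) = modulus z.
Proof. by rewrite /modulus normrN. Qed.

Lemma ler_modulusD z w : modulus (z + w) <= modulus z + modulus w.
Proof. by rewrite -lecR rmorphD /= !modulusE ler_normD. Qed.

Lemma ler_modulusB z w : modulus (z - w) <= modulus z + modulus w.
Proof. by rewrite -[modulus w]modulusN ler_modulusD. Qed.

Lemma lerB_modulus z w : modulus z - modulus w <= modulus (z - w).
Proof. by rewrite lerBlDr -{1}(subrK w z) ler_modulusD. Qed.

Lemma modulus_real (x : R) : modulus x%:C = `|x|.
Proof. by rewrite /modulus normc_def /= expr0n addr0 sqrtr_sqr. Qed.

Lemma ler_modulus_sum I (r : seq I) (F : I -> R[i]) :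
  modulus (\sum_(i <- r) F i) <= \sum_(i <- r) modulus (F i).
Proof.
elim: r => [|i r IH]; first by rewrite !big_nil modulus0.
by rewrite !big_cons (le_trans (ler_modulusD _ _)) // lerD2l.
Qed.

Lemma ler_Re_modulus z : `|complex.Re z| <= modulus z.
Proof.
by case: z => a b; rewrite /modulus normc_def /= -sqrtr_sqr ler_wsqrtr // lerDl sqr_ge0.
Qed.

Lemma ler_Im_modulus z : `|complex.Im z| <= modulus z.
Proof.
by case: z => a b; rewrite /modulus normc_def /= -sqrtr_sqr ler_wsqrtr // lerDr sqr_ge0.
Qed.

Lemma ler_modulus_ReIm z : modulus z <= `|complex.Re z| + `|complex.Im z|.
Proof.
rewrite {1}[z]complexE (le_trans (ler_modulusD _ _)) // modulus_real lerD2l.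
rewrite modulusM modulus_real ler_piMl // /modulus normc_def /=.
by rewrite expr0n expr1n add0r sqrtr1.
Qed.

End Modulus.

Section PowerSeries.
Variable R : realType.
Implicit Types (f g : R[i] -> R[i]) (u v : nat -> R[i]).

(* Near 0, but not necessarily at 0, the function f is the sum of the power
   series with coefficients u; the geometric bound on the remainder is
   equivalent to convergence and is what the closure properties use. *)
Definition expands f u : Prop := exists C K : R, 0 < K /\ forall w, w != 0 -> K * modulus w < 1 ->
  forall N, modulus (f w - \sum_(n < N) u n * w ^+ n) <= C * (K * modulus w) ^+ N.

(** Two expansions come with different constants; this moves both to a common [K']. The absolute
    value appears because [C] is not assumed to be nonnegative. *)
Lemma expands_weaken f (C K K' : R) u w N : 0 < K -> K <= K' ->
  K' * modulus w < 1 ->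
  (K * modulus w < 1 ->
    modulus (f w - \sum_(n < N) u n * w ^+ n) <= C * (K * modulus w) ^+ N) ->
  modulus (f w - \sum_(n < N) u n * w ^+ n) <= `|C| * (K' * modulus w) ^+ N.
Proof.
move=> K0 KK' K'w /(_ _)/le_trans; apply.
  by rewrite (le_lt_trans _ K'w) // ler_wpM2r ?modulus_ge0.
have Kw0 : 0 <= K * modulus w by rewrite mulr_ge0 ?modulus_ge0 // ltW.
rewrite (@le_trans _ _ (`|C| * (K * modulus w) ^+ N)) //.
  by rewrite ler_wpM2r ?ler_norm ?exprn_ge0.
have Kw' : K * modulus w <= K' * modulus w by rewrite ler_wpM2r ?modulus_ge0.
by rewrite ler_wpM2l ?normr_ge0 // lerXn2r ?nnegrE // (le_trans Kw0).
Qed.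

Lemma expands_ext_near f g u (K0 : R) : 0 < K0 ->
  (forall w, w != 0 -> K0 * modulus w < 1 -> f w = g w) ->
  expands f u -> expands g u.
Proof.
move=> K00 fg [C [K [K_gt0 H]]].
exists `|C|, (Num.max K0 K); split; first by rewrite lt_max K00.
move=> w w0 Kw N; rewrite -fg //; last first.
  by rewrite (le_lt_trans _ Kw) // ler_wpM2r ?modulus_ge0 // le_max lexx.
by apply: (expands_weaken K_gt0) => //; [rewrite le_max lexx orbT|move=> *; exact: H].
Qed.

Lemma expands_ext f g u : (forall w, w != 0 -> f w = g w) ->
  expands f u -> expands g u.
Proof.
move=> fg [C [K [K0 H]]]; exists C, K; split => // w w0 Kw N.
by rewrite -fg //; exact: H.
Qed.

Lemma expands_eq_coef f u v : u =1 v -> expands f u -> expands f v.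
Proof.
move=> uv [C [K [K0 H]]]; exists C, K; split => // w w0 Kw N.
by under eq_bigr do rewrite -uv; exact: H.
Qed.

Lemma expands0 : expands (fun=> 0) (fun=> 0).
Proof.
exists 0, 1; split => // w _ _ N.
by rewrite big1 ?subrr ?modulus0 ?mul0r// => i _; rewrite mul0r.
Qed.

Lemma expandsD f g u v : expands f u -> expands g v ->
  expands (fun w => f w + g w) (fun n => u n + v n).
Proof.
move=> [C [K [K0 H]]] [C' [K' [K'0 H']]].
exists (`|C| + `|C'|), (Num.max K K'); split; first by rewrite lt_max K0.
move=> w w0 Kw N.
under eq_bigr do rewrite mulrDl.
rewrite big_split /= opprD addrACA (le_trans (ler_modulusD _ _)) // mulrDl lerD //.
- by apply: (expands_weaken K0) => //; [rewrite le_max lexx|move=> *; exact: H].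
- by apply: (expands_weaken K'0) => //; [rewrite le_max lexx orbT|move=> *; exact: H'].
Qed.

Lemma expandsZ c f u : expands f u ->
  expands (fun w => c * f w) (fun n => c * u n).
Proof.
move=> [C [K [K0 H]]]; exists (modulus c * C), K; split => // w w0 Kw N.
under eq_bigr do rewrite -mulrA.
by rewrite -mulr_sumr -mulrBr modulusM -mulrA ler_wpM2l ?modulus_ge0 ?H.
Qed.

Lemma expands_sum (I : eqType) (r : seq I) (F : I -> R[i] -> R[i]) (U : I -> nat -> R[i]) :
  (forall i, i \in r -> expands (F i) (U i)) ->
  expands (fun w => \sum_(i <- r) F i w) (fun n => \sum_(i <- r) U i n).
Proof.
elim: r => [|i r IH] FU.
  apply: (@expands_ext (fun=> 0)) => [w _|]; first by rewrite big_nil.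
  by apply: expands_eq_coef expands0 => n; rewrite big_nil.
apply: (@expands_ext (fun w => F i w + \sum_(j <- r) F j w)) => [w _|].
  by rewrite big_cons.
apply: (@expands_eq_coef _ (fun n => U i n + \sum_(j <- r) U j n)) => [n|].
  by rewrite big_cons.
apply: expandsD; first by apply: FU; rewrite mem_head.
by apply: IH => j jr; apply: FU; rewrite inE jr orbT.
Qed.

Definition shift_coef u n := if n is n'.+1 then u n' else 0.

Lemma expands_mulX f u : expands f u ->
  expands (fun w => w * f w) (shift_coef u).
Proof.
move=> [C [K [K0 H]]]; exists (C / K), K; split => // w w0 Kw [|N].
  have := H w w0 Kw 0%N; rewrite !big_ord0 !subr0 expr0 !mulr1 modulusM => fC.
  rewrite ler_pdivlMr // mulrC mulrA (le_trans _ fC) // ler_piMl ?modulus_ge0 //.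
  exact: ltW.
rewrite big_ord_recl /= mul0r add0r.
under eq_bigr do rewrite exprS mulrCA.
rewrite -mulr_sumr -mulrBr modulusM exprS.
have -> : C / K * (K * modulus w * (K * modulus w) ^+ N)
  = modulus w * (C * (K * modulus w) ^+ N).
  by rewrite !mulrA mulfVK ?gt_eqF // -!mulrA mulrCA !mulrA.
by rewrite ler_wpM2l ?modulus_ge0 // H.
Qed.

(** A Cauchy estimate without contour integrals: [u n * w ^+ n] is the difference of two consecutive
    remainders at one fixed point. *)
Lemma expands_coef_bound f u : expands f u ->
  exists C K : R, 0 < K /\ forall n, modulus (u n) <= C * K ^+ n.
Proof.
move=> [C [K [K0 H]]]; exists (2 * C), K; split => // n.
(* With K |w| = 1/2, the two remainders add up to at most 2 C (K |w|)^n, and the powers of |w|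
   cancel. *)
pose w : R[i] := (K^-1 / 2)%:C.
have w0 : w != 0.
  by rewrite -modulus_eq0 modulus_real normr_eq0 mulf_neq0 ?invr_eq0 ?pnatr_eq0 ?gt_eqF.
have mw : modulus w = K^-1 / 2 by rewrite modulus_real ger0_norm // divr_ge0 // invr_ge0 ltW.
have Kw : K * modulus w = 2^-1 by rewrite mw mulrA divff ?mul1r // gt_eqF.
have Kw1 : K * modulus w < 1 by rewrite Kw; lra.
have := lerD (H w w0 Kw1 n) (H w w0 Kw1 n.+1).
move/(le_trans (ler_modulusB _ _)).
rewrite big_ord_recr /=; set S := \sum_(_ < _) _; set t := u n * _.
have -> : f w - S - (f w - (S + t)) = t by ring.
rewrite modulusM modulusX => Hn.
have wn0 : 0 < modulus w ^+ n by rewrite exprn_gt0 // modulus_gt0.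
rewrite -(ler_pM2r wn0) (le_trans Hn) // exprS Kw.
have C0 : 0 <= C.
  have := H w w0 Kw1 0%N; rewrite expr0 mulr1; exact: le_trans (modulus_ge0 _).
rewrite -[leRHS]mulrA -exprMn Kw.
have : 0 <= (2^-1 : R) ^+ n by rewrite exprn_ge0.
by set x := _ ^+ n => x0; nra.
Qed.

(** The coefficients of the quotient of a power series by 1 - c w. *)
Fixpoint geom_coef c u n := if n is n'.+1 then u n + c * geom_coef c u n' else u 0%N.

Lemma geom_coef_sum c u w N :
  (\sum_(n < N.+1) geom_coef c u n * w ^+ n) * (1 - c * w) =
  \sum_(n < N.+1) u n * w ^+ n - c * geom_coef c u N * w ^+ N.+1.
Proof.
elim: N => [|N IH]; first by rewrite !big_ord_recr !big_ord0 /= !expr0 expr1; ring.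
rewrite big_ord_recr [in RHS]big_ord_recr /= mulrDl IH [w ^+ N.+2]exprS; ring.
Qed.

(** By [geom_coef_sum], a partial sum of the quotient times 1 - c w is a partial sum of [f] up to
    one boundary term, which the growth bound on the new coefficients controls. *)
Lemma expands_geom c f u : expands f u ->
  expands (fun w => f w / (1 - c * w)) (geom_coef c u).
Proof.
move=> fu; have [C0 [K0 [K00 uC]]] := expands_coef_bound fu.
have [C [K [K_gt0 H]]] := fu.
have C00 : 0 <= C0.
  by have := uC 0%N; rewrite expr0 mulr1; exact: le_trans (modulus_ge0 _).
(* [M] dominates [K] and [K0]; M >= 2|c| closes the induction in [vM] and gives |c w| <= 1/2, hence
   |1 - c w| >= 1/2. *)
pose M := Num.max (Num.max K (2 * K0)) (Num.max 1 (2 * modulus c)).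
have M1 : 1 <= M by rewrite !le_max lexx !orbT.
have M0 : 0 < M by exact: lt_le_trans M1.
have MK : K <= M by rewrite !le_max lexx.
have MK0 : 2 * K0 <= M by rewrite !le_max lexx orbT.
have Mc : 2 * modulus c <= M by rewrite !le_max lexx !orbT.
have vM n : modulus (geom_coef c u n) <= 2 * C0 * M ^+ n.
  elim: n => [|n IH] /=.
    have := uC 0%N; rewrite !expr0 !mulr1 => /le_trans; apply; nra.
  rewrite (le_trans (ler_modulusD _ _)) // modulusM.
  have un : modulus (u n.+1) <= C0 * M ^+ n.+1.
    rewrite (le_trans (uC _)) // ler_wpM2l // lerXn2r ?nnegrE //; [exact: ltW|exact: ltW|].
    by nra.
  have Mn : 0 <= M ^+ n by rewrite exprn_ge0 // ltW.
  have : modulus c * modulus (geom_coef c u n) <= (M / 2) * (2 * C0 * M ^+ n).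
    by rewrite ler_pM ?modulus_ge0 //; nra.
  move: un; rewrite exprS; nra.
exists (2 * (`|C| + C0 * M)), M; split => // w w0 Mw N.
have mw0 : 0 < modulus w by rewrite modulus_gt0.
have fN : modulus (f w - \sum_(n < N) u n * w ^+ n) <= `|C| * (M * modulus w) ^+ N.
  by apply: (expands_weaken K_gt0) => // Kw; exact: H.
have cw : modulus (c * w) <= 2^-1 by rewrite modulusM; nra.
have dw : 2^-1 <= modulus (1 - c * w).
  by have := lerB_modulus 1 (c * w); rewrite modulus1; lra.
have d0 : 1 - c * w != 0 by rewrite -modulus_gt0; lra.
have q0 : 0 <= (M * modulus w) ^+ N by rewrite exprn_ge0 // mulr_ge0 ?modulus_ge0 // ltW.
suff num : modulus (f w - (\sum_(n < N) geom_coef c u n * w ^+ n) * (1 - c * w))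
    <= (`|C| + C0 * M) * (M * modulus w) ^+ N.
  rewrite -[X in _ - X](mulfK d0) -mulrBl modulusM modulusV ler_pdivrMr; last lra.
  rewrite (le_trans num) //.
  have S0 : 0 <= `|C| + C0 * M by rewrite addr_ge0 // mulr_ge0 // ltW.
  have := mulr_ge0 S0 q0; nra.
case: N fN q0 => [|N] fN q0.
  rewrite big_ord0 mul0r; move: fN; rewrite big_ord0 expr0 !mulr1 => /le_trans; apply.
  by rewrite lerDl mulr_ge0 // ltW.
rewrite geom_coef_sum opprD opprK addrA (le_trans (ler_modulusD _ _)) // mulrDl.
rewrite lerD // !modulusM modulusX exprMn [in leRHS]exprS !mulrA ler_wpM2r ?exprn_ge0 ?modulus_ge0 //.
have := vM N; have := modulus_ge0 c; have := modulus_ge0 (geom_coef c u N).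
have : 0 <= M ^+ N by rewrite exprn_ge0 // ltW.
set x := modulus _; set y := M ^+ N; set z := modulus c => y0 x0 z0 xy.
have Cy : 0 <= C0 * M * y by rewrite !mulr_ge0 // ltW.
apply: (@le_trans _ _ (M / 2 * (2 * C0 * y))); last nra.
by rewrite ler_pM //; nra.
Qed.

(** Once the lower coefficients vanish, the bound for N = n+1 reads |u_n| <= C K^(n+1) |w|, and |w|
    is arbitrarily small. *)
Lemma expands_zero_coef u : expands (fun=> 0) u -> u =1 (fun=> 0).
Proof.
move=> [C [K [K0 H]]] n; elim/ltn_ind: n => n IH.
apply/eqP; rewrite -modulus_eq0; apply/eqP/le_anti; rewrite modulus_ge0 andbT.
apply/ler_addgt0Pr => e e0; rewrite add0r.
pose D := 1 + `|C| * K ^+ n.+1.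
have D0 : 1 <= D by rewrite lerDl mulr_ge0 // exprn_ge0 // ltW.
pose x := Num.min (e / D) (K^-1 / 2).
have x0 : 0 < x by rewrite lt_min !divr_gt0 ?invr_gt0 //; lra.
have mx : modulus x%:C = x by rewrite modulus_real ger0_norm // ltW.
have w0 : x%:C != 0 by rewrite -modulus_eq0 mx gt_eqF.
have Kx : K * modulus x%:C < 1.
  rewrite mx (@le_lt_trans _ _ (K * (K^-1 / 2))) //.
    by rewrite ler_pM2l // /x; rewrite ge_min; apply/orP; right.
  by rewrite mulrA divff ?gt_eqF //; lra.
have := H _ w0 Kx n.+1.
rewrite big_ord_recr /= big1 => [|i _]; last by rewrite IH ?mul0r.
rewrite !add0r modulusN modulusM modulusX mx exprMn [x ^+ n.+1]exprS.
have xn : 0 < x ^+ n by rewrite exprn_gt0.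
have xe : x * D <= e by rewrite -ler_pdivlMr ?ge_min ?lexx //; lra.
have -> : C * (K ^+ n.+1 * (x * x ^+ n)) = C * K ^+ n.+1 * x * x ^+ n by ring.
rewrite ler_pM2r // => /le_trans; apply; apply: le_trans xe.
rewrite [x * D]mulrC ler_pM2r // /D.
have : C * K ^+ n.+1 <= `|C| * K ^+ n.+1.
  by rewrite ler_wpM2r ?ler_norm // exprn_ge0 // ltW.
by lra.
Qed.

Lemma expands_unique f u v : expands f u -> expands f v -> u =1 v.
Proof.
move=> fu fv n.
have : expands (fun=> 0) (fun n => u n - v n).
  apply: (@expands_ext (fun w => f w + -1 * f w)) => [w _|].
    by rewrite mulN1r subrr.
  by apply: expands_eq_coef (expandsD fu (expandsZ (-1) fv)) => k; rewrite mulN1r.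
by move/expands_zero_coef/(_ n)/eqP; rewrite subr_eq0 => /eqP.
Qed.

End PowerSeries.

Arguments shift_coef {R} u n.

(** * The complex exponential *)

Section Exponential.
Variable R : realType.
Implicit Types z w : R[i].

Lemma expCD z w : expC (z + w) = expC z * expC w.
Proof.
case: z => a b; case: w => c d; rewrite /expC /= expRD cosD sinD.
by simpc; congr Complex; ring.
Qed.

Lemma is_derive_expn n (s : R) :
  is_derive s 1 (fun x : R => x ^+ n) (n%:R * s ^+ n.-1).
Proof.
elim: n => [|n IH].
  rewrite mul0r; under eq_fun do rewrite expr0; exact: is_derive_cst.
have -> : (fun x : R => x ^+ n.+1) = (@idfun R) * (fun x => x ^+ n).
  by apply/funext => x; rewrite exprS.
apply: (is_derive_eq (is_deriveM (is_derive_id _ _) IH)).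
rewrite /GRing.scale /= mulr1; case: n {IH} => [|n] /=; first by rewrite mul0r mulr0 add0r expr0 mulr1.
by rewrite exprS -[in RHS]natr1; ring.
Qed.

Lemma is_derive_mulc (k : R) (f : R -> R) (s df : R) :
  is_derive s 1 f df -> is_derive s 1 (fun x => k * f x) (k * df).
Proof. exact: is_deriveZ. Qed.

Lemma is_derive_taylor_sum (c : nat -> R) N (s : R) :
  is_derive s 1 (fun x => \sum_(n < N.+1) c n * (x ^+ n / n`!%:R))
    (\sum_(n < N) c n.+1 * (s ^+ n / n`!%:R)).
Proof.
elim: N => [|N IH].
  rewrite big_ord0; under eq_fun do rewrite big_ord_recr big_ord0 /= add0r expr0.
  exact: is_derive_cst.
rewrite big_ord_recr /=; under eq_fun do rewrite big_ord_recr /=.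
apply: is_deriveD; apply: is_derive_mulc.
have -> : (fun x : R => x ^+ N.+1 / (N.+1)`!%:R)
    = (fun x => ((N.+1)`!%:R)^-1 * x ^+ N.+1).
  by apply/funext => x; rewrite mulrC.
apply: (is_derive_eq (is_derive_mulc _ (is_derive_expn _ _))).
by rewrite factS natrM invfM /= mulrACA mulVf ?pnatr_eq0 // mul1r mulrC.
Qed.

Definition taylor_rem (e : R -> R) (c : nat -> R) N (s : R) : R :=
  e s - \sum_(n < N) c n * (s ^+ n / n`!%:R).

Lemma is_derive_taylor_rem (e : R -> R) c N (s de : R) :
  is_derive s 1 e de ->
  is_derive s 1 (taylor_rem e c N.+1) (de - \sum_(n < N) c n.+1 * (s ^+ n / n`!%:R)).
Proof. by move=> ed; apply: is_deriveB => //; exact: is_derive_taylor_sum. Qed.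

Lemma mvt_bound (h dh : R -> R) (B s : R) : h 0 = 0 -> 0 <= s ->
  (forall x : R, is_derive x 1 h (dh x)) ->
  (forall x, 0 <= x <= s -> `|dh x| <= B) -> `|h s| <= B * s.
Proof.
move=> h0 s0 hd dB.
have hc : {within `[0, s], continuous h}.
  by apply: derivable_within_continuous => x _; have [] := hd x.
have [c cs] := MVT_segment s0 (fun x _ => hd x) hc.
rewrite h0 !subr0 => ->; rewrite normrM (ger0_norm s0) ler_wpM2r // dB //.
Qed.

(** Since e^(sz) has derivative z e^(sz), the remainder of order N+1 has as derivative z times the
    remainder of order N. This mixes real and imaginary parts, so both are bounded in one induction
    by the mean value theorem. The factorial is given up because [expands] asks for geometric bounds
    only. *)
Lemma expC_taylor (a b s : R) N : 0 <= s <= 1 ->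
  `|taylor_rem (fun s => expR (s * a) * cos (s * b))
      (fun n => complex.Re ((a +i* b) ^+ n)) N s| <= expR `|a| * (`|a| + `|b|) ^+ N * s ^+ N /\
  `|taylor_rem (fun s => expR (s * a) * sin (s * b))
      (fun n => complex.Im ((a +i* b) ^+ n)) N s| <= expR `|a| * (`|a| + `|b|) ^+ N * s ^+ N.
Proof.
elim: N s => [|N IH] s /andP[s0 s1].
  rewrite /taylor_rem !big_ord0 !subr0 !expr0 !mulr1.
  have es : `|expR (s * a)| <= expR `|a|.
    rewrite ger0_norm ?expR_ge0 // ler_expR.
    by rewrite (le_trans (ler_norm _)) // normrM ger0_norm // ler_piMl.
  by split; rewrite normrM -[leRHS]mulr1 ler_pM ?normr_ge0 //
    ler_norml ?cos_geN1 ?cos_le1 ?sin_geN1 ?sin_le1.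
pose ec t := expR (t * a) * cos (t * b); pose es t := expR (t * a) * sin (t * b).
have dm (k x : R) : is_derive x 1 (fun t : R => t * k) k.
  have -> : (fun t : R => t * k) = (fun t => k * t) by apply/funext => t; rewrite mulrC.
  by apply: (is_derive_eq (is_derive_mulc k (is_derive_id x 1))); rewrite mulr1.
have dE (x : R) : is_derive x 1 (fun t : R => expR (t * a)) (expR (x * a) * a).
  exact: (is_derive1_comp (is_derive_expR _) (dm a x)).
have dC (x : R) : is_derive x 1 (fun t : R => cos (t * b)) (- sin (x * b) * b).
  exact: (is_derive1_comp (is_derive_cos _) (dm b x)).
have dS (x : R) : is_derive x 1 (fun t : R => sin (t * b)) (cos (x * b) * b).
  exact: (is_derive1_comp (is_derive_sin _) (dm b x)).
have dec (x : R) : is_derive x 1 ec (a * ec x - b * es x).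
  apply: (is_derive_eq (is_deriveM (dE x) (dC x))).
  by rewrite /GRing.scale /= /ec /es; ring.
have des (x : R) : is_derive x 1 es (b * ec x + a * es x).
  apply: (is_derive_eq (is_deriveM (dE x) (dS x))).
  by rewrite /GRing.scale /= /ec /es; ring.
pose B := expR `|a| * (`|a| + `|b|) ^+ N.+1 * s ^+ N.
have B0 : 0 <= expR `|a| * (`|a| + `|b|) ^+ N.
  by rewrite mulr_ge0 ?expR_ge0 ?exprn_ge0 ?addr_ge0.
have bound (u v x : R) : 0 <= x <= s ->
    `|u| <= expR `|a| * (`|a| + `|b|) ^+ N * x ^+ N ->
    `|v| <= expR `|a| * (`|a| + `|b|) ^+ N * x ^+ N -> `|a| * `|u| + `|b| * `|v| <= B.
  move=> /andP[x0 xs] hu hv.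
  have xN : x ^+ N <= s ^+ N by rewrite lerXn2r ?nnegrE.
  have {}hu := le_trans hu (ler_wpM2l B0 xN).
  have {}hv := le_trans hv (ler_wpM2l B0 xN).
  have := lerD (ler_wpM2l (normr_ge0 a) hu) (ler_wpM2l (normr_ge0 b) hv).
  by move/le_trans; apply; rewrite /B exprS -mulrDl !mulrA [(_ + _) * expR _]mulrC.
have rs x : 0 <= x <= s -> 0 <= x <= 1.
  by move=> /andP[-> xs] /=; exact: le_trans s1.
have BE : expR `|a| * (`|a| + `|b|) ^+ N.+1 * s ^+ N.+1 = B * s.
  by rewrite /B [s ^+ N.+1]exprSr mulrA.
have rem0 e c : e 0 = c 0%N -> taylor_rem e c N.+1 0 = 0.
  move=> e0; rewrite /taylor_rem big_ord_recl /= expr0 fact0 divr1 mulr1 e0.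
  by rewrite big1 ?addr0 ?subrr // => i _; rewrite exprS !mul0r mulr0.
rewrite !BE; split.
  apply: (mvt_bound _ s0 (fun x => is_derive_taylor_rem _ _ (dec x))).
    by apply: rem0; rewrite /ec /es !mul0r expR0 cos0 mulr1 expr0.
  move=> x xs; have [hu hv] := IH x (rs x xs).
  apply: le_trans (bound _ _ _ xs hu hv).
  rewrite -!normrM -[X in _ <= _ + X]normrN (le_trans _ (ler_normD _ _)) //.
  rewrite le_eqVlt; apply/orP; left; apply/eqP; congr `|_|.
  rewrite /taylor_rem !mulrBr !mulr_sumr -/(ec x) -/(es x).
  have -> : \sum_(n < N) complex.Re ((a +i* b) ^+ n.+1) * (x ^+ n / n`!%:R) =
    \sum_(n < N) a * (complex.Re ((a +i* b) ^+ n) * (x ^+ n / n`!%:R)) -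
    \sum_(n < N) b * (complex.Im ((a +i* b) ^+ n) * (x ^+ n / n`!%:R)).
    by rewrite -sumrB; apply: eq_bigr => i _; rewrite exprS; case: (_ ^+ i) => c d /=; ring.
  ring.
apply: (mvt_bound _ s0 (fun x => is_derive_taylor_rem _ _ (des x))).
  by apply: rem0; rewrite /ec /es !mul0r expR0 sin0 mulr0 expr0.
move=> x xs; have [hu hv] := IH x (rs x xs).
have := bound _ _ _ xs hv hu; apply: le_trans.
rewrite -!normrM (le_trans _ (ler_normD _ _)) //.
rewrite le_eqVlt; apply/orP; left; apply/eqP; congr `|_|.
rewrite /taylor_rem !mulrBr !mulr_sumr -/(ec x) -/(es x).
have -> : \sum_(n < N) complex.Im ((a +i* b) ^+ n.+1) * (x ^+ n / n`!%:R) =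
  \sum_(n < N) b * (complex.Re ((a +i* b) ^+ n) * (x ^+ n / n`!%:R)) +
  \sum_(n < N) a * (complex.Im ((a +i* b) ^+ n) * (x ^+ n / n`!%:R)).
  by rewrite -big_split; apply: eq_bigr => i _; rewrite exprS; case: (_ ^+ i) => c d /=; ring.
ring.
Qed.

Lemma expands_expC (l : R[i]) : expands (fun w => expC (l * w)) (fun n => l ^+ n / n`!%:R).
Proof.
(* The factor 2 pays for |Re z| + |Im z| <= 2 |z|, and the summand 1 keeps [K] positive when [l] is
   0. *)
pose K := 2 * modulus l + 1.
have K0 : 0 < K by have := modulus_ge0 l; rewrite /K; lra.
exists (2 * expR 1), K; split => // w w0 Kw N.
have -> : \sum_(n < N) l ^+ n / n`!%:R * w ^+ n = \sum_(n < N) (l * w) ^+ n / n`!%:R.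
  by apply: eq_bigr => i _; rewrite exprMn mulrAC.
have : 2 * modulus (l * w) <= K * modulus w.
  by rewrite modulusM mulrA ler_wpM2r ?modulus_ge0 // /K; lra.
move: (l * w) => z zK.
have z1 : 2 * modulus z < 1 by exact: le_lt_trans Kw.
case: z zK z1 => a b zK z1.
have ha := ler_Re_modulus (a +i* b); have hb := ler_Im_modulus (a +i* b).
rewrite /= in ha hb.
have [|hc hs] := @expC_taylor a b 1 N; first by rewrite lexx ler01.
set z := a +i* b in ha hb hc hs zK z1 *; set S := \sum_(_ < _) _.
have split_sum : S = (\sum_(n < N) complex.Re (z ^+ n) * (1 ^+ n / n`!%:R))
    +i* (\sum_(n < N) complex.Im (z ^+ n) * (1 ^+ n / n`!%:R)).
  rewrite /S; elim: N {hc hs S} => [|N IH]; first by rewrite !big_ord0.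
  rewrite !big_ord_recr /= IH /= expr1n mul1r.
  have -> : (N`!%:R : R[i])^-1 = ((N`!%:R)^-1)%:C by rewrite fmorphV rmorph_nat.
  by case: (z ^+ N) => c d; simpc.
rewrite (le_trans (ler_modulus_ReIm _)) // split_sum /=.
have bnd : expR `|a| * (`|a| + `|b|) ^+ N * 1 ^+ N <= expR 1 * (K * modulus w) ^+ N.
  rewrite expr1n mulr1 ler_pM ?expR_ge0 ?exprn_ge0 ?addr_ge0 //.
    by rewrite ler_expR; lra.
  have sz : `|a| + `|b| <= K * modulus w by lra.
  by rewrite lerXn2r ?nnegrE ?addr_ge0 // (le_trans _ sz) ?addr_ge0.
have := le_trans hc bnd; have := le_trans hs bnd.
rewrite /taylor_rem !mul1r -/z; lra.
Qed.

End Exponential.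

(** * Residues *)

Section Residues.
Variable R : realType.
Implicit Types (f F : R[i] -> R[i]) (u : nat -> R[i]) (z w : R[i]).

Lemma complex_gt0 (e : R[i]) : 0 < e -> e = (complex.Re e)%:C /\ 0 < complex.Re e.
Proof. by case: e => a b; rewrite ltcE /= => /andP[/eqP ->]. Qed.

Lemma expands_cvg f u (z0 : R[i]^o) : expands f u ->
  \forall z \near z0^', series (fun n => u n * (z - z0) ^+ n : R[i]^o) @ \oo -->
    (f (z - z0) : R[i]^o).
Proof.
move=> [C [K [K0 H]]].
rewrite near_withinE. exists (K^-1)%:C => /=; first by rewrite ltcR invr_gt0.
move=> z /=; rewrite -normrN opprB -modulusE ltcR => zK zz0.
have w0 : z - z0 != 0 by rewrite subr_eq0.
have Kw : K * modulus (z - z0) < 1 by rewrite mulrC -ltr_pdivlMr // div1r.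
apply/cvgrPdist_le => e /complex_gt0[-> e0].
have [N _ HN] : \forall N \near \oo, `|C| * (K * modulus (z - z0)) ^+ N <= complex.Re e.
  have : (fun N => `|C| * (K * modulus (z - z0)) ^+ N) @ \oo --> `|C| * 0.
    apply: cvgMr; apply: cvg_expr.
    by rewrite ger0_norm // mulr_ge0 ?modulus_ge0 // ltW.
  rewrite mulr0 => /cvgrPdist_le/(_ _ e0); apply: filterS => N.
  by rewrite sub0r normrN => /(le_trans _); apply; rewrite ler_norm.
exists N => // n /= Nn; rewrite -modulusE lecR /series /= big_mkord.
apply: le_trans (HN n Nn).
apply: le_trans (H _ w0 Kw n) _.
by rewrite ler_wpM2r ?ler_norm ?exprn_ge0 // mulr_ge0 ?modulus_ge0 // ltW.
Qed.

(** Convergence at the single point [r] bounds |u_n| r^n by some [B]; for |w| <= r/2 the tails are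
    then dominated by a geometric series of ratio |w|/r <= 1/2. *)
Lemma cvg_expands (F : R[i]^o -> R[i]^o) u (z0 : R[i]^o) :
  (\forall z \near z0^', series (fun n => u n * (z - z0) ^+ n : R[i]^o) @ \oo -->
    F (z - z0)) -> expands F u.
Proof.
rewrite near_withinE => /nbhs_normP[e /= /complex_gt0[ee e0]] H; rewrite ee in H.
pose r := complex.Re e / 2.
have r0 : 0 < r by rewrite /r; lra.
have rc : r%:C != 0 :> R[i] by rewrite -modulus_eq0 modulus_real normr_eq0 gt_eqF.
have mr : modulus r%:C = r by rewrite modulus_real ger0_norm // ltW.
have Hw w : w != 0 -> modulus w < complex.Re e ->
    series (fun n => u n * w ^+ n : R[i]^o) @ \oo --> F w.
  move=> w0 we; have := H (z0 + w).
  rewrite /ball_ /= opprD addrA subrr sub0r normrN -modulusE ltcR => /(_ we).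
  have -> : z0 + w - z0 = w by rewrite addrC addrA addNr add0r.
  by apply; apply: contra w0 => /eqP /(canRL (addKr _)); rewrite addNr => ->.
have [B HB] : exists B, forall n, modulus (u n) * r ^+ n <= B.
  have /Hw-/(_ rc) : modulus r%:C < complex.Re e by rewrite mr /r; lra.
  move=> cv.
  have /cvg_seq_bounded[M [Mr HM]] : cvgn (series (fun n => u n * r%:C ^+ n : R[i]^o)).
    by apply/cvg_ex; eexists; exact: cv.
  have [M' M'0 HM'] : exists2 M' : R, 0 <= M' & forall n,
      modulus (series (fun n => u n * r%:C ^+ n : R[i]^o) n) <= M'.
    exists (modulus M + 1); first by rewrite addr_ge0 ?modulus_ge0.
    move=> n; rewrite -lecR modulusE; apply: HM => //.
    rewrite rmorphD /= modulusE rmorph1; apply: le_lt_trans (real_ler_norm _) _ => //.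
    by rewrite ltrDl.
  exists (M' + M') => n.
  rewrite -mr -modulusX -modulusM.
  have -> : u n * r%:C ^+ n = series (fun n => u n * r%:C ^+ n : R[i]^o) n.+1
      - series (fun n => u n * r%:C ^+ n : R[i]^o) n.
    by rewrite seriesSB.
  by rewrite (le_trans (ler_modulusB _ _)) // lerD.
have B0 : 0 <= B.
  by have := HB 0%N; rewrite expr0 mulr1; exact: le_trans (modulus_ge0 _).
exists (2 * B), (2 / r); split; first by rewrite divr_gt0.
move=> w w0; rewrite mulrAC => wr N.
pose x := modulus w / r.
have x0 : 0 <= x by rewrite divr_ge0 ?modulus_ge0 // ltW.
have x2 : x <= 2^-1.
  by move: wr; rewrite /x -mulrA; set y := modulus w / r; lra.
have we : modulus w < complex.Re e.
  have : modulus w = x * r by rewrite /x mulfVK // gt_eqF.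
  move: x2; rewrite /r; nra.
pose S n := \sum_(k < n) u k * w ^+ k.
have ux n : modulus (u n * w ^+ n) <= B * x ^+ n.
  rewrite modulusM modulusX.
  have -> : modulus w ^+ n = r ^+ n * x ^+ n.
    by rewrite -exprMn /x mulrCA mulfV ?mulr1 // gt_eqF.
  by rewrite mulrA ler_wpM2r ?exprn_ge0.
(* The factor 1 - 2^-k grows by exactly the 2^-(k+1) that the next term needs, and stays below 1 in
   the limit. *)
have SN k : modulus (S (N + k)%N - S N) <= 2 * B * x ^+ N * (1 - 2^-1 ^+ k).
  elim: k => [|k IH]; first by rewrite addn0 !subrr modulus0 mulr0.
  rewrite addnS {1}/S big_ord_recr /= -/(S _) addrAC (le_trans (ler_modulusD _ _)) //.
  have h := lerD IH (ux (N + k)%N); rewrite (le_trans h) //.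
  have xk : x ^+ k <= 2^-1 ^+ k by rewrite lerXn2r ?nnegrE // ?invr_ge0.
  have Bx : 0 <= B * x ^+ N by rewrite mulr_ge0 ?exprn_ge0.
  rewrite exprD [2^-1 ^+ k.+1]exprS mulrA.
  have := ler_wpM2l Bx xk; set X := _ ^+ k; set Y := _ ^+ k; lra.
have -> : 2 * modulus w / r = 2 * x by rewrite /x mulrA.
apply: (@le_trans _ _ (2 * B * x ^+ N)); last first.
  have xx : x <= 2 * x by lra.
  by rewrite ler_wpM2l ?mulr_ge0 // lerXn2r ?nnegrE // (le_trans x0 xx).
apply/ler_addgt0Pr => d d0.
have /cvgrPdist_le/(_ d%:C) := Hw w w0 we.
rewrite ltcR => /(_ d0)[M _ /(_ (N + M)%N)] /=.
rewrite leq_addl /series /= big_mkord -modulusE lecR -/(S _) => /(_ isT) HM.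
rewrite -/(S N) -(subrK (S (N + M)%N) (F w)) -addrA (le_trans (ler_modulusD _ _)) //.
by rewrite [leLHS]addrC lerD // (le_trans (SN M)) // ler_piMr ?mulr_ge0 ?exprn_ge0 //.
Qed.

Lemma expands_mulXn k f u : expands f u ->
  expands (fun w => w ^+ k * f w) (iter k shift_coef u).
Proof.
elim: k => [|k IH] fu /=.
  by apply: expands_ext fu => w _; rewrite expr0 mul1r.
apply: (@expands_ext _ (fun w => w * (w ^+ k * f w))) => [w _|].
  by rewrite exprS mulrA.
exact: expands_mulX (IH fu).
Qed.

Lemma iter_shift_coef k u n : iter k shift_coef u (k + n)%N = u n.
Proof. by elim: k => [|k IH] //=; rewrite addSn. Qed.

Lemma iter_shift_coef_lt k u n : (n < k)%N -> iter k shift_coef u n = 0.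
Proof. by elim: k n => // k IH [|n] //= /IH. Qed.

Lemma has_residueP (F : R[i]^o -> R[i]^o) (z0 c : R[i]^o) :
  has_residue F z0 c <-> exists m u, u m = c /\
    expands (fun w => w ^+ m.+1 * F (z0 + w)) u.
Proof.
have addK z : z0 + (z - z0) = z by rewrite addrC subrK.
split=> -[m [u [umc H]]]; exists m, u; split => //.
  apply: (@cvg_expands _ _ z0); apply: filterS H => z.
  by rewrite addK.
by have := @expands_cvg _ _ z0 H; apply: filterS => z; rewrite addK.
Qed.

(** The choice made by [residue] may use another pole order [m']. Multiplying each expansion by the
    other power of w gives two expansions of one function, whose common coefficient of index m + m'
    + 1 is the residue. *)
Lemma residueE F (z0 : R[i]) m u :
  expands (fun w => w ^+ m.+1 * F (z0 + w)) u -> residue F z0 = u m.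
Proof.
move=> H; rewrite /residue; case: xgetP => [c _ /has_residueP[m' [u' [<- H']]]|]; last first.
  by move/(_ (u m)); case; apply/has_residueP; exists m, u.
have := expands_mulXn m'.+1 H; have := expands_mulXn m.+1 H'.
move=> E1 E2.
have {}E2 : expands (fun w => w ^+ m.+1 * (w ^+ m'.+1 * F (z0 + w))) (iter m'.+1 shift_coef u).
  by apply: expands_ext E2 => w _; rewrite mulrCA.
have := expands_unique E1 E2 (m.+1 + m')%N.
by rewrite iter_shift_coef addSnnS addnC iter_shift_coef.
Qed.

Lemma expands_divn k c f u : expands f u ->
  expands (fun w => f w / (1 - c * w) ^+ k) (iter k (geom_coef c) u).
Proof.
elim: k => [|k IH] fu /=; first by apply: expands_ext fu => w _; rewrite expr0 divr1.
apply: (@expands_ext _ (fun w => f w / (1 - c * w) ^+ k / (1 - c * w))) => [w _|].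
  by rewrite exprSr invfM mulrA.
exact: expands_geom (IH fu).
Qed.

Definition delta0 (n : nat) : R[i] := (n == 0%N)%:R.

Lemma expands1 : expands (fun=> 1) delta0.
Proof.
exists 1, 1; split => // w _ _ [|N].
  by rewrite big_ord0 subr0 modulus1 expr0 mulr1.
rewrite big_ord_recl big1 => [|i _]; last by rewrite mul0r.
by rewrite addr0 expr0 mulr1 subrr modulus0 !mul1r exprn_ge0 ?modulus_ge0.
Qed.

(** The negative binomial series of (1 - c w)^-(j+1); the double recursion is Pascal's rule. *)
Lemma geom_coef_delta0 j c n :
  iter j.+1 (geom_coef c) delta0 n = 'C(n + j, j)%:R * c ^+ n.
Proof.
elim: j n => [|j IHj] n; last elim: n => [|n IHn].
- by elim: n => [|n IHn]; [rewrite bin0 expr0 mulr1|rewrite /= in IHn *; rewrite IHn !bin0 add0r exprS !mul1r].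
- rewrite add0n binn expr0 mulr1; have := IHj 0%N; rewrite add0n binn expr0 mulr1 => <-.
  by rewrite [LHS]/=.
have -> : iter j.+2 (geom_coef c) delta0 n.+1 =
  iter j.+1 (geom_coef c) delta0 n.+1 + c * iter j.+2 (geom_coef c) delta0 n by [].
have e : (n.+1 + j = n + j.+1)%N by rewrite addSnnS.
by rewrite IHj IHn exprS e addSn binS natrD; ring.
Qed.

Lemma expands_horner (P : {poly R[i]}) : expands (horner P) (fun n => P`_n).
Proof.
have H (i : 'I_(size P)) : i \in index_enum 'I_(size P) -> expands (fun w => P`_i * (w ^+ i * 1)) (fun n => P`_i * iter i shift_coef delta0 n).
  by move=> _; apply/expandsZ/expands_mulXn/expands1.
apply: (@expands_ext _ (fun w => \sum_(i < size P) P`_i * (w ^+ i * 1))) => [w _|].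
  by rewrite horner_coef; under eq_bigr do rewrite mulr1.
apply: expands_eq_coef (expands_sum H) => n.
have [nP|Pn] := ltnP n (size P); last first.
  rewrite big1 ?nth_default // => i _.
  by rewrite -(subnKC (leq_trans (ltnW (ltn_ord i)) Pn)) iter_shift_coef /delta0 subn_eq0 leqNgt (leq_trans (ltn_ord i) Pn) mulr0.
rewrite (bigD1 (Ordinal nP)) //= big1 => [|i iN].
  have := iter_shift_coef n delta0 0; rewrite addn0 => ->.
  by rewrite addr0 mulr1.
have [ni|ni] := ltnP n i; first by rewrite iter_shift_coef_lt ?mulr0.
rewrite -(subnKC ni) iter_shift_coef /delta0 subn_eq0; case: leqP; rewrite ?mulr0 // => ni'.
by case/eqP: iN; apply: val_inj => /=; apply/eqP; rewrite eqn_leq ni ni'.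
Qed.

End Residues.

(** * The CARMA kernel *)

Section PartialFractions.
Variable F : fieldType.

Definition roots_poly (s : seq F) : {poly F} := \prod_(l <- s) ('X - l%:P).

Lemma roots_poly_split (l : F) s : exists2 c : {poly F}, c.[l] != 0 &
  roots_poly s = ('X - l%:P) ^+ count_mem l s * c.
Proof.
elim: s => [|x s [c cl E]].
  by exists 1; rewrite ?hornerC ?oner_eq0 // /roots_poly big_nil expr0 mulr1.
rewrite /roots_poly big_cons -/(roots_poly s) E /=; have [->|xl] := eqVneq x l.
  by exists c => //; rewrite add1n exprS mulrA.
exists (('X - x%:P) * c); last by rewrite add0n mulrCA.
by rewrite hornerM hornerXsubC mulf_neq0 // subr_eq0 eq_sym.
Qed.

Lemma horner_roots_poly_eq0 s z : ((roots_poly s).[z] == 0) = (z \in s).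
Proof. by rewrite -[_ == 0]/(root _ _) root_prod_XsubC. Qed.

(** With [c] the part of the product over [s] prime to X - l, the constant [C] is chosen so that r -
    C c vanishes at l. Dividing by X - l leaves a numerator for [s], and C c over the whole
    denominator is a pure power of 1/(z - l). *)
Lemma partial_fractions (s : seq F) (r : {poly F}) : (size r <= size s)%N ->
  exists ts : seq (F * (F * nat)),
    (forall k, k \in ts -> (k.2.2 < count_mem k.2.1 s)%N) /\
    forall z, z \notin s ->
      r.[z] / (roots_poly s).[z] = \sum_(k <- ts) k.1 / (z - k.2.1) ^+ k.2.2.+1.
Proof.
elim: s r => [|l s IH] r.
  rewrite leqn0 size_poly_eq0 => /eqP ->; exists [::]; split => // z _.
  by rewrite big_nil horner0 mul0r.
move=> rs; have [c cl E] := roots_poly_split l s.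
set m := count_mem l s in E.
have szP : size (roots_poly s) = (size s).+1 by rewrite /roots_poly size_prod_XsubC.
have c0 : c != 0 by apply: contraNneq cl => ->; rewrite horner0.
have szc : (size c <= (size s).+1)%N.
  rewrite -szP E size_monicM ?monic_exp ?monicXsubC // size_exp_XsubC /=.
  by rewrite leq_addl.
pose C := r.[l] / c.[l].
have /factor_theorem[r' Er] : root (r - C%:P * c) l.
  by rewrite rootE !hornerE /C mulfVK // subrr.
have szr' : (size r' <= size s)%N.
  have [->|r'0] := eqVneq r' 0; first by rewrite size_poly0.
  rewrite -ltnS; have := size_Mmonic r'0 (monicXsubC l).
  rewrite -Er size_XsubC addn2 /= => <-.
  rewrite (leq_trans (size_polyD _ _)) // geq_max rs /=.
  by rewrite size_polyN mul_polyC (leq_trans (size_scale_leq _ _)).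
have [ts [tsc tsE]] := IH r' szr'.
exists ((C, (l, m)) :: ts); split.
  move=> k; rewrite inE => /orP[/eqP -> /=|/tsc kts]; first by rewrite eqxx add1n.
  by rewrite (leq_trans kts) // leq_addl.
move=> z; rewrite inE negb_or => /andP[zl zs].
rewrite big_cons /= -tsE // /roots_poly big_cons -/(roots_poly s) hornerM hornerXsubC.
have Ps : (roots_poly s).[z] != 0 by rewrite horner_roots_poly_eq0.
have -> : r = r' * ('X - l%:P) + C%:P * c by rewrite -Er subrK.
have zl0 : z - l != 0 by rewrite subr_eq0.
rewrite hornerD !hornerM hornerXsubC hornerC mulrDl addrC; congr (_ + _).
  move: Ps; rewrite E hornerM horner_exp hornerXsubC mulf_eq0 negb_or => /andP[zlm cz].
  by rewrite mulrA -exprS -mulf_div divff // mulr1.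
by rewrite [(z - l) * _]mulrC -mulf_div divff // mulr1.
Qed.

End PartialFractions.

(** * The kernel as a sum of exponential polynomials, and its behaviour at 0 *)

Section Kernel.
Variable R : realType.
Implicit Types (ts : seq (R[i] * (R[i] * nat))) (z w l c : R[i]).

Lemma near_notin (s : seq R[i]) l : exists K : R, 0 < K /\
  forall w, w != 0 -> K * modulus w < 1 -> l + w \notin s.
Proof.
elim: s => [|x s [K [K0 H]]]; first by exists 1.
have [->|xl] := eqVneq x l.
  exists K; split => // w w0 Kw; rewrite inE negb_or H // andbT.
  by rewrite -subr_eq0 addrAC subrr add0r.
have m0 : 0 < modulus (x - l) by rewrite modulus_gt0 subr_eq0.
exists (Num.max K (modulus (x - l))^-1); split; first by rewrite lt_max K0.
move=> w w0 Kw; rewrite inE negb_or H // ?andbT; last first.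
  by rewrite (le_lt_trans _ Kw) // ler_wpM2r ?modulus_ge0 // le_max lexx.
apply/eqP => e; have : (modulus (x - l))^-1 * modulus w < 1.
  by rewrite (le_lt_trans _ Kw) // ler_wpM2r ?modulus_ge0 // le_max lexx orbT.
by rewrite -e addrAC subrr add0r mulVf ?ltxx // modulus_eq0.
Qed.

(** The inverse Laplace transform of the sum of the partial fractions c/(z-l)^(j+1), where an entry
    of [ts] is (c, (l, j)). *)
Definition kernel_sum ts w : R[i] :=
  \sum_(k <- ts) k.1 * (w ^+ k.2.2 / (k.2.2)`!%:R) * expC (k.2.1 * w).

(** One order [m] serves all summands, so that the residue of their sum sits at one index. A summand
    whose pole is not [l] is regular there and starts only at index m+1. *)
Lemma expands_pole m (k : R[i] * (R[i] * nat)) l (t : R[i]) : (k.2.2 <= m)%N ->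
  exists U : nat -> R[i], U m =
    (if k.2.1 == l then k.1 * (t ^+ k.2.2 / (k.2.2)`!%:R) * expC (k.2.1 * t) else 0) /\
    expands (fun w => w ^+ m.+1 * (expC ((l + w) * t) * (k.1 / (l + w - k.2.1) ^+ k.2.2.+1))) U.
Proof.
case: k => c [x j] /= jm; have et := expands_expC t.
have [->|xl] := eqVneq x l.
  exists (fun n => c * expC (l * t) * iter (m - j)%N shift_coef (fun n => t ^+ n / n`!%:R) n).
  split; first by rewrite -[X in iter _ _ _ X](subnK jm) iter_shift_coef; ring.
  apply: expands_ext (expandsZ _ (expands_mulXn _ et)) => w w0.
  rewrite mulrDl expCD [w * t]mulrC addrAC subrr add0r.
  rewrite -[X in w ^+ X.+1 * _](subnK jm) -addnS exprD.
  have wj : w ^+ j.+1 != 0 by rewrite expf_neq0.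
  by move: (expC _) (expC _) (w ^+ (m - j)) (w ^+ j.+1) wj => A B D E E0; field.
pose d := x - l; have d0 : d != 0 by rewrite subr_eq0.
exists (iter m.+1 shift_coef (fun n => c * expC (l * t) * (- d) ^- j.+1 *
   iter j.+1 (geom_coef d^-1) (fun n => t ^+ n / n`!%:R) n)).
split; first by rewrite iter_shift_coef_lt.
apply: expands_ext (expands_mulXn _ (expandsZ _ (expands_divn _ _ et))) => w w0.
congr (_ * _); rewrite mulrDl expCD [w * t]mulrC.
have -> : l + w - x = - d * (1 - d^-1 * w) by rewrite /d; field.
rewrite exprMn [in RHS]invfM; ring.
Qed.

Lemma carma_kernelE (a b : {poly R}) (lam : seq R[i]) ts (t : R) :
  polyC_of a = roots_poly lam ->
  (forall k, k \in ts -> (k.2.2 < count_mem k.2.1 lam)%N) ->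
  (forall z, z \notin lam -> (polyC_of b).[z] / (polyC_of a).[z] =
      \sum_(k <- ts) k.1 / (z - k.2.1) ^+ k.2.2.+1) ->
  0 < t -> carma_kernel a b lam t = complex.Re (kernel_sum ts t%:C).
Proof.
move=> alam tslam tsE t0; rewrite /carma_kernel t0; congr complex.Re.
pose v (k : R[i] * (R[i] * nat)) :=
  k.1 * (t%:C ^+ k.2.2 / (k.2.2)`!%:R) * expC (k.2.1 * t%:C).
have res l : residue (fun z => expC (z * t%:C) * ((polyC_of b).[z] / (polyC_of a).[z])) l
    = \sum_(k <- ts | k.2.1 == l) v k.
  (* No multiplicity exceeds [size lam], which is therefore a pole order common to all terms. *)
  pose m := size lam.
  have jm k : k \in ts -> (k.2.2 <= m)%N.
    by move=> /tslam /ltnW /leq_trans; apply; exact: count_size.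
  have Uk (k : R[i] * (R[i] * nat)) : exists U : nat -> R[i], k \in ts ->
      U m = (if k.2.1 == l then v k else 0) /\
      expands (fun w => w ^+ m.+1 * (expC ((l + w) * t%:C) * (k.1 / (l + w - k.2.1) ^+ k.2.2.+1))) U.
    have [kts|kts] := boolP (k \in ts); last by exists (fun=> 0).
    by have [U HU] := expands_pole l t%:C (jm k kts); exists U.
  have [U HU] := choice Uk.
  have expU := expands_sum (fun k (kts : k \in ts) => (HU k kts).2).
  rewrite (@residueE _ _ l m (fun n => \sum_(k <- ts) U k n)).
    rewrite big_seq (eq_bigr (fun k => if k.2.1 == l then v k else 0)); last first.
      by move=> k /HU[].
    by rewrite -big_seq -big_mkcond.
  have [K [K0 HK]] := near_notin lam l.
  apply: (expands_ext_near K0) expU => w w0 Kw.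
  by rewrite tsE ?HK // !mulr_sumr.
under eq_bigr do rewrite res.
rewrite (exchange_big_dep xpredT) //= /kernel_sum.
rewrite [LHS]big_seq [RHS]big_seq; apply: eq_bigr => k /tslam klam.
have kin : k.2.1 \in undup lam.
  by rewrite mem_undup -has_pred1 has_count (leq_ltn_trans _ klam).
rewrite (big_rem _ kin) /= eqxx big_seq_cond big1 ?addr0 // => x /andP[].
by rewrite mem_rem_uniq ?undup_uniq // !inE eq_sym => /andP[/negPf ->].
Qed.

Lemma near_inv_notin (s : seq R[i]) : exists K : R, 0 < K /\
  forall w, w != 0 -> K * modulus w < 1 -> w^-1 \notin s.
Proof.
elim: s => [|x s [K [K0 H]]]; first by exists 1.
exists (Num.max K (modulus x)); split; first by rewrite lt_max K0.
move=> w w0 Kw; rewrite inE negb_or H // ?andbT; last first.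
  by rewrite (le_lt_trans _ Kw) // ler_wpM2r ?modulus_ge0 // le_max lexx.
apply/eqP => e; have : modulus x * modulus w < 1.
  by rewrite (le_lt_trans _ Kw) // ler_wpM2r ?modulus_ge0 // le_max lexx orbT.
by rewrite -e -modulusM mulVf // modulus1 ltxx.
Qed.

(** Only the constant coefficient of the quotient matters later; each factor equals 1 at 0 and
    preserves it. *)
Lemma expands_div_prod (s : seq R[i]) f u : expands f u ->
  exists v, v 0%N = u 0%N /\ expands (fun w => f w / \prod_(l <- s) (1 - l * w)) v.
Proof.
move=> fu; elim: s => [|l s [v [v0 H]]].
  by exists u; split => //; apply: expands_ext fu => w _; rewrite big_nil divr1.
exists (geom_coef l v); split => //.
by apply: expands_ext (expands_geom l H) => w _; rewrite big_cons invfM mulrA mulrAC.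
Qed.

Lemma horner_roots_poly_inv (s : seq R[i]) w : w != 0 ->
  (roots_poly s).[w^-1] = w ^- size s * \prod_(l <- s) (1 - l * w).
Proof.
move=> w0; rewrite /roots_poly horner_prod.
elim: s => [|l s IH]; first by rewrite !big_nil expr0 invr1 mulr1.
rewrite !big_cons IH hornerXsubC /= exprS invfM; field.
by rewrite w0 expf_neq0.
Qed.

Lemma horner_inv (B : {poly R[i]}) q w : size B = q.+1 -> w != 0 ->
  B.[w^-1] = w ^- q * (\poly_(i < q.+1) B`_(q - i)).[w].
Proof.
move=> Bq w0; rewrite horner_coef Bq horner_poly mulr_sumr.
rewrite (reindex_inj rev_ord_inj) /=; apply: eq_bigr => i _.
have -> : w ^+ q = w ^+ (q - i) * w ^+ i by rewrite -exprD subnK // leq_ord.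
rewrite subSS exprVn; field.
by rewrite !expf_neq0.
Qed.

(** Put z = 1/x in the partial fractions: their sum becomes x^(p-q) times the reversed [B] over the
    product of the 1 - l x, so its expansion in x starts with x^(p-q). Its coefficient of x^(n+1) is
    n! times the coefficient of w^n of [kernel_sum]. *)
Lemma kernel_sum_expands (B : {poly R[i]}) (lam : seq R[i]) ts p q :
  B \is monic -> size B = q.+1 -> size lam = p -> (q < p)%N ->
  (forall z, z \notin lam -> B.[z] / (roots_poly lam).[z] =
      \sum_(k <- ts) k.1 / (z - k.2.1) ^+ k.2.2.+1) ->
  exists u, [/\ expands (kernel_sum ts) u,
    forall n, (n.+1 < p - q)%N -> u n = 0 & u (p - q).-1 = ((p - q).-1)`!%:R^-1].
Proof.
move=> Bm Bq lamp qp tsE.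
pose W (k : R[i] * (R[i] * nat)) n := k.1 * iter k.2.2.+1 shift_coef
  (iter k.2.2.+1 (geom_coef k.2.1) (@delta0 R)) n.
have E1 : expands (fun x => \sum_(k <- ts) k.1 * (x ^+ k.2.2.+1 * (1 / (1 - k.2.1 * x) ^+ k.2.2.+1)))
    (fun n => \sum_(k <- ts) W k n).
  by apply: expands_sum => k _; apply/expandsZ/expands_mulXn/expands_divn/expands1.
have [v [v0 E2]] := expands_div_prod lam (expands_horner (\poly_(i < q.+1) B`_(q - i))).
have {}E2 := expands_mulXn (p - q) E2.
have EW : (fun n => \sum_(k <- ts) W k n) =1 iter (p - q) shift_coef v.
  apply: expands_unique E1 _.
  have [K [K0 HK]] := near_inv_notin lam.
  apply: (expands_ext_near K0) E2 => x x0 Kx.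
  have xn : x^-1 \notin lam by exact: HK.
  have Px : (roots_poly lam).[x^-1] != 0 by rewrite horner_roots_poly_eq0.
  transitivity (B.[x^-1] / (roots_poly lam).[x^-1]).
    move: Px; rewrite horner_roots_poly_inv // (horner_inv Bq) // lamp.
    rewrite mulf_eq0 negb_or => /andP[_ Px].
    have -> : x ^+ p = x ^+ (p - q) * x ^+ q by rewrite -exprD subnK // ltnW.
    field.
    by rewrite Px !expf_neq0.
  rewrite tsE //; apply: eq_bigr => k _.
  have -> : x^-1 - k.2.1 = x^-1 * (1 - k.2.1 * x) by field.
  by rewrite exprMn invfM exprVn invrK mul1r.
exists (fun n => (\sum_(k <- ts) W k n.+1) / n`!%:R); split.
- have Ek (k : R[i] * (R[i] * nat)) : k \in ts ->
      expands (fun w => k.1 * (w ^+ k.2.2 / (k.2.2)`!%:R) * expC (k.2.1 * w))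
        (fun n => W k n.+1 / n`!%:R).
    move=> _; case: k => c [l j] /=.
    have := expandsZ (c / j`!%:R) (expands_mulXn j (expands_expC l)).
    move=> E; apply: expands_ext (expands_eq_coef _ E) => [w _|n]; first by ring.
    rewrite /W /=; have [nj|jn] := ltnP n j.
      by rewrite !iter_shift_coef_lt // !mulr0 mul0r.
    (* Both sides are c l^i up to the identity 1/(j! i!) = C(i+j, j)/(i+j)!. *)
    rewrite -(subnKC jn) !iter_shift_coef; set i := (n - j)%N.
    rewrite -[geom_coef _ _ _]/(iter j.+1 (geom_coef l) (@delta0 R) i) geom_coef_delta0.
    rewrite [(j + i)%N]addnC -(bin_fact (leq_addl i j)) addnK !natrM.
    have f0 m : (m`!%:R : R[i]) != 0 by rewrite pnatr_eq0 -lt0n fact_gt0.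
    have b0 : ('C(i + j, j)%:R : R[i]) != 0 by rewrite pnatr_eq0 -lt0n bin_gt0 leq_addl.
    by field; rewrite !f0 b0.
  by apply: expands_eq_coef (expands_sum Ek) => n; rewrite mulr_suml.
- by move=> n npq; rewrite EW iter_shift_coef_lt ?mul0r.
rewrite EW prednK ?subn_gt0 //.
have := iter_shift_coef (p - q) v 0; rewrite addn0 => ->.
have := monicP Bm; rewrite v0 coef_poly subn0 /lead_coef Bq /= => ->.
by rewrite mul1r.
Qed.

Lemma kernel_near0 (a b : {poly R}) (lam : seq R[i]) p q :
  b \is monic -> size b = q.+1 -> size lam = p -> (q < p)%N ->
  polyC_of a = roots_poly lam ->
  exists ts, [/\ forall k, k \in ts -> (k.2.2 < count_mem k.2.1 lam)%N,
    forall t : R, 0 < t -> carma_kernel a b lam t = complex.Re (kernel_sum ts t%:C) &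
    exists C d : R, [/\ 0 <= C, 0 < d & forall t, 0 < t < d ->
      `|carma_kernel a b lam t - t ^+ (p - q).-1 / ((p - q).-1)`!%:R| <= C * t ^+ (p - q)]].
Proof.
move=> bm bq lamp qp alam.
have szB : size (polyC_of b) = q.+1 by rewrite size_map_poly.
have Bm : polyC_of b \is monic by rewrite map_monic.
have [|ts [tslam tsE]] := @partial_fractions _ lam (polyC_of b); first by rewrite szB lamp.
exists ts; have gE t : 0 < t -> carma_kernel a b lam t = complex.Re (kernel_sum ts t%:C).
  by apply: carma_kernelE => // z zl; rewrite alam tsE.
split => //.
have [u [[C [K [K0 H]]] u0 uk]] := kernel_sum_expands Bm szB lamp qp tsE.
have C0 : 0 <= C.
  (* The bound with N = 0 at any admissible point shows C >= 0. *)
  pose w : R[i] := (K^-1 / 2)%:C.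
  have mw : modulus w = K^-1 / 2 by rewrite modulus_real ger0_norm // divr_ge0 // invr_ge0 ltW.
  have w0 : w != 0 by rewrite -modulus_eq0 mw mulf_neq0 // invr_eq0 ?pnatr_eq0 ?gt_eqF.
  have Kw : K * modulus w < 1 by rewrite mw mulrA divff ?mul1r ?gt_eqF //; lra.
  by have := H w w0 Kw 0%N; rewrite expr0 mulr1; exact: le_trans (modulus_ge0 _).
exists (C * K ^+ (p - q)), K^-1; split; first by rewrite mulr_ge0 // exprn_ge0 // ltW.
  by rewrite invr_gt0.
move=> t /andP[t0 td]; rewrite gE //.
have mt : modulus t%:C = t by rewrite modulus_real ger0_norm // ltW.
have tC0 : t%:C != 0 :> R[i] by rewrite -modulus_eq0 mt gt_eqF.
have Kt : K * modulus t%:C < 1 by rewrite mt mulrC -ltr_pdivlMr // div1r.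
have := H _ tC0 Kt (p - q)%N; rewrite mt exprMn mulrA.
have k0 : (0 < p - q)%N by rewrite subn_gt0.
rewrite -(prednK k0) big_ord_recr /= big1 => [|i _]; last by rewrite u0 ?mul0r // -ltn_predRL.
rewrite add0r uk prednK // => h; apply: le_trans h.
set k := (p - q).-1.
have -> : k`!%:R^-1 * t%:C ^+ k = (t ^+ k / k`!%:R)%:C :> R[i].
  by rewrite rmorphM /= rmorphXn fmorphV /= rmorph_nat mulrC.
by rewrite (le_trans _ (ler_Re_modulus _)) // raddfB.
Qed.

End Kernel.

(** * The autoregressive filter, and why it annihilates the exponential sums *)

Section LagPolynomials.
Variable F : fieldType.

Definition lag_poly (cs : seq F) : {poly F} := \prod_(c <- cs) (1 - c%:P * 'X).

Lemma lag_poly_cons c cs : lag_poly (c :: cs) = lag_poly cs - c *: (lag_poly cs * 'X).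
Proof. by rewrite /lag_poly big_cons mulrBl mul1r mul_polyC -scalerAl [_ * 'X]mulrC. Qed.

Lemma size_lag_poly cs : (size (lag_poly cs) <= (size cs).+1)%N.
Proof.
elim: cs => [|c cs IH]; first by rewrite /lag_poly big_nil size_poly1.
rewrite lag_poly_cons (leq_trans (size_polyD _ _)) // geq_max (leq_trans IH) //=.
rewrite size_polyN (leq_trans (size_scale_leq _ _)) //.
rewrite (leq_trans (size_polyMleq _ _)) // size_polyX addn2 /= ltnS.
exact: IH.
Qed.

Lemma coef_lag_poly_cons c cs j :
  (lag_poly (c :: cs))`_j = (lag_poly cs)`_j - c * (if j is i.+1 then (lag_poly cs)`_i else 0).
Proof. by rewrite lag_poly_cons coefB coefZ coefMX; case: j. Qed.

End LagPolynomials.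

Section Annihilation.
Variable R : realType.
Implicit Types (D t l c : R[i]) (x : R[i] -> R[i]).

Definition lag_op D c x t := x t - c * x (t - D).

Lemma lag_op_sum (cs : seq R[i]) D x t :
  \sum_(j < (size cs).+1) (lag_poly cs)`_j * x (t - j%:R * D) =
  foldr (lag_op D) x cs t.
Proof.
elim: cs t => [|c cs IH] t.
  by rewrite big_ord_recl big_ord0 /lag_poly big_nil /= coef1 mul1r mul0r subr0 addr0.
rewrite [RHS]/= /lag_op -!IH [size _]/=.
under eq_bigr do rewrite coef_lag_poly_cons mulrBl.
rewrite sumrB; congr (_ - _).
  rewrite big_ord_recr /= [X in _ + X * _]nth_default ?mul0r ?addr0 //.
  exact: size_lag_poly.
rewrite big_ord_recl /= mulr0 mul0r add0r mulr_sumr; apply: eq_bigr => i _.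
by rewrite -mulrA; congr (_ * (_ * x _)); rewrite /bump /= -natr1; ring.
Qed.

Definition exp_poly l d x := exists P : {poly R[i]}, (size P <= d)%N /\
  forall t, x t = P.[t] * expC (l * t).

(** A translation preserves the leading coefficient, so the difference loses the top degree. *)
Lemma size_shift_polyB d (P : {poly R[i]}) D : (size P <= d.+1)%N ->
  (size (P - (P \Po ('X - D%:P)))%R <= d)%N.
Proof.
move=> Pd; have sP : size (P \Po ('X - D%:P)) = size P by rewrite size_comp_poly2 ?size_XsubC.
apply/leq_sizeP => j; rewrite leq_eqVlt coefB => /orP[/eqP <-|dj]; last first.
  by rewrite !nth_default ?subr0 // ?sP (leq_trans Pd).
move: Pd; rewrite leq_eqVlt ltnS => /orP[/eqP Pd|Pd]; last first.
  by rewrite !nth_default ?subr0 ?sP.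
have szX : (1 < size (('X - D%:P)%R : {poly R[i]}))%N by rewrite size_XsubC.
have := lead_coef_comp P szX.
rewrite lead_coefXsubC expr1n mulr1 /lead_coef sP Pd /= => ->.
by rewrite subrr.
Qed.

Lemma exp_poly_lag l d x D c : exp_poly l d x -> exp_poly l d (lag_op D c x).
Proof.
move=> [P [Pd xE]]; exists (P - (c * expC (- (l * D))) *: (P \Po ('X - D%:P))); split.
  rewrite (leq_trans (size_polyD _ _)) // geq_max Pd size_polyN /=.
  by rewrite (leq_trans (size_scale_leq _ _)) // size_comp_poly2 ?size_XsubC.
move=> t; rewrite /lag_op !xE hornerD hornerN hornerZ horner_comp hornerXsubC.
by rewrite mulrBr expCD; ring.
Qed.

(** With the matching constant e^(lD) the exponential factors out, and the operator acts on the
    polynomial as a backward difference. *)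
Lemma exp_poly_lag_root l d x D : exp_poly l d x ->
  exp_poly l d.-1 (lag_op D (expC (l * D)) x).
Proof.
move=> [P [Pd xE]]; exists (P - (P \Po ('X - D%:P))); split.
  case: d Pd => [|d /=]; last exact: size_shift_polyB.
  by rewrite leqn0 size_poly_eq0 => /eqP ->; rewrite comp_poly0 subr0 size_poly0.
move=> t; rewrite /lag_op !xE hornerD hornerN horner_comp hornerXsubC.
have e : expC (l * D) * expC (l * (t - D)) = expC (l * t).
  by rewrite -expCD; congr expC; ring.
by rewrite mulrBl; congr (_ - _); rewrite mulrCA e.
Qed.

Lemma exp_poly_annihil l d x (lam : seq R[i]) D : exp_poly l d x ->
  exp_poly l (d - count_mem l lam) (foldr (lag_op D) x [seq expC (m * D) | m <- lam]).
Proof.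
move=> xd; elim: lam => [|m lam IH]; first by rewrite subn0.
rewrite /=; have [->|ml] := eqVneq m l; last exact: exp_poly_lag.
rewrite add1n -[_.+1]addn1 subnDA subn1.
exact: exp_poly_lag_root IH.
Qed.

Lemma ar_polyE (lam : seq R[i]) (D : R) :
  ar_poly lam D = lag_poly [seq expC (m * D%:C) | m <- lam].
Proof. by rewrite /lag_poly big_map. Qed.

(** A term t^j e^(lt) has j smaller than the multiplicity of l, so the matching factors of the
    filter suffice to reduce its polynomial to 0. *)
Lemma kernel_sum_annihil (ts : seq (R[i] * (R[i] * nat))) (lam : seq R[i]) (D t : R) :
  (forall k, k \in ts -> (k.2.2 < count_mem k.2.1 lam)%N) ->
  \sum_(j < (size lam).+1) (ar_poly lam D)`_j * kernel_sum ts (t - j%:R * D)%:C = 0.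
Proof.
move=> tslam; rewrite /kernel_sum; under eq_bigr do rewrite mulr_sumr.
rewrite exchange_big /= big_seq big1 // => k /tslam klam.
pose x (t : R[i]) := k.1 * (t ^+ k.2.2 / (k.2.2)`!%:R) * expC (k.2.1 * t).
have xk : exp_poly k.2.1 k.2.2.+1 x.
  exists ((k.1 / (k.2.2)`!%:R) *: 'X^(k.2.2)); split.
    by rewrite (leq_trans (size_scale_leq _ _)) // size_polyXn.
  by move=> s; rewrite /x hornerZ hornerXn; ring.
have := exp_poly_annihil lam D%:C xk.
rewrite (eqP (_ : k.2.2.+1 - _ == 0)%N) ?subn_eq0 // => -[P [P0 xE]].
have := xE t%:C; rewrite -lag_op_sum size_map -ar_polyE.
move: P0; rewrite leqn0 size_poly_eq0 => /eqP ->; rewrite horner0 mul0r.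
move=> x0; rewrite -[RHS]x0; apply: eq_bigr => j _.
by rewrite /x rmorphB rmorphM /= rmorph_nat.
Qed.

Lemma conjc_expC l : conjc (expC l) = expC (conjc l).
Proof. by case: l => a b; rewrite /expC /= cosN sinN mulrN. Qed.

Lemma perm_roots_poly (F : fieldType) (s1 s2 : seq F) :
  roots_poly s1 = roots_poly s2 -> perm_eq s1 s2.
Proof.
move=> e; apply/allP => x _ /=; apply/eqP.
by rewrite -(mu_prod_XsubC x s1) -(mu_prod_XsubC x s2) -!/(roots_poly _) e.
Qed.

Lemma perm_conjc_roots (a : {poly R}) (lam : seq R[i]) :
  polyC_of a = roots_poly lam -> perm_eq [seq conjc l | l <- lam] lam.
Proof.
move=> alam; apply: perm_roots_poly; rewrite -alam.
have -> : polyC_of a = map_poly (@conjc R) (polyC_of a).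
  apply/polyP => i; rewrite [RHS](coef_map (@conjc R)) /polyC_of coef_map.
  exact/esym/conjc_real.
by rewrite alam /roots_poly map_prod_XsubC big_map.
Qed.

(** Conjugation permutes [lam], as [a] is real, and commutes with [expC]; hence it fixes the
    filter. *)
Lemma ar_poly_real (a : {poly R}) (lam : seq R[i]) (D : R) j :
  polyC_of a = roots_poly lam -> complex.Im (ar_poly lam D)`_j = 0.
Proof.
move=> /perm_conjc_roots plam.
have h l : map_poly (@conjc R) (1 - (expC (l * D%:C))%:P * 'X) = 1 - (expC (conjc l * D%:C))%:P * 'X.
  apply/polyP => i; rewrite (coef_map (@conjc R)) !coefB !coefCM coefX coef1.
  have -> : expC (conjc l * D%:C) = conjc (expC (l * D%:C)).
    by rewrite conjc_expC; congr expC; case: (l) => x y; simpc.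
  by rewrite [LHS]rmorphB [X in _ - X]rmorphM !rmorph_nat.
have e : map_poly (@conjc R) (ar_poly lam D) = ar_poly lam D.
  rewrite {2}/ar_poly -(perm_big _ plam) big_map /ar_poly rmorph_prod.
  by apply: eq_bigr => l _; exact: h.
have : (map_poly (@conjc R) (ar_poly lam D))`_j = (ar_poly lam D)`_j by rewrite e.
rewrite coef_map /=; case: (_`_j) => x y /= [] hxy.
by lra.
Qed.

Lemma ar_poly_cvg (lam : seq R[i]) j :
  (complex.Re (ar_poly lam D)`_j @[D --> (0:R)^'+] --> ((1 - 'X) ^+ size lam : {poly R})`_j) /\
  (complex.Im (ar_poly lam D)`_j @[D --> (0:R)^'+] --> (0:R)).
Proof.
have cE (l : R[i]) : (complex.Re (expC (l * D%:C)) @[D --> (0:R)^'+] --> (1:R)) /\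
   (complex.Im (expC (l * D%:C)) @[D --> (0:R)^'+] --> (0:R)).
  case: l => a b; rewrite /expC /=.
  under eq_fun do rewrite !mulr0 subr0 add0r.
  under [X in _ /\ (X @ _ --> _)]eq_fun do rewrite !mulr0 subr0 add0r.
  have ck (k : R) : k * D @[D --> (0:R)^'+] --> (0:R).
    rewrite -[X in _ --> X](mulr0 k); apply: cvgMr.
    exact: cvg_at_right_filter cvg_id.
  have ce : expR (a * D) @[D --> (0:R)^'+] --> (1:R).
    by rewrite -(expR0 R); apply: continuous_cvg => //; exact: continuous_expR.
  have cc : cos (b * D) @[D --> (0:R)^'+] --> (1:R).
    by rewrite -(cos0 R); apply: continuous_cvg => //; exact: continuous_cos.
  have cs : sin (b * D) @[D --> (0:R)^'+] --> (0:R).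
    by rewrite -[X in _ --> X](sin0 R); apply: continuous_cvg => //; exact: continuous_sin.
  by split; [rewrite -[X in _ --> X](mulr1 1)|rewrite -[X in _ --> X](mulr0 1)]; apply: cvgM.
elim: lam j => [|l lam IH] j.
  rewrite /ar_poly; under eq_fun do rewrite big_nil.
  under [X in _ /\ (X @ _ --> _)]eq_fun do rewrite big_nil.
  rewrite expr0 !coef1; split; case: (j == 0%N) => /=; exact: cvg_cst.
have arS (D : R) : ar_poly (l :: lam) D =
    ar_poly lam D - expC (l * D%:C) *: (ar_poly lam D * 'X).
  by rewrite /ar_poly big_cons mulrBl mul1r -mulrA [_ * 'X]mulrC mul_polyC ['X * _]mulrC.
have pS : ((1 - 'X) ^+ (size lam).+1 : {poly R})`_j = ((1 - 'X) ^+ size lam : {poly R})`_j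
    - (if j is i.+1 then ((1 - 'X) ^+ size lam : {poly R})`_i else 0).
  by rewrite exprS mulrBl mul1r coefB coefXM; case: j.
have ReE (x y z : R[i]) : complex.Re (x - y * z) =
    complex.Re x - (complex.Re y * complex.Re z - complex.Im y * complex.Im z).
  by case: x => ? ?; case: y => ? ?; case: z.
have ImE (x y z : R[i]) : complex.Im (x - y * z) =
    complex.Im x - (complex.Re y * complex.Im z + complex.Im y * complex.Re z).
  by case: x => ? ?; case: y => ? ?; case: z.
have [IH1 IH2] := IH j.
have [IHr IHi] : (complex.Re (if j is i.+1 then (ar_poly lam D)`_i else 0) @[D --> (0:R)^'+]
    --> (if j is i.+1 then ((1 - 'X) ^+ size lam : {poly R})`_i else 0)) /\
    (complex.Im (if j is i.+1 then (ar_poly lam D)`_i else 0) @[D --> (0:R)^'+] --> (0:R)).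
  by case: j {IH1 IH2 pS} => [|i]; [split; exact: cvg_cst|exact: IH].
have [Er Ei] := cE l.
rewrite [size _]/= pS; split.
  rewrite -[X in _ - X]mul1r -[X in _ - X]subr0 -[X in _ - (_ - X)](mul0r 0).
  have -> : (fun D : R => complex.Re (ar_poly (l :: lam) D)`_j) = (fun D : R =>
    complex.Re (ar_poly lam D)`_j - (complex.Re (expC (l * D%:C)) * complex.Re (if j is i.+1 then (ar_poly lam D)`_i else 0)
     - complex.Im (expC (l * D%:C)) * complex.Im (if j is i.+1 then (ar_poly lam D)`_i else 0))).
    apply/funext => D; rewrite arS coefB coefZ coefMX.
    by case: j {IH1 IH2 IHr IHi pS} => [|i]; rewrite ReE.
  by apply: cvgB => //; apply: cvgB; apply: cvgM.
have -> : (fun D : R => complex.Im (ar_poly (l :: lam) D)`_j) = (fun D : R =>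
  complex.Im (ar_poly lam D)`_j - (complex.Re (expC (l * D%:C)) * complex.Im (if j is i.+1 then (ar_poly lam D)`_i else 0)
   + complex.Im (expC (l * D%:C)) * complex.Re (if j is i.+1 then (ar_poly lam D)`_i else 0))).
  apply/funext => D; rewrite arS coefB coefZ coefMX.
  by case: j {IH1 IH2 IHr IHi pS} => [|i]; rewrite ImE.
set L := (if j is i.+1 then ((1 - 'X) ^+ size lam : {poly R})`_i else 0) in IHr.
rewrite [X in _ --> X](_ : 0 = 0 - (1 * 0 + 0 * L)); last by ring.
by apply: cvgB => //; apply: cvgD; apply: cvgM.
Qed.

End Annihilation.

(** * Square-integrable functions *)

Section SquareIntegrable.
Context d (T : measurableType d) (R : realType) (mu : {measure set T -> \bar R}).
Implicit Types f g h : T -> R.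

Definition sq_integrable f := measurable_fun setT f /\
  mu.-integrable setT (fun x => (f x ^+ 2)%:E).

Definition inner f g : R := fine (\int[mu]_x (f x * g x)%:E).

Lemma measurable_EFin f : measurable_fun setT f -> measurable_fun setT (EFin \o f).
Proof. by move=> mf; exact/measurable_EFinP. Qed.

Lemma sq_integrable_le f g : measurable_fun setT f -> sq_integrable g ->
  (forall x, f x ^+ 2 <= g x ^+ 2) -> sq_integrable f.
Proof.
move=> mf [mg ig] fg; split => //.
apply: le_integrable ig => //; first exact/measurable_EFin/measurable_funX.
by move=> x _ /=; rewrite lee_fin !ger0_norm ?sqr_ge0.
Qed.

Lemma sq_integrableP f : measurable_fun setT f ->
  (\int[mu]_x (f x ^+ 2)%:E < +oo)%E -> sq_integrable f.
Proof.
move=> mf fi; split => //; apply/integrableP; split.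
  exact/measurable_EFin/measurable_funX.
under eq_integral do rewrite gee0_abs ?lee_fin ?sqr_ge0 //; exact: fi.
Qed.

Lemma integrable_mul f g : sq_integrable f -> sq_integrable g ->
  mu.-integrable setT (fun x => (f x * g x)%:E).
Proof.
move=> [mf fi] [mg gi].
apply: le_integrable (integrableD measurableT fi gi) => //.
  exact/measurable_EFin/measurable_funM.
move=> x _ /=; rewrite lee_fin normrM [leRHS]ger0_norm ?addr_ge0 ?sqr_ge0 //.
rewrite -[f x ^+ 2]real_normK ?num_real // -[g x ^+ 2]real_normK ?num_real //.
have := sqr_ge0 (`|f x| - `|g x|); have := sqr_ge0 (`|f x| + `|g x|).
by rewrite sqrrB sqrrD; lra.
Qed.

Lemma integral_mulE f g : sq_integrable f -> sq_integrable g ->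
  (\int[mu]_x (f x * g x)%:E)%E = (inner f g)%:E.
Proof.
by move=> hf hg; rewrite /inner fineK // integrable_fin_num // integrable_mul.
Qed.

Lemma integral_sqrE f : sq_integrable f -> (\int[mu]_x (f x ^+ 2)%:E)%E = (inner f f)%:E.
Proof. by move=> hf; rewrite -integral_mulE //; under eq_integral do rewrite expr2. Qed.

Lemma sq_integrable0 : sq_integrable (fun=> 0).
Proof.
split=> //; under eq_fun do rewrite expr0n; exact: integrable0.
Qed.

Lemma sq_integrableD f g : sq_integrable f -> sq_integrable g ->
  sq_integrable (fun x => f x + g x).
Proof.
move=> hf hg; have [mf fi] := hf; have [mg gi] := hg.
split; first exact: measurable_funD.
have fg := integrable_mul hf hg.
have := integrableD measurableT (integrableD measurableT fi gi) (integrableD measurableT fg fg).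
apply: eq_integrable => // x _ /=; rewrite -!EFinD; congr EFin; ring.
Qed.

Lemma sq_integrableZ c f : sq_integrable f -> sq_integrable (fun x => c * f x).
Proof.
move=> [mf fi]; split; first exact: measurable_funM.
have := integrableZl measurableT (c ^+ 2) fi.
by apply: eq_integrable => // x _ /=; rewrite -EFinM exprMn.
Qed.

Lemma sq_integrableB f g : sq_integrable f -> sq_integrable g ->
  sq_integrable (fun x => f x - g x).
Proof.
move=> hf /(sq_integrableZ (-1)) hg.
by have := sq_integrableD hf hg; under eq_fun do rewrite mulN1r.
Qed.

Lemma sq_integrable_sum (I : Type) (r : seq I) (F : I -> T -> R) :
  (forall i, sq_integrable (F i)) -> sq_integrable (fun x => \sum_(i <- r) F i x).
Proof.
move=> hF; elim: r => [|i r IH].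
  by under eq_fun do rewrite big_nil; exact: sq_integrable0.
by under eq_fun do rewrite big_cons; exact: sq_integrableD.
Qed.

Lemma innerC f g : inner f g = inner g f.
Proof. by rewrite /inner; under eq_integral do rewrite mulrC. Qed.

Lemma inner_ge0 f : 0 <= inner f f.
Proof. by apply/fine_ge0/integral_ge0 => x _; rewrite lee_fin -expr2 sqr_ge0. Qed.

Lemma innerDl f g h : sq_integrable f -> sq_integrable g -> sq_integrable h ->
  inner (fun x => f x + g x) h = inner f h + inner g h.
Proof.
move=> hf hg hh; apply: EFin_inj; rewrite EFinD -!integral_mulE //; last exact: sq_integrableD.
rewrite -integralD //; [|exact: integrable_mul|exact: integrable_mul].
by apply: eq_integral => x _; rewrite mulrDl EFinD.
Qed.

Lemma innerZl c f g : sq_integrable f -> sq_integrable g ->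
  inner (fun x => c * f x) g = c * inner f g.
Proof.
move=> hf hg; apply: EFin_inj; rewrite EFinM -!integral_mulE //; last exact: sq_integrableZ.
rewrite -integralZl //; last exact: integrable_mul.
by apply: eq_integral => x _; rewrite -EFinM mulrA.
Qed.

Lemma innerDr f g h : sq_integrable f -> sq_integrable g -> sq_integrable h ->
  inner h (fun x => f x + g x) = inner h f + inner h g.
Proof. by move=> *; rewrite innerC innerDl // ![inner h _]innerC. Qed.

Lemma innerZr c f g : sq_integrable f -> sq_integrable g ->
  inner g (fun x => c * f x) = c * inner g f.
Proof. by move=> *; rewrite innerC innerZl // [inner g _]innerC. Qed.

Lemma innerBl f g h : sq_integrable f -> sq_integrable g -> sq_integrable h ->
  inner (fun x => f x - g x) h = inner f h - inner g h.
Proof.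
move=> hf hg hh; under eq_fun do rewrite -mulN1r.
by rewrite innerDl ?innerZl ?mulN1r //; exact: sq_integrableZ.
Qed.

Lemma innerBr f g h : sq_integrable f -> sq_integrable g -> sq_integrable h ->
  inner h (fun x => f x - g x) = inner h f - inner h g.
Proof. by move=> *; rewrite innerC innerBl // ![inner h _]innerC. Qed.

Lemma inner0l f : inner (fun=> 0) f = 0.
Proof. by rewrite /inner; under eq_integral do rewrite mul0r; rewrite integral0. Qed.

Lemma inner_suml (I : Type) (r : seq I) (F : I -> T -> R) g :
  (forall i, sq_integrable (F i)) -> sq_integrable g ->
  inner (fun x => \sum_(i <- r) F i x) g = \sum_(i <- r) inner (F i) g.
Proof.
move=> hF hg; elim: r => [|i r IH].
  by under eq_fun do rewrite big_nil; rewrite inner0l big_nil.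
under eq_fun do rewrite big_cons.
by rewrite innerDl // ?IH ?big_cons //; exact: sq_integrable_sum.
Qed.

Lemma inner_sumr (I : Type) (r : seq I) (F : I -> T -> R) g :
  (forall i, sq_integrable (F i)) -> sq_integrable g ->
  inner g (fun x => \sum_(i <- r) F i x) = \sum_(i <- r) inner g (F i).
Proof.
by move=> hF hg; rewrite innerC inner_suml //; apply: eq_bigr => i _; rewrite innerC.
Qed.

Lemma inner_polarization f g : sq_integrable f -> sq_integrable g ->
  inner f g = (inner (fun x => f x + g x) (fun x => f x + g x) - inner f f - inner g g) / 2.
Proof.
move=> hf hg; have hfg := sq_integrableD hf hg.
by rewrite innerDl // !innerDr // [inner g f]innerC; field.
Qed.

(** Nonnegativity of the square norm of c f + g; with a free constant [c] it does the work of the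
    Cauchy-Schwarz inequality. *)
Lemma inner_quadratic c f g : sq_integrable f -> sq_integrable g ->
  0 <= c ^+ 2 * inner f f + 2 * c * inner f g + inner g g.
Proof.
move=> hf hg; have hc := sq_integrableZ c hf.
have := inner_ge0 (fun x => c * f x + g x).
rewrite (innerDl hc hg (sq_integrableD hc hg)) (innerDr hc hg hc) (innerDr hc hg hg).
rewrite (innerZl c hf hc) (innerZl c hf hg) (innerZr c hf hf) (innerZr c hf hg) [inner g f]innerC.
by move/le_trans; apply; rewrite le_eqVlt; apply/orP; left; apply/eqP; ring.
Qed.

Lemma inner_ae f f' g g' : measurable_fun setT f -> measurable_fun setT f' ->
  measurable_fun setT g -> measurable_fun setT g' ->
  {ae mu, forall x, f x = f' x} -> {ae mu, forall x, g x = g' x} -> inner f g = inner f' g'.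
Proof.
move=> mf mf' mg mg' ff' gg'; rewrite /inner; congr fine.
apply: ae_eq_integral => //.
- exact/measurable_EFin/measurable_funM.
- exact/measurable_EFin/measurable_funM.
- by apply: filterS2 ff' gg' => x fx gx _; rewrite fx gx.
Qed.

Lemma sq_integrable_ae f g : measurable_fun setT g -> sq_integrable f ->
  {ae mu, forall x, f x = g x} -> sq_integrable g.
Proof.
move=> mg [mf fi] fg; apply: sq_integrableP => //.
rewrite (_ : (\int[mu]_x _)%E = \int[mu]_x (f x ^+ 2)%:E)%E.
  have /integrableP[_] := fi.
  by under eq_integral do rewrite gee0_abs ?lee_fin ?sqr_ge0 //; apply.
apply: ae_eq_integral => //; try exact/measurable_EFin/measurable_funX.
by apply: filterS fg => x -> _.
Qed.

Lemma sq_integrable_limit f (S : nat -> T -> R) : measurable_fun setT f ->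
  (forall n, sq_integrable (S n)) ->
  (\int[mu]_x ((f x - S n x) ^+ 2)%:E)%E @[n --> \oo] --> 0%E ->
  sq_integrable f.
Proof.
move=> mf hS /fine_cvgP[[N _ HN] _].
have hfN : sq_integrable (fun x => f x - S N x).
  apply: sq_integrableP; first by apply: measurable_funB => //; have [] := hS N.
  by have := HN N (leqnn N); rewrite ge0_fin_numE //; apply: integral_ge0 => x _; rewrite lee_fin sqr_ge0.
have := sq_integrableD hfN (hS N).
by under eq_fun do rewrite subrK.
Qed.

Lemma inner_limit f (S : nat -> T -> R) : measurable_fun setT f ->
  (forall n, sq_integrable (S n)) ->
  (\int[mu]_x ((f x - S n x) ^+ 2)%:E)%E @[n --> \oo] --> 0%E ->
  inner (S n) (S n) @[n --> \oo] --> inner f f.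
Proof.
move=> mf hS cv; have hf := sq_integrable_limit mf hS cv.
have hfS n : sq_integrable (fun x => f x - S n x) by exact: sq_integrableB.
pose e n := inner (fun x => f x - S n x) (fun x => f x - S n x).
have e0 : e n @[n --> \oo] --> (0:R).
  have /fine_cvgP[_] := cv; apply: cvg_trans; apply: near_eq_cvg; near=> n.
  by rewrite /= integral_sqrE.
set A := inner f f; have A0 : 0 <= A := inner_ge0 f.
apply/cvgrPdist_le => eps eps0.
(* [k] is the weight in 2 |(f, f - S_n)| <= k |f|^2 + |f - S_n|^2 / k. It makes the first term at
   most eps/2, while [m] below bounds both |f - S_n|^2 and its quotient by [k] by eps/4. *)
pose k := eps / (2 * (A + 1)).
have k0 : 0 < k by rewrite divr_gt0 // mulr_gt0 //; lra.
pose m := Num.min (eps / 4) (k * eps / 4).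
have m0 : 0 < m by rewrite lt_min !divr_gt0 // mulr_gt0.
have /cvgrPdist_le/(_ m m0) := e0; apply: filterS => n.
rewrite sub0r normrN ger0_norm; last exact: inner_ge0.
rewrite le_min => /andP[em ek].
have SE : inner (S n) (S n) = A - 2 * inner f (fun x => f x - S n x) + e n.
  by rewrite /e !innerBr // !innerBl // [inner (S n) f]innerC -/A; ring.
have cs : `|2 * inner f (fun x => f x - S n x)| <= k * A + e n / k.
  have P c : 0 <= c ^+ 2 * A + 2 * c * inner f (fun x => f x - S n x) + e n.
    exact: inner_quadratic (hfS n).
  have := P k; have := P (- k); set B := inner f _ => P1 P2.
  have keK : k * (e n / k) = e n by rewrite mulrCA mulfV ?mulr1 // gt_eqF.
  rewrite ler_norml; apply/andP; split.
    by rewrite -(ler_pM2l k0); move: P2 keK; set w := e n / k; nra.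
  by rewrite -(ler_pM2l k0); move: P1 keK; set w := e n / k; nra.
rewrite SE -/A.
have kA : k * A <= eps / 2.
  have : k * (2 * (A + 1)) = eps by rewrite /k mulfVK // gt_eqF // mulr_gt0 //; lra.
  by nra.
have ekk : e n / k <= eps / 4 by rewrite ler_pdivrMr //; lra.
have -> : A - (A - 2 * inner f (fun x => f x - S n x) + e n) =
  2 * inner f (fun x => f x - S n x) - e n by ring.
rewrite (le_trans (ler_normB _ _)) // [`|e n|]ger0_norm ?inner_ge0 //.
lra.
Unshelve. all: by end_near.
Qed.

End SquareIntegrable.

(** * Levy integrals *)

Section Independence.
Context d (T : measurableType d) (R : realType) (P : probability T R).
Implicit Types X Y : T -> R.

Definition rv_of d' (U : measurableType d') (f : T -> U) (mf : measurable_fun setT f) :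
    {RV P >-> U} := MeasurableFun.Pack (MeasurableFun.Class (isMeasurableFun.Build _ _ _ _ f mf)).

Definition independent2 X Y := forall A B, measurable A -> measurable B ->
  P (X @^-1` A `&` Y @^-1` B) = (P (X @^-1` A) * P (Y @^-1` B))%E.

Lemma integral_cst_probability (c : \bar R) : (\int[P]_w c)%E = c.
Proof.
rewrite integral_cst //; transitivity (c * 1)%E; last exact: mule1.
by congr (_ * _)%E; exact: probability_setT.
Qed.

Lemma expectation_same_law X Y (h : R -> \bar R) :
  measurable_fun setT X -> measurable_fun setT Y ->
  (forall A, measurable A -> P (X @^-1` A) = P (Y @^-1` A)) ->
  measurable_fun setT h -> (forall x, (0 <= h x)%E) ->
  (\int[P]_w h (X w) = \int[P]_w h (Y w))%E.
Proof.
move=> mX mY XY mh h0.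
have := @ge0_integral_distribution _ _ _ _ _ P (rv_of mX) h mh h0.
have := @ge0_integral_distribution _ _ _ _ _ P (rv_of mY) h mh h0.
move=> /= <- <-; apply: eq_measure_integral => A mA _.
exact: XY.
Qed.

(** Independence says that the law of the pair and the product of the laws agree on rectangles,
    hence everywhere. *)
Lemma tonelli_independent X Y (h : R * R -> \bar R) :
  measurable_fun setT X -> measurable_fun setT Y -> independent2 X Y ->
  measurable_fun setT h -> (forall x, (0 <= h x)%E) ->
  (\int[P]_w h (X w, Y w) = \int[P]_w' \int[P]_w h (X w, Y w'))%E.
Proof.
move=> mX mY XY mh h0.
have mXY : measurable_fun setT (fun w => (X w, Y w)) by exact: measurable_fun_pair.
have := @ge0_integral_distribution _ _ _ _ _ P (rv_of mXY) h mh h0.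
move=> /= <-.
have -> : (\int[distribution P (rv_of mXY)]_z h z =
  \int[(distribution P (rv_of mX) \x distribution P (rv_of mY))%E]_z h z)%E.
  apply/esym/eq_measure_integral => A mA _.
  by apply: product_measure_unique => // B C mB mC; rewrite /= -XY.
rewrite fubini_tonelli2 // ge0_integral_distribution //; last 2 first.
- exact: measurable_fun_fubini_tonelli_G.
- by move=> y; apply: integral_ge0 => x _.
apply: eq_integral => w' _; rewrite /= /fubini_G.
rewrite ge0_integral_distribution //.
exact: measurableT_comp.
Qed.

Lemma measurable_sqD : measurable_fun setT (fun z : R * R => ((z.1 + z.2) ^+ 2)%:E).
Proof. by apply/measurable_EFinP; apply: measurable_funX; apply: measurable_funD. Qed.

Lemma integral_sqD_independent X Y : measurable_fun setT X -> measurable_fun setT Y ->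
  independent2 X Y ->
  (\int[P]_w ((X w + Y w) ^+ 2)%:E = \int[P]_w' \int[P]_w ((X w + Y w') ^+ 2)%:E)%E.
Proof.
move=> mX mY XY; have := tonelli_independent mX mY XY measurable_sqD.
by apply=> z; rewrite lee_fin sqr_ge0.
Qed.

Lemma sq_integrable_cst c : sq_integrable P (fun=> c).
Proof.
split => //; exact: finite_measure_integrable_cst.
Qed.

(* By Tonelli, X + y is square-integrable for at least one value y of Y. *)
Lemma sq_integrable_independent X Y : measurable_fun setT X -> measurable_fun setT Y ->
  independent2 X Y -> sq_integrable P (fun w => X w + Y w) -> sq_integrable P X.
Proof.
move=> mX mY XY hXY.
have [y hy] : exists y, (\int[P]_w ((X w + y) ^+ 2)%:E < +oo)%E.
  apply/not_existsP => H.
  have := integral_sqrE hXY; rewrite integral_sqD_independent //.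
  under eq_integral => w' _.
    rewrite (_ : (\int[P]_w _)%E = +oo%E); last first.
      by apply/eqP; rewrite -leye_eq leNgt; apply/negP/H.
    over.
  by rewrite integral_cst_probability.
have hy' : sq_integrable P (fun w => X w + y) by apply: sq_integrableP => //; exact: measurable_funD.
have := sq_integrableB hy' (sq_integrable_cst y).
by under eq_fun do rewrite addrK.
Qed.

(** Tonelli is applied to the nonnegative (X + Y)^2 only; polarization then isolates the mean of the
    product. *)
Lemma inner_independent X Y : independent2 X Y ->
  sq_integrable P X -> sq_integrable P Y ->
  inner P X Y = inner P X (fun=> 1) * inner P Y (fun=> 1).
Proof.
move=> XY hX hY; have [mX _] := hX; have [mY _] := hY.
have h1 c := sq_integrable_cst c.
have inner_cst c : inner P (fun=> c) (fun=> c) = c ^+ 2.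
  apply: EFin_inj; rewrite -integral_sqrE //.
  exact: integral_cst_probability.
set a := inner P X (fun=> 1); set b := inner P Y (fun=> 1).
have scal Z c : sq_integrable P Z -> inner P Z (fun=> c) = c * inner P Z (fun=> 1).
  move=> hZ; rewrite -innerZr //; congr (inner _ _ _).
  by apply/funext => w; rewrite mulr1.
have shift Z c : sq_integrable P Z -> inner P (fun w => Z w + c) (fun w => Z w + c) =
    inner P Z Z + 2 * c * inner P Z (fun=> 1) + c ^+ 2.
  move=> hZ; have hZc := sq_integrableD hZ (h1 c).
  rewrite (innerDl hZ (h1 c) hZc) (innerDr hZ (h1 c) hZ) (innerDr hZ (h1 c) (h1 c)).
  by rewrite inner_cst [inner P (fun=> c) Z]innerC scal //; ring.
have hXY := sq_integrableD hX hY.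
have := integral_sqrE hXY; rewrite integral_sqD_independent //.
under eq_integral => w' _.
  rewrite integral_sqrE; last exact: (sq_integrableD hX (h1 _)).
  rewrite (shift X (Y w') hX) -/a.
  (* Completing the square writes the inner integral as a sum of two nonnegative terms, the second
     being the variance of [X], so that the integral may be split. *)
  have -> : inner P X X + 2 * Y w' * a + Y w' ^+ 2 = (Y w' + a) ^+ 2 + (inner P X X - a ^+ 2) by ring.
  over.
have v0 : 0 <= inner P X X - a ^+ 2.
  have := inner_quadratic (- a) (h1 1) hX.
  by rewrite inner_cst innerC -/a; lra.
under eq_integral do rewrite EFinD.
rewrite ge0_integralD //; last 2 first.
- by move=> w _; rewrite lee_fin sqr_ge0.
- by apply/measurable_EFinP/measurable_funX/measurable_funD.
rewrite integral_cst_probability.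
rewrite integral_sqrE; last exact: (sq_integrableD hY (h1 _)).
rewrite shift // -/b -EFinD => -[].
have := inner_polarization hX hY; lra.
Qed.

End Independence.

(** Cauchy's equation with continuity at 0: [f] vanishes at all nonnegative multiples of 1/N, and
    every t >= 0 exceeds such a multiple by less than 1/N. *)
Lemma additive_eq0 (R : realType) (f : R -> R) :
  (forall s t, 0 <= s -> 0 <= t -> f (s + t) = f s + f t) -> f 1 = 0 ->
  (forall e, 0 < e -> exists2 dl, 0 < dl & forall t, 0 <= t < dl -> `|f t| <= e) ->
  forall t, 0 <= t -> f t = 0.
Proof.
move=> fD f1 fs t t0; apply/eqP; rewrite -normr_le0; apply/ler_addgt0Pr => e e0.
rewrite add0r; have [dl dl0 Hd] := fs e e0.
pose N := (Num.truncn dl^-1).+1.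
have N0 : 0 < N%:R :> R by rewrite ltr0n.
have Ndl : N%:R^-1 < dl.
  by rewrite invf_plt ?posrE //; apply: truncnS_gt.
have f0 : f 0 = 0 by have := fD 0 0 (lexx _) (lexx _); rewrite addr0; lra.
have fn s n : 0 <= s -> f (n%:R * s) = n%:R * f s.
  move=> s0; elim: n => [|n IH]; first by rewrite !mul0r.
  by rewrite -natr1 !mulrDl !mul1r fD ?IH // mulr_ge0.
have fN : f (N%:R^-1) = 0.
  have Ni : 0 <= N%:R^-1 :> R by rewrite invr_ge0 ltW.
  have := fn _ N Ni; rewrite mulfV ?gt_eqF // f1 => /esym/eqP.
  by rewrite mulf_eq0 gt_eqF //= => /eqP.
pose j := Num.truncn (t * N%:R).
have /andP[j1 j2] : j%:R <= t * N%:R < j.+1%:R.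
  by rewrite truncn_le truncnS_gt mulr_ge0 // ltW.
pose r := t - j%:R * N%:R^-1.
have r0 : 0 <= r by rewrite subr_ge0 ler_pdivrMr.
have rN : r < N%:R^-1.
  rewrite ltrBlDr -[X in X + _]mul1r -mulrDl addrC natr1 ltr_pdivlMr //.
have -> : t = j%:R * N%:R^-1 + r by rewrite /r addrC subrK.
rewrite fD // ?mulr_ge0 ?invr_ge0 ?(ltW N0) // fn ?invr_ge0 ?(ltW N0) // fN mulr0 add0r.
by apply: Hd; rewrite r0 (lt_trans rN).
Qed.

(** * First and second moments of Levy increments, from those of L_1 *)

Section LevyIncrements.
Context d (T : measurableType d) (R : realType) (P : probability T R).
Variables (L : R -> {RV P >-> R}) (sigma : R).
Hypothesis hL : levy_process L.
Hypothesis hmean : 'E_P[(L 1)%R]%E = 0%E.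
Hypothesis hvar : 'E_P[fun w => (L 1 w ^+ 2)%R]%E = (sigma ^+ 2)%:E%E.

Definition increment (s t : R) (w : T) : R := L t w - L s w.

Local Notation mean X := (inner P X (fun=> 1)).

Lemma measurable_increment s t : measurable_fun setT (increment s t).
Proof. by apply: measurable_funB; exact: measurable_funPT. Qed.
Hint Resolve measurable_increment : core.

Lemma increment_split s t u : increment s u = (fun w => increment s t w + increment t u w).
Proof. by apply/funext => w; rewrite /increment; ring. Qed.

Lemma probability_fin_num A : measurable A -> P A \is a fin_num.
Proof. by move=> mA; exact: fin_num_measure. Qed.

Lemma increment_independent s t u : s < t -> t < u ->
  independent2 P (increment s t) (increment t u).
Proof.
move=> st tu A B mA mB; have [_ hI _ _ _] := hL.
have := hI 2%N (fun i => nth s [:: s; t; u] i) (fun i => if i is 0%N then A else B).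
have -> : [set w | forall i, (i < 2)%N -> (if i is 0%N then A else B)
    (L (nth s [:: s; t; u] i.+1) w - L (nth s [:: s; t; u] i) w)] =
    increment s t @^-1` A `&` increment t u @^-1` B.
  apply/seteqP; split => w /=; first by move=> H; split; [exact: (H 0%N)|exact: (H 1%N)].
  by move=> [H0 H1] [|[|//]] _.
rewrite big_ord_recl big_ord_recl big_ord0 mulr1 /= => H.
have m1 : measurable (increment s t @^-1` A) by rewrite -[X in measurable X]setTI; exact: measurable_increment.
have m2 : measurable (increment t u @^-1` B) by rewrite -[X in measurable X]setTI; exact: measurable_increment.
rewrite -[LHS]fineK ?probability_fin_num //; last exact: measurableI.
rewrite H; [|by case=> [|[|//]]|by case=> [|[|//]]].
by rewrite EFinM !fineK ?probability_fin_num.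
Qed.

Lemma increment_law s t h A : s <= t -> measurable A ->
  P (increment (s + h) (t + h) @^-1` A) = P (increment s t @^-1` A).
Proof. by move=> st mA; have [_ _ hS _ _] := hL; exact: hS. Qed.

Lemma expectation_increment s t h (g : R -> \bar R) : s <= t ->
  measurable_fun setT g -> (forall x, (0 <= g x)%E) ->
  (\int[P]_w g (increment (s + h)%R (t + h)%R w) = \int[P]_w g (increment s t w))%E.
Proof.
move=> st mg g0; apply: expectation_same_law => // A mA.
exact: increment_law.
Qed.

Lemma increment0_L1 : {ae P, forall w, L 1 w = increment 0 1 w}.
Proof.
have [h0 _ _ _ _] := hL; apply: filterS h0 => w h0.
by rewrite /increment h0 subr0.
Qed.

Lemma sq_integrable_L1 : sq_integrable P (L 1).
Proof.
apply: sq_integrableP; first exact: measurable_funPT.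
by have := hvar; rewrite unlock => ->; rewrite ltry.
Qed.

Lemma sq_integrable_increment01 : sq_integrable P (increment 0 1).
Proof. exact: sq_integrable_ae sq_integrable_L1 increment0_L1. Qed.

Lemma inner_increment01 : inner P (increment 0 1) (increment 0 1) = sigma ^+ 2.
Proof.
have mL : measurable_fun setT (L 1) := measurable_funPT _.
rewrite -(inner_ae mL _ mL _ increment0_L1 increment0_L1) //.
apply: EFin_inj; rewrite -integral_sqrE; last exact: sq_integrable_L1.
by have := hvar; rewrite unlock.
Qed.

Lemma mean_increment01 : mean (increment 0 1) = 0.
Proof.
have mL : measurable_fun setT (L 1) := measurable_funPT _.
rewrite -(@inner_ae _ _ _ _ _ _ (fun=> 1) (fun=> 1) mL _ _ _ increment0_L1) //.
apply: EFin_inj; rewrite -integral_mulE; [|exact: sq_integrable_L1|exact: sq_integrable_cst].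
under eq_integral do rewrite mulr1.
by have := hmean; rewrite unlock.
by apply: aeW.
Qed.

Lemma sq_integrable_increment_shift s t h : s <= t ->
  sq_integrable P (increment s t) -> sq_integrable P (increment (s + h) (t + h)).
Proof.
move=> st hst; apply: sq_integrableP => //.
rewrite (expectation_increment h (g := fun x => (x ^+ 2)%:E)) //.
- by rewrite integral_sqrE // ltry.
- by apply/measurable_EFinP; exact: measurable_funX.
- by move=> x; rewrite lee_fin sqr_ge0.
Qed.

(** An increment shorter than 1 is an independent summand of the increment over [0, 1], hence
    inherits square-integrability; a long one is a sum of shifted increments of length at most 1. *)
Lemma sq_integrable_increment s t : s <= t -> sq_integrable P (increment s t).
Proof.
have small h : 0 <= h -> h <= 1 -> sq_integrable P (increment 0 h).
  rewrite le_eqVlt => /orP[/eqP <- _|h0].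
    rewrite (_ : increment 0 0 = fun=> 0); first exact: sq_integrable0.
    by apply/funext => w; rewrite /increment subrr.
  rewrite le_eqVlt => /orP[/eqP ->|h1]; first exact: sq_integrable_increment01.
  apply: (@sq_integrable_independent _ _ _ _ _ (increment h 1)) => //.
    exact: increment_independent.
  by rewrite -increment_split; exact: sq_integrable_increment01.
have bounded n : forall t', s <= t' -> t' - s <= n%:R -> sq_integrable P (increment s t').
  elim: n => [|n IH] t' st' tn.
    have -> : t' = s by apply/eqP; rewrite eq_le st' andbT; lra.
    rewrite (_ : increment s s = fun=> 0); first exact: sq_integrable0.
    by apply/funext => w; rewrite /increment subrr.
  have [le1|gt1] := leP (t' - s) 1.
    have := sq_integrable_increment_shift s (_ : 0 <= t' - s) (small _ _ le1).
    by rewrite add0r subrK; apply; rewrite subr_ge0.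
  rewrite (increment_split s (t' - 1) t'); apply: sq_integrableD.
    by apply: IH; [lra|rewrite -natr1 in tn; lra].
  have := sq_integrable_increment_shift (t' - 1) ler01 (small 1 ler01 (lexx _)).
  by rewrite add0r [1 + _]addrC subrK.
move=> st; apply: (bounded (Num.truncn (t - s)).+1) => //.
exact/ltW/truncnS_gt.
Qed.

Lemma inner_increment_shift s t h : s <= t ->
  inner P (increment (s + h) (t + h)) (increment (s + h) (t + h)) =
  inner P (increment s t) (increment s t).
Proof.
move=> st; have sth : s + h <= t + h by rewrite lerD2r.
have hst := sq_integrable_increment st; have hsth := sq_integrable_increment sth.
apply: EFin_inj; rewrite -!integral_sqrE //.
apply: (expectation_increment h (g := fun x => (x ^+ 2)%:E)) => //.
- by apply/measurable_EFinP; exact: measurable_funX.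
- by move=> x; rewrite lee_fin sqr_ge0.
Qed.

Lemma mean_sqD1 X : sq_integrable P X ->
  inner P (fun w => X w + 1) (fun w => X w + 1) = inner P X X + 2 * mean X + mean (fun=> 1).
Proof.
move=> hX; have h1 := sq_integrable_cst P 1; have hX1 := sq_integrableD hX h1.
rewrite (innerDl hX h1 hX1) (innerDr hX h1 hX) (innerDr hX h1 h1).
by rewrite [inner P (fun=> 1) X]innerC; ring.
Qed.

(** Equality of laws is available through integrals of nonnegative functions, so the mean is
    recovered from the second moments of X and X + 1. *)
Lemma mean_increment_shift s t h : s <= t ->
  mean (increment (s + h) (t + h)) = mean (increment s t).
Proof.
move=> st.
have sth : s + h <= t + h by rewrite lerD2r.
have hst := sq_integrable_increment st; have hsth := sq_integrable_increment sth.
have h1 := sq_integrable_cst P 1.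
suff : inner P (fun w => increment (s + h) (t + h) w + 1) (fun w => increment (s + h) (t + h) w + 1) =
    inner P (fun w => increment s t w + 1) (fun w => increment s t w + 1).
  by rewrite !mean_sqD1 // ?inner_increment_shift //; lra.
apply: EFin_inj; rewrite -!integral_sqrE; try exact: sq_integrableD.
apply: (expectation_increment h (g := fun x => ((x + 1) ^+ 2)%:E)) => //.
- by apply/measurable_EFinP/measurable_funX/measurable_funD.
- by move=> x; rewrite lee_fin sqr_ge0.
Qed.

Definition mean_at t := mean (increment 0 t).
Definition sqmean_at t := inner P (increment 0 t) (increment 0 t).
Definition var_at t := sqmean_at t - mean_at t ^+ 2.

Lemma increment_additive s t : 0 <= s -> 0 <= t ->
  mean_at (s + t) = mean_at s + mean_at t /\
  sqmean_at (s + t) = sqmean_at s + sqmean_at t + 2 * mean_at s * mean_at t.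
Proof.
move=> s0 t0; have h1 := sq_integrable_cst P 1.
have z0 : increment 0 0 = fun=> 0 by apply/funext => w; rewrite /increment subrr.
have m0 : mean_at 0 = 0 by rewrite /mean_at z0 inner0l.
have v0 : sqmean_at 0 = 0 by rewrite /sqmean_at z0 inner0l.
move: s0; rewrite le_eqVlt => /orP[/eqP <-|s0].
  by rewrite !add0r m0 v0 !add0r mulr0 mul0r addr0.
move: t0; rewrite le_eqVlt => /orP[/eqP <-|t0].
  by rewrite !addr0 m0 v0 !addr0 mulr0 addr0.
have hs : sq_integrable P (increment 0 s) by apply: sq_integrable_increment; exact: ltW.
have ht : sq_integrable P (increment 0 t) by apply: sq_integrable_increment; exact: ltW.
have hst : sq_integrable P (increment s (s + t)).
  by apply: sq_integrable_increment; rewrite lerDl ltW.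
have ms : mean (increment s (s + t)) = mean_at t.
  by have := mean_increment_shift s (ltW t0); rewrite add0r addrC.
have vs : inner P (increment s (s + t)) (increment s (s + t)) = sqmean_at t.
  by have := inner_increment_shift s (ltW t0); rewrite add0r addrC.
rewrite /mean_at /sqmean_at !(increment_split 0 s (s + t)); split.
  by rewrite innerDl // ms.
have := inner_polarization hs hst; rewrite vs.
rewrite inner_independent //; first by rewrite ms -!/(mean_at _) /sqmean_at; lra.
by apply: increment_independent; rewrite // ltrDl.
Qed.

Lemma var_at_additive s t : 0 <= s -> 0 <= t -> var_at (s + t) = var_at s + var_at t.
Proof.
by move=> s0 t0; rewrite /var_at; have [-> ->] := increment_additive s0 t0; ring.
Qed.

Lemma mean_at1 : mean_at 1 = 0. Proof. exact: mean_increment01. Qed.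

Lemma var_at1 : var_at 1 = sigma ^+ 2.
Proof. by rewrite /var_at mean_at1 expr0n subr0; exact: inner_increment01. Qed.

Lemma inner11 : mean (fun=> 1) = 1.
Proof.
apply: EFin_inj; rewrite -integral_mulE; try exact: sq_integrable_cst.
by rewrite mulr1 integral_cst_probability.
Qed.

Lemma inner_centered X : sq_integrable P X ->
  inner P (fun w => X w - mean X) (fun w => X w - mean X) = inner P X X - mean X ^+ 2.
Proof.
move=> hX; have h1 := sq_integrable_cst P 1.
have -> : (fun w => X w - mean X) = (fun w => X w - mean X * 1).
  by apply/funext => w; rewrite mulr1.
have hm := sq_integrableZ (mean X) h1.
have hXm := sq_integrableB hX hm.
rewrite (innerBl hX hm hXm) (innerBr hX hm hX) (innerBr hX hm hm).
rewrite (innerZl _ h1 hm) (innerZl _ h1 hX) (innerZr _ h1 hX) (innerZr _ h1 h1).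
by rewrite inner11 [inner P (fun=> 1) X]innerC; ring.
Qed.

Lemma var_at_ge0 t : 0 <= t -> 0 <= var_at t.
Proof.
by move=> t0; rewrite /var_at -inner_centered ?inner_ge0 //; exact: sq_integrable_increment.
Qed.

(** The variance is additive and nonnegative, hence monotone: for N t <= 1, N times the variance at
    t is at most the variance sigma^2 at 1. *)
Lemma var_at_small e : 0 < e -> exists2 dl, 0 < dl & forall t, 0 <= t < dl -> var_at t <= e.
Proof.
move=> e0; pose N := (Num.truncn (sigma ^+ 2 / e)).+1.
have N0 : 0 < N%:R :> R by rewrite ltr0n.
exists N%:R^-1; first by rewrite invr_gt0.
move=> t /andP[t0 tN].
have vn n : var_at (n%:R * t) = n%:R * var_at t.
  elim: n => [|n IH]; last by rewrite -natr1 !mulrDl !mul1r var_at_additive ?IH // mulr_ge0.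
  by rewrite !mul0r; have := var_at_additive (lexx 0) (lexx 0); rewrite addr0; lra.
have Nt : N%:R * t <= 1 by rewrite mulrC -ler_pdivlMr // div1r ltW.
have : N%:R * var_at t <= sigma ^+ 2.
  have Nt0 : 0 <= N%:R * t by rewrite mulr_ge0.
  have Nt1 : 0 <= 1 - N%:R * t by rewrite subr_ge0.
  rewrite -vn -var_at1 (_ : var_at 1 = var_at (N%:R * t) + var_at (1 - N%:R * t)).
    by rewrite lerDl var_at_ge0.
  by rewrite -var_at_additive // addrC subrK.
have sN : sigma ^+ 2 < N%:R * e by rewrite -ltr_pdivrMr // truncnS_gt.
by move=> h; rewrite -(ler_pM2l N0); lra.
Qed.

(* Chebyshev: the increment is close to its mean because its variance is small,
   and close to 0 by stochastic continuity. *)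
Lemma mean_at_small e : 0 < e ->
  exists2 dl, 0 < dl & forall t, 0 <= t < dl -> `|mean_at t| <= e.
Proof.
move=> e0; pose k := e / 2; have k0 : 0 < k by rewrite divr_gt0.
have k4 : 0 < k ^+ 2 / 4 by rewrite divr_gt0 // exprn_gt0.
have [dl dl0 Hdl] := var_at_small k4.
have [_ _ _ hC _] := hL.
have /fine_cvgP[/nbhs_ballP[dl1 /= dl10 fin1] fcv] := hC 0 k k0.
have /cvgrPdist_le/(_ 4^-1) := fcv.
rewrite invr_gt0 ltr0n => /(_ isT)/nbhs_ballP[dl2 /= dl20 H2].
pose dm := Num.min dl (Num.min dl1 dl2).
exists dm; first by rewrite !lt_min dl0 dl10 dl20.
move=> t /andP[t0]; rewrite !lt_min => /and3P[tdl tdl1 tdl2].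
have ht := sq_integrable_increment t0.
have b1 : ball (0:R) dl1 t by rewrite /ball /= sub0r normrN ger0_norm.
have b2 : ball (0:R) dl2 t by rewrite /ball /= sub0r normrN ger0_norm.
have fP := fin1 t b1.
have := H2 t b2; rewrite sub0r normrN => HP.
have {HP}HP := le_trans (ler_norm _) HP.
rewrite leNgt; apply/negP => me.
have vt : var_at t <= k ^+ 2 / 4 by apply: Hdl; rewrite t0.
pose A := [set w | k < `|L t w - L 0 w|].
have mA : measurable A.
  have -> : A = setT `&` (Num.norm \o increment 0 t) @^-1` `]k, +oo[.
    by apply/seteqP; split => w /=; rewrite in_itv /= andbT // => -[].
  have mn : measurable_fun setT (Num.norm \o increment 0 t : T -> R).
    by apply: measurableT_comp => //; exact: measurable_increment.
  exact: mn.
pose m := mean_at t.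
have hc : sq_integrable P (fun w => increment 0 t w - m).
  by apply: sq_integrableB => //; exact: sq_integrable_cst.
(* If |m| > e = 2k, then outside [A] the increment is at distance at least k from m. Integrating
   gives 1 <= P(A) + var/k^2 <= 1/4 + 1/4, a contradiction. *)
have pw w : 1 <= (\1_A w : R) + (k ^+ 2)^-1 * (increment 0 t w - m) ^+ 2.
  rewrite indicE; have [wA|wA] := boolP (w \in A).
    by rewrite lerDl mulr_ge0 ?sqr_ge0 // invr_ge0 sqr_ge0.
  rewrite add0r -(ler_pM2l (_ : 0 < k ^+ 2)) ?exprn_gt0 // mulr1 mulVKf ?gt_eqF ?exprn_gt0 //.
  have {wA} : `|increment 0 t w| <= k.
    by rewrite leNgt; apply: contra wA => wA; rewrite inE.
  move=> Dk; rewrite -[leRHS]real_normK ?num_real // lerXn2r ?nnegrE //; first exact: ltW.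
  have := ler_normB m (m - increment 0 t w); rewrite opprB addrC subrK => _.
  have : `|m| <= `|increment 0 t w - m| + `|increment 0 t w|.
    by rewrite distrC (le_trans _ (ler_normD _ _)) // subrK.
  by rewrite -/m in me; rewrite /k in Dk *; lra.
have : (\int[P]_w (1%:E : \bar R) <= \int[P]_w ((\1_A w : R)%:E + ((k ^+ 2)^-1 * (increment 0 t w - m) ^+ 2)%:E))%E.
  apply: ge0_le_integral => //.
    apply/measurable_EFinP/measurable_funD; first exact: measurable_indic.
    apply: measurable_funM => //; apply: measurable_funX; exact: measurable_funB.
  by move=> w _; rewrite -EFinD lee_fin.
rewrite integral_cst_probability ge0_integralD //; last 3 first.
- by apply/measurable_EFinP; exact: measurable_indic.
- by move=> w _; rewrite lee_fin mulr_ge0 ?sqr_ge0 // invr_ge0 sqr_ge0.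
- apply/measurable_EFinP; apply: measurable_funM => //; apply: measurable_funX; exact: measurable_funB.
rewrite integral_indic // setIT.
under [X in (_ <= _ + X)%E]eq_integral do rewrite EFinM.
rewrite ge0_integralZl_EFin //; last 3 first.
- by move=> w _; rewrite lee_fin sqr_ge0.
- by apply/measurable_EFinP; apply: measurable_funX; exact: measurable_funB.
- by rewrite invr_ge0 sqr_ge0.
rewrite integral_sqrE // /m /mean_at inner_centered // -/(sqmean_at t) -/(mean_at t) -/(var_at t).
move=> h; have {h} : (1%:E <= (fine (P A))%:E + ((k ^+ 2)^-1 * var_at t)%:E)%E.
  by rewrite fineK // EFinM; exact: h.
rewrite -EFinD lee_fin.
have k20 : 0 < k ^+ 2 by rewrite exprn_gt0.
have : (k ^+ 2)^-1 * var_at t <= 4^-1.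
  by rewrite mulrC ler_pdivrMr //; lra.
by move: HP; rewrite -/A; set x := fine _; lra.
Qed.

Lemma mean_at_eq0 t : 0 <= t -> mean_at t = 0.
Proof.
apply: additive_eq0; [|exact: mean_at1|exact: mean_at_small].
by move=> s t' s0 t0; have [] := increment_additive s0 t0.
Qed.

Lemma sqmean_atE t : 0 <= t -> sqmean_at t = sigma ^+ 2 * t.
Proof.
move=> t0; have : var_at t - sigma ^+ 2 * t = 0; last first.
  by rewrite /var_at mean_at_eq0 // expr0n subr0; lra.
move: t t0; apply: additive_eq0.
- by move=> s t s0 t0; rewrite var_at_additive //; ring.
- by rewrite var_at1; ring.
- move=> e e0; have [dl dl0 Hdl] := var_at_small e0.
  have s1 : 0 < sigma ^+ 2 + 1 by have := sqr_ge0 sigma; lra.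
  exists (Num.min dl (e / (sigma ^+ 2 + 1))); first by rewrite lt_min dl0 divr_gt0.
  move=> t /andP[t0]; rewrite lt_min => /andP[tdl]; rewrite ltr_pdivlMr // => te.
  have ve : var_at t <= e by apply: Hdl; rewrite t0.
  have v0 := var_at_ge0 t0; have := sqr_ge0 sigma.
  by rewrite ler_norml => s0; apply/andP; split; nra.
Qed.

Lemma inner_increment_self s t : s <= t ->
  inner P (increment s t) (increment s t) = sigma ^+ 2 * (t - s).
Proof.
move=> st; have ts : 0 <= t - s by rewrite subr_ge0.
have := inner_increment_shift s ts.
by rewrite add0r subrK => ->; exact: sqmean_atE.
Qed.

Lemma mean_increment s t : s <= t -> mean (increment s t) = 0.
Proof.
move=> st; have ts : 0 <= t - s by rewrite subr_ge0.
have := mean_increment_shift s ts.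
by rewrite add0r subrK => ->; exact: mean_at_eq0.
Qed.

Lemma inner_increment_nested c x y : c <= x -> x <= y ->
  inner P (increment c x) (increment c y) = sigma ^+ 2 * (x - c).
Proof.
move=> cx xy; have h1 := sq_integrable_increment cx; have h2 := sq_integrable_increment xy.
rewrite (increment_split c x y) (innerDr h1 h2 h1) inner_increment_self //.
move: cx; rewrite le_eqVlt => /orP[/eqP cx|cx].
  rewrite cx; have -> : increment x x = fun=> 0 by apply/funext => w; rewrite /increment subrr.
  by rewrite inner0l addr0.
move: xy; rewrite le_eqVlt => /orP[/eqP xy|xy].
  rewrite xy; have -> : increment y y = fun=> 0 by apply/funext => w; rewrite /increment subrr.
  by rewrite innerC inner0l addr0.
rewrite [X in _ + X]inner_independent //; last exact: increment_independent.
by rewrite mean_increment ?ltW // mul0r addr0.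
Qed.

End LevyIncrements.

(** * The Levy isometry, from intervals through step functions to the L^2 limit *)

Section IntervalIndicators.
Variable R : realType.
Local Notation leb := (@lebesgue_measure R).

Lemma measurable_itv_indic (s t : R) : measurable_fun setT (\1_`]s, t] : R -> R).
Proof. exact: measurable_indic. Qed.

Lemma integral_itv_indic (s t : R) : s <= t ->
  (\int[leb]_x (\1_`]s, t] x : R)%:E = (t - s)%:E)%E.
Proof.
move=> st; rewrite integral_indic // setIT.
apply: etrans (lebesgue_measure_itv `]s, t]) _.
by rewrite /= lte_fin; case: ltP => // ts; congr EFin; lra.
Qed.

Lemma sq_integrable_itv_indic (s t : R) : s <= t -> sq_integrable leb (\1_`]s, t] : R -> R).
Proof.
move=> st; apply: sq_integrableP; first exact: measurable_itv_indic.
rewrite (_ : (\int[leb]_x _)%E = (t - s)%:E); first exact: ltry.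
rewrite -integral_itv_indic //; apply: eq_integral => x _.
by rewrite indicE; case: (_ \in _); rewrite ?expr1n ?expr0n.
Qed.

Lemma inner_itv_indic (c x y : R) : c <= x -> x <= y ->
  inner leb (\1_`]c, x] : R -> R) (\1_`]c, y] : R -> R) = x - c.
Proof.
move=> cx xy; rewrite /inner -[RHS]/(fine (x - c)%:E) -integral_itv_indic //.
congr fine; apply: eq_integral => z _; rewrite !indicE !mem_setE /=.
congr EFin; rewrite !in_itv /=; case: (c < z) => /=; last by rewrite mul0r.
by case: (leP z x) => zx; rewrite ?mul0r // (le_trans zx xy) mulr1.
Qed.

Lemma itv_indic_split (c s t x : R) : c <= s -> s <= t ->
  (\1_`]s, t] x : R) = \1_`]c, t] x - \1_`]c, s] x.
Proof.
move=> cs st; rewrite !indicE !mem_setE !in_itv /=.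
case: (ltP s x) => sx; case: (ltP c x) => cx; case: (leP x t) => xt;
  rewrite ?subr0 ?subrr //=; lra.
Qed.

End IntervalIndicators.

Section Isometry.
Context d (T : measurableType d) (R : realType) (P : probability T R).
Variables (L : R -> {RV P >-> R}) (sigma : R).
Hypothesis hL : levy_process L.
Hypothesis hmean : 'E_P[(L 1)%R]%E = 0%E.
Hypothesis hvar : 'E_P[fun w => (L 1 w ^+ 2)%R]%E = (sigma ^+ 2)%:E%E.
Local Notation leb := (@lebesgue_measure R).
Local Notation incr := (increment L).

Lemma increment_isometry_nested c x y : c <= x -> c <= y ->
  inner P (incr c x) (incr c y) =
  sigma ^+ 2 * inner leb (\1_`]c, x] : R -> R) (\1_`]c, y] : R -> R).
Proof.
move=> cx cy; have [xy|/ltW yx] := leP x y.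
  by rewrite (inner_increment_nested hL hmean hvar) // inner_itv_indic.
by rewrite innerC [inner leb _ _]innerC (inner_increment_nested hL hmean hvar) // inner_itv_indic.
Qed.

(** Both sides are bilinear, and each interval is a difference of two intervals starting at the
    common left end [c]; for these one contains the other. *)
Lemma increment_isometry s t s' t' : s <= t -> s' <= t' ->
  inner P (incr s t) (incr s' t') =
  sigma ^+ 2 * inner leb (\1_`]s, t] : R -> R) (\1_`]s', t'] : R -> R).
Proof.
move=> st st'; pose c := Num.min s s'.
have cs : c <= s by rewrite ge_min lexx.
have cs' : c <= s' by rewrite ge_min lexx orbT.
have ct := le_trans cs st; have ct' := le_trans cs' st'.
have E a b : incr a b = (fun w => incr c b w - incr c a w).
  by apply/funext => w; rewrite /increment; ring.
have I a b : c <= a -> a <= b ->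
    (\1_`]a, b] : R -> R) = (fun x => \1_`]c, b] x - \1_`]c, a] x).
  by move=> ca ab; apply/funext => x; exact: itv_indic_split.
have h x : c <= x -> sq_integrable P (incr c x).
  by move=> cx; exact: (sq_integrable_increment hL hvar cx).
have h' x : c <= x -> sq_integrable leb (\1_`]c, x] : R -> R).
  exact: sq_integrable_itv_indic.
rewrite (E s t) (E s' t') (I s t) // (I s' t') //.
have hst := sq_integrableB (h _ ct) (h _ cs).
have hst' := sq_integrableB (h _ ct') (h _ cs').
have jst := sq_integrableB (h' _ ct) (h' _ cs).
have jst' := sq_integrableB (h' _ ct') (h' _ cs').
rewrite (innerBl (h _ ct) (h _ cs) hst') !(innerBr (h _ ct') (h _ cs')) //; try exact: h.
rewrite (innerBl (h' _ ct) (h' _ cs) jst') !(innerBr (h' _ ct') (h' _ cs')) //; try exact: h'.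
by rewrite !increment_isometry_nested //; ring.
Qed.

Lemma step_isometry u : all (fun k : R * (R * R) => k.2.1 <= k.2.2) u ->
  [/\ sq_integrable P (step_integral L u), sq_integrable leb (step_fun u) &
  inner P (step_integral L u) (step_integral L u) =
  sigma ^+ 2 * inner leb (step_fun u) (step_fun u)].
Proof.
move=> hu.
(* [v] is the identity on the entries of [u] but orders the endpoints of every entry whatsoever,
   because the bilinear expansion requires every summand to be square-integrable, not only those
   indexed by [u]. *)
pose v k := (k.1 : R, (Num.min k.2.1 k.2.2, k.2.2 : R)).
have uv : u = map v u.
  elim: u hu => //= k u IH /andP[kk /IH <-]; congr (_ :: _).
  by case: k kk => c [s t] /= st; rewrite /v /= (min_idPl st).
have vle (k : R * (R * R)) : (v k).2.1 <= (v k).2.2 by rewrite /= ge_min lexx orbT.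
have hP (k : R * (R * R)) : sq_integrable P (fun w => (v k).1 * incr (v k).2.1 (v k).2.2 w).
  by apply: sq_integrableZ; exact: (sq_integrable_increment hL hvar).
have hl (k : R * (R * R)) : sq_integrable leb (fun x => (v k).1 * (\1_`](v k).2.1, (v k).2.2] x)).
  by apply: sq_integrableZ; exact: sq_integrable_itv_indic.
have SE : step_integral L u = (fun w => \sum_(k <- u) (v k).1 * incr (v k).2.1 (v k).2.2 w).
  by apply/funext => w; rewrite /step_integral {1}uv big_map.
have FE : step_fun u = (fun x => \sum_(k <- u) (v k).1 * (\1_`](v k).2.1, (v k).2.2] x)).
  by apply/funext => w; rewrite /step_fun {1}uv big_map.
rewrite SE FE; split; [exact: sq_integrable_sum|exact: sq_integrable_sum|].
have hPs := sq_integrable_sum u hP; have hls := sq_integrable_sum u hl.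
rewrite inner_suml // inner_suml // mulr_sumr; apply: eq_bigr => k _.
rewrite inner_sumr // inner_sumr // mulr_sumr; apply: eq_bigr => k' _.
have hi (x : R * (R * R)) := sq_integrable_increment hL hvar (vle x).
have hj (x : R * (R * R)) := sq_integrable_itv_indic (vle x).
rewrite (innerZl _ (hi k) (hP k')) (innerZr _ (hi k') (hi k)).
rewrite (innerZl _ (hj k) (hl k')) (innerZr _ (hj k') (hj k)).
by rewrite increment_isometry //; ring.
Qed.

Lemma levy_integral_norm f X : is_levy_integral L f X ->
  [/\ sq_integrable P X, sq_integrable leb f &
    inner P X X = sigma ^+ 2 * inner leb f f].
Proof.
move=> [mf [u [uok fu Xu]]].
have hS n : sq_integrable P (step_integral L (u n)) by have [] := step_isometry (uok n).
have hF n : sq_integrable leb (step_fun (u n)) by have [] := step_isometry (uok n).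
have Xu' : (\int[P]_w ((X w - step_integral L (u n) w) ^+ 2)%:E)%E @[n --> \oo] --> 0%E.
  by move: Xu; rewrite unlock.
have mX : measurable_fun setT X by exact: measurable_funPT.
split; [exact: sq_integrable_limit Xu'|exact: sq_integrable_limit fu|].
have c1 := inner_limit mX hS Xu'.
have c2 : sigma ^+ 2 * inner leb (step_fun (u n)) (step_fun (u n)) @[n --> \oo]
    --> sigma ^+ 2 * inner leb f f by apply: cvgMr; exact: inner_limit.
have e : (fun n => inner P (step_integral L (u n)) (step_integral L (u n))) =
    (fun n => sigma ^+ 2 * inner leb (step_fun (u n)) (step_fun (u n))).
  by apply/funext => n; have [] := step_isometry (uok n).
rewrite e in c1; exact: cvg_unique c1 c2.
Qed.

(** From (x + y)^2 <= 2 x^2 + 2 y^2, applied to the two approximation errors. *)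
Lemma sq_distD_cvg0 d' (T' : measurableType d') (mu : {measure set T' -> \bar R})
    (f g : T' -> R) (S S' : nat -> T' -> R) :
  sq_integrable mu f -> sq_integrable mu g ->
  (forall n, sq_integrable mu (S n)) -> (forall n, sq_integrable mu (S' n)) ->
  (\int[mu]_x ((f x - S n x) ^+ 2)%:E)%E @[n --> \oo] --> 0%E ->
  (\int[mu]_x ((g x - S' n x) ^+ 2)%:E)%E @[n --> \oo] --> 0%E ->
  (\int[mu]_x (((f x + g x) - (S n x + S' n x)) ^+ 2)%:E)%E @[n --> \oo] --> 0%E.
Proof.
move=> hf hg hS hS' cS cS'.
have hfS n := sq_integrableB hf (hS n); have hgS n := sq_integrableB hg (hS' n).
have hfg n := sq_integrableD (hfS n) (hgS n).
have E n : (\int[mu]_x (((f x + g x) - (S n x + S' n x)) ^+ 2)%:E)%E =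
    (inner mu (fun x => (f x - S n x) + (g x - S' n x)) (fun x => (f x - S n x) + (g x - S' n x)))%:E.
  rewrite -integral_sqrE //; apply: eq_integral => x _; congr ((_ ^+ 2)%:E); ring.
under eq_fun do rewrite E.
have re (h : T' -> R) (Q : nat -> T' -> R) : (forall n, sq_integrable mu (fun x => h x - Q n x)) ->
    (\int[mu]_x ((h x - Q n x) ^+ 2)%:E)%E @[n --> \oo] --> 0%E ->
    inner mu (fun x => h x - Q n x) (fun x => h x - Q n x) @[n --> \oo] --> (0:R).
  move=> hQ; under eq_fun do rewrite integral_sqrE //.
  by move/fine_cvgP => [_].
have r1 := re _ _ hfS cS; have r2 := re _ _ hgS cS'.
apply: cvg_EFin; first by near=> n.
apply: (@squeeze_cvgr _ _ _ _ (fun=> 0) (fun n => 2 * inner mu (fun x => f x - S n x) (fun x => f x - S n x)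
   + 2 * inner mu (fun x => g x - S' n x) (fun x => g x - S' n x))).
- near=> n; rewrite inner_ge0 /=.
  have := inner_quadratic (-1) (hfS n) (hgS n).
  rewrite (inner_polarization (hfS n) (hgS n)); lra.
- exact: cvg_cst.
- rewrite -[X in _ --> X](addr0 0) -{1}(mulr0 2) -{2}(mulr0 2).
  by apply: cvgD; apply: cvgMr.
Unshelve. all: by end_near.
Qed.

Lemma levy_integralD f g (X Y Z : {RV P >-> R}) : (forall w, Z w = X w + Y w) ->
  is_levy_integral L f X -> is_levy_integral L g Y ->
  is_levy_integral L (fun x => f x + g x) Z.
Proof.
move=> ZE hfX hgY.
have [hX hf _] := levy_integral_norm hfX; have [hY hg _] := levy_integral_norm hgY.
have [mf [u [uok fu Xu]]] := hfX; have [mg [v [vok gv Yv]]] := hgY.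
split; first exact: measurable_funD.
exists (fun n => u n ++ v n); split.
- by move=> n; rewrite all_cat uok vok.
- under eq_fun => n do under eq_integral do rewrite /step_fun big_cat /=.
  by apply: sq_distD_cvg0 => // n; [have [] := step_isometry (uok n)|have [] := step_isometry (vok n)].
- move: Xu Yv; rewrite unlock => Xu Yv.
  under eq_fun => n do under eq_integral do rewrite ZE /step_integral big_cat /=.
  by apply: sq_distD_cvg0 => // n; [have [] := step_isometry (uok n)|have [] := step_isometry (vok n)].
Qed.

(** X + Y is an integral of f + g, so equality of norms passes to inner products by polarization on
    both sides. *)
Lemma levy_isometry f g X Y : is_levy_integral L f X -> is_levy_integral L g Y ->
  inner P X Y = sigma ^+ 2 * inner leb f g.
Proof.
move=> hfX hgY.
have [hX hf eX] := levy_integral_norm hfX; have [hY hg eY] := levy_integral_norm hgY.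
have mXY : measurable_fun setT (fun w => X w + Y w) by apply: measurable_funD; exact: measurable_funPT.
have [_ _] := levy_integral_norm (@levy_integralD _ _ _ _ (rv_of P mXY) (fun=> erefl) hfX hgY).
rewrite /= => e.
by rewrite (inner_polarization hX hY) (inner_polarization hf hg) e eX eY; ring.
Qed.

End Isometry.

(** * Spectral factorization of moving averages *)

Lemma poly_eq_nonzero (F : numFieldType) (p q : {poly F}) :
  (forall x, x != 0 -> p.[x] = q.[x]) -> p = q.
Proof.
move=> pq; apply/eqP; rewrite -subr_eq0; apply/negPn/negP => n0.
pose rs : seq F := [seq i.+1%:R | i <- iota 0 (size (p - q))].
have := @max_poly_roots _ (p - q) rs n0.
rewrite size_map size_iota ltnn => H; suff : false by [].
apply: H; last by rewrite map_inj_uniq ?iota_uniq // => i j /eqP; rewrite eqr_nat => /eqP [].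
apply/allP => x /mapP[i _ ->].
by rewrite rootE hornerD hornerN pq ?subrr // pnatr_eq0.
Qed.

(** This is z^n p(1/z), a polynomial substitute for p(1/z). The fixed [n], rather than the degree of
    [p], makes it depend linearly on [p], which matters in the limit. *)
Definition rev_poly (F : nzRingType) n (p : {poly F}) : {poly F} := \poly_(i < n.+1) p`_(n - i).

Lemma horner_rev_poly (F : fieldType) n (p : {poly F}) z : (size p <= n.+1)%N -> z != 0 ->
  (rev_poly n p).[z] = z ^+ n * p.[z^-1].
Proof.
move=> pn z0; rewrite (horner_coef_wide _ pn) horner_poly mulr_sumr.
rewrite (reindex_inj rev_ord_inj) /=; apply: eq_bigr => i _.
have hi : (i <= n)%N := leq_ord i.
have -> : z ^+ n = z ^+ (n - i) * z ^+ i by rewrite -exprD subnK.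
rewrite subSS subKn // exprVn; field.
by rewrite expf_neq0.
Qed.

Lemma map_rev_poly (F F' : nzRingType) (f : {rmorphism F -> F'}) n (p : {poly F}) :
  map_poly f (rev_poly n p) = rev_poly n (map_poly f p).
Proof.
apply/polyP => i; rewrite coef_map [(rev_poly n p)`_i]coef_poly [RHS]coef_poly.
by case: ifP => _; [rewrite coef_map|rewrite raddf0].
Qed.

Section Factorization.
Variable R : realType.
Implicit Types (s : seq R[i]) (z : R[i]).

Lemma horner_lag_poly (F : fieldType) (s : seq F) x :
  (lag_poly s).[x] = \prod_(c <- s) (1 - c * x).
Proof.
by rewrite /lag_poly horner_prod; apply: eq_bigr => c _; rewrite !hornerE.
Qed.

Lemma lag_poly_nseq0 (F : fieldType) (s : seq F) m : lag_poly (s ++ nseq m 0) = lag_poly s.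
Proof.
rewrite /lag_poly big_cat /= [X in _ * X]big1_seq ?mulr1 // => c /andP[_].
by rewrite mem_nseq => /andP[_ /eqP ->]; rewrite mul0r subr0.
Qed.

Lemma rev_lag_poly (F : numFieldType) (s : seq F) : rev_poly (size s) (lag_poly s) = roots_poly s.
Proof.
apply: poly_eq_nonzero => x x0; rewrite horner_rev_poly ?size_lag_poly //.
rewrite horner_lag_poly /roots_poly horner_prod.
elim: s => [|c s IH]; first by rewrite !big_nil mulr1.
by rewrite !big_cons /= -IH hornerXsubC exprS; field.
Qed.

Definition ma_admissible n (q : {poly R}) := [/\ (size q <= n.+1)%N, q.[0] = 1 &
  forall z : R[i], `|z| < 1 -> ~~ root (polyC_of q) z].

(** The entries of [s] are the inverses of the zeroes. Padding with 0, which contributes the trivial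
    factor 1 - 0 z, makes the length exactly [n] whatever the degree of [q]. *)
Lemma ma_factor n (q : {poly R}) : ma_admissible n q ->
  exists s : seq R[i], [/\ size s = n, forall c, c \in s -> modulus c <= 1 & polyC_of q = lag_poly s].
Proof.
move=> [qn q0 qroot].
have [r Er] := closed_field_poly_normal (polyC_of q).
have q00 : (polyC_of q).[0] = 1.
  by rewrite -[0](rmorph0 (real_complex R)) horner_map q0 rmorph1.
have lc0 : lead_coef (polyC_of q) != 0.
  apply/eqP => l0; move: q00; rewrite Er l0 scale0r horner0 => /eqP.
  by rewrite eq_sym oner_eq0.
have szr : (size r <= n)%N.
  rewrite -ltnS -(size_prod_XsubC r id) -(size_scale _ lc0) -Er.
  by rewrite size_map_poly.
have r1 z : z \in r -> 1 <= modulus z.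
  move=> zr; rewrite leNgt; apply/negP => z1.
  have : root (polyC_of q) z by rewrite Er rootZ // root_prod_XsubC.
  by apply/negP/qroot; rewrite -modulusE -[1]/(1%:C) ltcR.
have rn0 z : z \in r -> z != 0.
  by move=> /r1 h; rewrite -modulus_gt0; lra.
exists ([seq z^-1 | z <- r] ++ nseq (n - size r) 0); split.
- by rewrite size_cat size_map size_nseq subnKC.
- move=> c; rewrite mem_cat => /orP[/mapP[z zr ->]|].
    by rewrite modulusV invf_le1 ?r1 // modulus_gt0 rn0.
  by rewrite mem_nseq => /andP[_ /eqP ->]; rewrite modulus0.
rewrite lag_poly_nseq0.
have [k Ek] : exists k, polyC_of q = k *: lag_poly [seq z^-1 | z <- r].
  rewrite Er; move: (lead_coef _) => k.
  exists (k * \prod_(z <- r) (- z)); rewrite -scalerA; congr (_ *: _).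
  rewrite /lag_poly big_map -mul_polyC rmorph_prod /= -big_split /=.
  rewrite big_seq [RHS]big_seq; apply: eq_bigr => z /rn0 z0.
  by rewrite mulrBr mulr1 mulrA -polyCM mulNr mulfV // !polyCN polyC1 mulN1r opprK addrC.
move: q00; rewrite Ek hornerZ horner_lag_poly big1 => [|c _]; last by rewrite mulr0 subr0.
by rewrite mulr1 => ->; rewrite scale1r.
Qed.

Lemma ma_coef_bound n (q : {poly R}) j : ma_admissible n q -> `|q`_j| <= 2 ^+ n.
Proof.
move=> /ma_factor[s [sn s1 Es]]; rewrite -modulus_real.
have -> : (q`_j)%:C = (lag_poly s)`_j by rewrite -Es /polyC_of coef_map.
rewrite -sn; elim: s s1 j {Es sn} => [|c s IH] s1 j.
  rewrite /lag_poly big_nil coef1 expr0; case: (j == 0%N); rewrite ?modulus0 ?modulus1 //.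
rewrite coef_lag_poly_cons (le_trans (ler_modulusB _ _)) // exprS modulusM.
have {}IH k : modulus (lag_poly s)`_k <= 2 ^+ size s.
  by apply: IH => c' c's; apply: s1; rewrite inE c's orbT.
have c1 : modulus c <= 1 by apply: s1; rewrite mem_head.
have h2 : modulus c * modulus (if j is i.+1 then (lag_poly s)`_i else 0) <= 2 ^+ size s.
  rewrite -[leRHS]mul1r ler_pM ?modulus_ge0 //; case: j => [|j] //.
  by rewrite modulus0 exprn_ge0.
by have := IH j; lra.
Qed.

Lemma ma_lower_bound n (q : {poly R}) z : ma_admissible n q -> modulus z < 1 ->
  (1 - modulus z) ^+ n <= modulus (polyC_of q).[z].
Proof.
move=> /ma_factor[s [sn s1 ->]] z1; rewrite horner_lag_poly -sn.
elim: s s1 {sn} => [|c s IH] s1; first by rewrite big_nil modulus1 expr0.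
rewrite big_cons modulusM exprS ler_pM ?exprn_ge0 //; try lra.
  have := lerB_modulus 1 (c * z); rewrite modulus1 modulusM.
  have c1 : modulus c <= 1 by apply: s1; rewrite mem_head.
  by have := modulus_ge0 z; nra.
by apply: IH => c' c's; apply: s1; rewrite inE c's orbT.
Qed.

(** The conjugate of the head [e] of [s1] is a zero of the right-hand side. Either [e] lies in [s2],
    or c conj(e) = 1 for some [c] in [s2]; as both moduli are at most 1, then |e| = 1 and c = e. The
    common factor is cancelled and the induction goes on. *)
Lemma spectral_perm s1 s2 (k1 k2 : R[i]) : k1 != 0 -> k2 != 0 ->
  (forall c, c \in s1 -> modulus c <= 1) -> (forall c, c \in s2 -> modulus c <= 1) ->
  size s1 = size s2 ->
  k1 *: (roots_poly [seq conjc c | c <- s1] * lag_poly s1) =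
  k2 *: (roots_poly [seq conjc c | c <- s2] * lag_poly s2) -> perm_eq s1 s2.
Proof.
move=> k10 k20; elim: s1 s2 => [|e s1 IH] s2 h1 h2 sz E; first by case: s2 sz {h2 E}.
have es2 : e \in s2.
  have : (k2 *: (roots_poly [seq conjc c | c <- s2] * lag_poly s2)).[conjc e] == 0.
    by rewrite -E hornerZ hornerM /roots_poly big_cons hornerM hornerXsubC subrr !mul0r mulr0.
  rewrite hornerZ hornerM !mulf_eq0 (negPf k20) /= horner_roots_poly_eq0.
  case/orP => [/mapP[c cs /(can_inj (@conjcK R)) ->//]|].
  rewrite horner_lag_poly prodf_seq_eq0 => /hasP[c cs /=].
  rewrite subr_eq0 => /eqP ce.
  have me : modulus (conjc e) = modulus e by rewrite /modulus normcJ.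
  have m1 : modulus c * modulus e = 1 by rewrite -me -modulusM -ce modulus1.
  have ce1 := h2 c cs; have ee1 : modulus e <= 1 by apply: h1; rewrite mem_head.
  have e1 : modulus e = 1.
    by have := modulus_ge0 e; have := modulus_ge0 c; nra.
  have e0 : conjc e != 0 by rewrite -modulus_eq0 me e1 oner_eq0.
  suff -> : e = c by [].
  apply: (mulIf e0); rewrite -ce -sqr_normc -modulusE e1.
  by rewrite -rmorphXn expr1n.
have p2 := perm_to_rem es2.
rewrite (perm_trans _ (_ : perm_eq (e :: rem e s2) s2)) ?[perm_eq _ s2]perm_sym //.
rewrite perm_cons; apply: IH.
- by move=> c cs; apply: h1; rewrite inE cs orbT.
- by move=> c /mem_rem; exact: h2.
- by rewrite size_rem // -sz.
have fac (s : seq R[i]) : roots_poly [seq conjc c | c <- e :: s] * lag_poly (e :: s) =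
    (('X - (conjc e)%:P) * (1 - e%:P * 'X)) * (roots_poly [seq conjc c | c <- s] * lag_poly s).
  by rewrite /roots_poly /lag_poly !big_cons mulrACA.
have E2 : roots_poly [seq conjc c | c <- s2] * lag_poly s2 =
    roots_poly [seq conjc c | c <- e :: rem e s2] * lag_poly (e :: rem e s2).
  rewrite /roots_poly /lag_poly (perm_big _ p2); congr (_ * _).
  by rewrite !big_map (perm_big _ p2).
move: E; rewrite E2 !fac !scalerAr; apply: mulfI.
rewrite mulf_neq0 ?polyXsubC_eq0 //; apply/eqP => e0.
by have := congr1 (horner^~ 0) e0; rewrite /= !(hornerE, mulr0, subr0) => /eqP; rewrite oner_eq0.
Qed.

(** For a real polynomial the list of inverse zeroes is stable under conjugation, so the reversed
    polynomial is the product over the conjugates that [spectral_perm] expects. *)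
Lemma spectral_unique n (q1 q2 : {poly R}) (k1 k2 : R) : k1 != 0 -> k2 != 0 ->
  ma_admissible n q1 -> ma_admissible n q2 ->
  k1 *: (rev_poly n q1 * q1) = k2 *: (rev_poly n q2 * q2) -> q1 = q2.
Proof.
move=> k10 k20 a1 a2 E.
have [s1 [sz1 h1 E1]] := ma_factor a1; have [s2 [sz2 h2 E2]] := ma_factor a2.
have revE (q : {poly R}) (s : seq R[i]) : size s = n -> polyC_of q = lag_poly s ->
    polyC_of (rev_poly n q) = roots_poly [seq conjc c | c <- s].
  move=> sn qs.
  have e : polyC_of (rev_poly n q) = roots_poly s.
    by rewrite /polyC_of map_rev_poly -/(polyC_of q) qs -sn rev_lag_poly.
  rewrite e; have /perm_conjc_roots := e => ps.
  by rewrite /roots_poly (perm_big _ ps).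
have kc (k : R) : k != 0 -> k%:C != 0 :> R[i].
  by move=> k0; rewrite -modulus_eq0 modulus_real normr_eq0.
have pe : perm_eq s1 s2.
  apply: (spectral_perm (kc _ k10) (kc _ k20) h1 h2); first by rewrite sz1.
  rewrite -(revE _ _ sz1 E1) -(revE _ _ sz2 E2) -E1 -E2 /polyC_of.
  by rewrite -!rmorphM -!(map_polyZ (real_complex R)) E.
apply: (@map_inj_poly _ _ (real_complex R)) => //; first exact: complexI.
by rewrite -!/(polyC_of _) E1 E2 /lag_poly (perm_big _ pe).
Qed.

End Factorization.

Lemma cvg_sumr (R : realType) (T I : Type) (F : set_system T) (FF : Filter F) (r : seq I)
    (f : I -> T -> R) (l : I -> R) : (forall i, f i x @[x --> F] --> l i) ->
  \sum_(i <- r) f i x @[x --> F] --> \sum_(i <- r) l i.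
Proof.
move=> fl; elim: r => [|i r IH].
  by rewrite big_nil; under eq_fun do rewrite big_nil; exact: cvg_cst.
by rewrite big_cons; under eq_fun do rewrite big_cons; exact: cvgD.
Qed.

(** * Continuity of the spectral factorization, by compactness *)

Section SpectralLimit.
Variables (R : realType) (n : nat).
Local Notation V := ('rV[R]_n.+1).

Lemma horner_rVpoly_sum (v : V) z : (rVpoly v).[z] = \sum_(i < n.+1) v 0 i * z ^+ i.
Proof.
rewrite (horner_coef_wide _ (size_poly _ _)); apply: eq_bigr => i _.
by rewrite coef_rVpoly_ord.
Qed.

Lemma horner_rev_rVpoly_sum (v : V) z :
  (rev_poly n (rVpoly v)).[z] = \sum_(i < n.+1) v 0 (rev_ord i) * z ^+ i.
Proof.
rewrite horner_poly; apply: eq_bigr => i _.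
by rewrite -[RHS]/(v 0 _ * _) -coef_rVpoly_ord /= subSS.
Qed.

Lemma cvg_lin_form (H : set_system V) {FH : Filter H} (v : V) (c : 'I_n.+1 -> R) :
  H --> v -> \sum_i w 0 i * c i @[w --> H] --> \sum_i v 0 i * c i.
Proof.
move=> Hv; apply: cvg_sumr => i; apply: cvgMr_tmp.
apply: (@cvg_comp _ _ _ id (fun w : V => w 0 i) H (nbhs v)) => //.
exact: coord_continuous.
Qed.

Lemma cvg_horner_rVpoly (H : set_system V) {FH : Filter H} (v : V) z : H --> v ->
  (rVpoly w).[z] @[w --> H] --> (rVpoly v).[z].
Proof.
move=> Hv; rewrite horner_rVpoly_sum; under eq_fun do rewrite horner_rVpoly_sum.
exact: cvg_lin_form.
Qed.

Lemma cvg_horner_rev_rVpoly (H : set_system V) {FH : Filter H} (v : V) z : H --> v ->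
  (rev_poly n (rVpoly w)).[z] @[w --> H] --> (rev_poly n (rVpoly v)).[z].
Proof.
move=> Hv; rewrite horner_rev_rVpoly_sum; under eq_fun do rewrite horner_rev_rVpoly_sum.
have e (w : V) : \sum_(i < n.+1) w 0 (rev_ord i) * z ^+ i = \sum_(i < n.+1) w 0 i * z ^+ rev_ord i :> R.
  by rewrite (reindex_inj rev_ord_inj); apply: eq_bigr => i _; rewrite rev_ordK.
rewrite e; have := @cvg_lin_form H FH v (fun i => z ^+ rev_ord i) Hv.
by apply: cvg_trans; apply: near_eq_cvg; apply: nearW => w; rewrite e.
Qed.

(* The lower bound [ma_lower_bound] is a closed condition that excludes zeroes in
   the open disc. *)
Lemma admissible_limit (H : set_system V) (PH : ProperFilter H) (v : V) : H --> v ->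
  (\forall w \near H, ma_admissible n (rVpoly w)) -> ma_admissible n (rVpoly v).
Proof.
move=> Hv adm; split; first exact: size_poly.
  have c1 := cvg_horner_rVpoly (z := 0) Hv.
  have c2 : (rVpoly w).[0] @[w --> H] --> (1:R).
    by apply: cvg_near_cst; apply: filterS adm => w [_ w0 _].
  by rewrite -(cvg_lim _ (c1 _)) // -(cvg_lim _ c2).
move=> z z1; have {}z1 : modulus z < 1 by rewrite -ltcR modulusE.
rewrite rootE -modulus_eq0 gt_eqF //.
have low (w : V) : ma_admissible n (rVpoly w) -> (1 - modulus z) ^+ n <= modulus (polyC_of (rVpoly w)).[z].
  by move=> hw; exact: ma_lower_bound.
have hornE (w : V) : (polyC_of (rVpoly w)).[z] =
   (\sum_(i < n.+1) w 0 i * complex.Re (z ^+ i)) +i* (\sum_(i < n.+1) w 0 i * complex.Im (z ^+ i)).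
  have szw : (size (polyC_of (rVpoly w)) <= n.+1)%N by rewrite size_map_poly size_poly.
  rewrite (horner_coef_wide _ szw).
  rewrite (_ : \sum_(i < n.+1) _ = \sum_(i < n.+1) ((w 0 i * complex.Re (z ^+ i)) +i* (w 0 i * complex.Im (z ^+ i)))).
    by elim/big_rec3: _ => // i x y c _ ->.
  apply: eq_bigr => i _; rewrite /polyC_of coef_map coef_rVpoly_ord /=.
  by case: (z ^+ i) => x y /=; simpc.
(* The squared modulus is a polynomial in the coordinates of [w], so its limit reduces to limits of
   real linear forms. *)
pose m2 (w : V) := (\sum_(i < n.+1) w 0 i * complex.Re (z ^+ i)) ^+ 2 + (\sum_(i < n.+1) w 0 i * complex.Im (z ^+ i)) ^+ 2.
have mE w : modulus (polyC_of (rVpoly w)).[z] = Num.sqrt (m2 w).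
  by rewrite hornE /modulus normc_def.
have m20 w : 0 <= m2 w by rewrite addr_ge0 ?sqr_ge0.
have c0 : 0 < (1 - modulus z) ^+ n by rewrite exprn_gt0 // subr_gt0.
have cm : m2 w @[w --> H] --> m2 v.
  by apply: cvgD; rewrite expr2; under eq_fun do rewrite expr2; apply: cvgM; exact: cvg_lin_form.
have : (1 - modulus z) ^+ n ^+ 2 <= m2 v.
  apply: (cvgr_to_ge cm); apply: filterS adm => w /low; rewrite mE => h.
  rewrite -[m2 w]sqr_sqrtr // lerXn2r ?nnegrE ?sqrtr_ge0 //; exact: ltW.
rewrite mE sqrtr_gt0; apply: lt_le_trans.
by rewrite exprn_gt0.
Qed.

(** Neither factor is the zero polynomial: the coefficient of z^n in the reversed one is q(0) =
    1. *)
Lemma admissible_rev_neq0 (q : {poly R}) : ma_admissible n q ->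
  exists2 z, z != 0 & (rev_poly n q).[z] * q.[z] != 0.
Proof.
move=> [_ q0 _]; apply: contrapT => nz; have : rev_poly n q * q = 0.
  apply: poly_eq_nonzero => z z0; rewrite horner0 hornerM.
  by apply: contrapT => /eqP h; apply: nz; exists z.
move/eqP; rewrite mulf_eq0 => /orP[] /eqP e0.
  have := congr1 (fun p : {poly R} => p`_n) e0.
  rewrite coef_poly ltnSn subnn coef0 -horner_coef0 q0 => /eqP.
  by rewrite oner_eq0.
by move: q0; rewrite e0 horner0 => /esym/eqP; rewrite oner_eq0.
Qed.

Theorem spectral_limit (F : set_system R) (PF : ProperFilter F) (theta : R -> {poly R})
    (kappa : R -> R) (q0 : {poly R}) (k0 : R) :
  k0 != 0 -> ma_admissible n q0 ->
  (\forall D \near F, ma_admissible n (theta D)) ->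
  (forall z, z != 0 -> kappa D * ((rev_poly n (theta D)).[z] * (theta D).[z]) @[D --> F]
      --> k0 * ((rev_poly n q0).[z] * q0.[z])) ->
  (forall j, (theta D)`_j @[D --> F] --> q0`_j) /\ kappa D @[D --> F] --> k0.
Proof.
move=> k00 adm0 adm lim.
pose phi D : V := poly_rV (theta D).
pose v0 : V := poly_rV q0.
(* Admissible coefficients are bounded by 2^n; the extra 1 makes [K] a neighbourhood of [v0]. *)
pose K : set V := [set v | forall i : 'I_n.+1, `[- (2 ^+ n + 1), 2 ^+ n + 1]%classic (v ord0 i)].
pose hz (z : R) := (rev_poly n q0).[z] * q0.[z].
have szq0 : (size q0 <= n.+1)%N by case: adm0.
have v0K : rVpoly v0 = q0 by rewrite poly_rV_K.
have Kc : compact K.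
  apply: (@rV_compact R n.+1 (fun=> `[- (2 ^+ n + 1), 2 ^+ n + 1]%classic)) => i.
  exact: segment_compact.
have phiK : \forall D \near F, K (phi D).
  apply: filterS adm => D aD i /=; rewrite in_itv /= mxE.
  have := ma_coef_bound i aD; rewrite ler_norml => /andP[]; lra.
have Kv0 : nbhs v0 K.
  suff coord (i : 'I_n.+1) : nbhs v0 (fun w : V => `[- (2 ^+ n + 1), 2 ^+ n + 1]%classic (w ord0 i)).
    exact: (filter_forall _ coord).
  have cw : w ord0 i @[w --> nbhs v0] --> v0 ord0 i by exact: coord_continuous.
  have : `|v0 ord0 i| <= 2 ^+ n by rewrite mxE; exact: ma_coef_bound.
  rewrite ler_norml => /andP[b1 b2].
  have l1 : - (2 ^+ n + 1) < v0 ord0 i by lra.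
  have l2 : v0 ord0 i < 2 ^+ n + 1 by lra.
  have c1 := cvgr_ge _ cw _ l1; have c2 := cvgr_le _ cw _ l2.
  by near=> w; rewrite /= in_itv /=; apply/andP; split; near: w; [exact: c1|exact: c2].
have [z1 z10 hz1] := admissible_rev_neq0 adm0; rewrite -/(hz z1) in hz1.
pose A x (w : V) := (rev_poly n (rVpoly w)).[x] * (rVpoly w).[x].
have Aphi x : \forall D \near F, A x (phi D) = (rev_poly n (theta D)).[x] * (theta D).[x].
  by apply: filterS adm => D [sz _ _]; rewrite /A poly_rV_K.
have Abound x : exists B, forall w, K w -> `|A x w| <= B.
  pose S := \sum_(i < n.+1) (2 ^+ n + 1) * `|x| ^+ i.
  exists (S * S) => w Kw; rewrite /A normrM horner_rev_rVpoly_sum horner_rVpoly_sum.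
  have wi i : `|w 0 i| <= 2 ^+ n + 1.
    by have := Kw i; rewrite /= in_itv /= ler_norml.
  by rewrite ler_pM // (le_trans (ler_norm_sum _ _ _)) //; apply: ler_sum => i _;
    rewrite normrM normrX ler_wpM2r ?exprn_ge0.
(* Cross-multiplying the limits at z and z1 eliminates kappa, which is not known
   to be bounded. *)
have cross z : z != 0 -> forall H : set_system V, ProperFilter H -> forall v, H --> v ->
    phi @ F `<=` H -> A z v * hz z1 = A z1 v * hz z.
  move=> z0 H PH v Hv FH.
  have cA x : A x w @[w --> H] --> A x v.
    by apply: cvgM; [exact: cvg_horner_rev_rVpoly|exact: cvg_horner_rVpoly].
  pose h w := A z w * hz z1 - A z1 w * hz z.
  have hF : h (phi D) @[D --> F] --> (0 : R).
    have [B1 HB1] := Abound z; have [B2 HB2] := Abound z1.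
    pose a x D := k0 * hz x - kappa D * ((rev_poly n (theta D)).[x] * (theta D).[x]).
    have a0 x : x != 0 -> `|a x D| @[D --> F] --> (0:R).
      move=> x0; rewrite -(normr0 R); apply: cvg_norm.
      by rewrite -(subrr (k0 * hz x)); apply: cvgB; [exact: cvg_cst|exact: lim].
    apply/norm_cvg0P.
    apply: (@squeeze_cvgr _ _ _ _ (fun=> 0) (fun D => `|k0|^-1 * (B1 * `|a z1 D| + B2 * `|a z D|))).
    - near=> D; rewrite normr_ge0 /=.
      have k0n : 0 < `|k0| by rewrite normr_gt0.
      rewrite mulrC ler_pdivlMr // -normrM.
      have -> : h (phi D) * k0 = A z (phi D) * a z1 D - A z1 (phi D) * a z D.
        rewrite /h /a.
        have -> : A z (phi D) = (rev_poly n (theta D)).[z] * (theta D).[z] by near: D; exact: Aphi.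
        have -> : A z1 (phi D) = (rev_poly n (theta D)).[z1] * (theta D).[z1] by near: D; exact: Aphi.
        by ring.
      have KD : K (phi D) by near: D.
      by rewrite (le_trans (ler_normB _ _)) // [X in X + _]normrM [X in _ + X <= _]normrM lerD ?ler_wpM2r ?HB1 ?HB2.
    - exact: cvg_cst.
    - rewrite -[X in _ --> X](mulr0 `|k0|^-1); apply: cvgMl_tmp.
      rewrite -[X in _ --> X](addr0 0) -{1}(mulr0 B1) -{2}(mulr0 B2).
      by apply: cvgD; apply: cvgMl_tmp; exact: a0.
  have hH : h w @[w --> H] --> (0:R).
    by move=> U /hF; exact: FH.
  have hv : h w @[w --> H] --> h v by apply: cvgB; exact: cvgMr_tmp.
  have : h v = 0 by rewrite -(cvg_lim _ hv) // -(cvg_lim _ hH).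
  by move/eqP; rewrite subr_eq0 => /eqP.
have clus v : cluster (phi @ F) v -> v = v0.
  rewrite cluster_cvgE => -[H PH [Hv FH]].
  have admv : ma_admissible n (rVpoly v).
    apply: (@admissible_limit H PH v Hv); apply: FH; rewrite /fmap /=.
    by apply: filterS adm => D aD /=; rewrite poly_rV_K //; case: aD.
  (* If the product for [v] vanished at [z1], the cross relation would make it vanish at [z2] too.
     So [A z1 v] is a legitimate constant for [spectral_unique]. *)
  have [z2 z20 Az2] := admissible_rev_neq0 admv.
  have Az1 : A z1 v != 0.
    apply: contra Az2 => /eqP e; have := cross z2 z20 H PH v Hv FH.
    by rewrite e mul0r => /eqP; rewrite mulf_eq0 (negPf hz1) orbF.
  rewrite -(rVpolyK v) (_ : rVpoly v = q0) //.
  apply: (spectral_unique hz1 Az1 admv adm0).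
  apply: poly_eq_nonzero => z z0; rewrite !hornerZ !hornerM mulrC.
  exact: cross z0 H PH v Hv FH.
have phiv0 : phi D @[D --> F] --> v0.
  have PFphi : ProperFilter (phi @ F) by exact: fmap_proper_filter.
  (* In a compact set, a filter with [v0] as its only cluster point converges to it. *)
  apply: (compact_cluster_set1 (@norm_hausdorff _ _) Kc Kv0 PFphi phiK).
  apply/seteqP; split => [v /clus -> //|v ->].
  have [w [_ cw]] := Kc _ PFphi phiK.
  by rewrite -(clus w cw).
have coefs j : (theta D)`_j @[D --> F] --> q0`_j.
  have [jn|nj] := ltnP j n.+1; last first.
    rewrite (nth_default 0 (leq_trans szq0 nj)).
    apply: cvg_near_cst; apply: filterS adm => D [sz _ _].
    by rewrite nth_default // (leq_trans sz).
  have : (phi D) 0 (Ordinal jn) @[D --> F] --> v0 0 (Ordinal jn).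
    by apply: (cvg_comp phi (fun w : V => w 0 (Ordinal jn)) phiv0); exact: coord_continuous.
  rewrite mxE /=; apply: cvg_trans; apply: near_eq_cvg; apply: nearW => D.
  by rewrite mxE.
split => //.
have cA1 : A z1 (phi D) @[D --> F] --> hz z1.
  have -> : hz z1 = A z1 v0 by rewrite /A v0K.
  have cAn : A z1 w @[w --> nbhs v0] --> A z1 v0.
    by apply: cvgM; [exact: cvg_horner_rev_rVpoly|exact: cvg_horner_rVpoly].
  exact: (cvg_comp phi (A z1) phiv0 cAn).
(* With [theta] convergent, [kappa] is recovered by dividing at [z1], where the limit product is
   nonzero. *)
have : kappa D * ((rev_poly n (theta D)).[z1] * (theta D).[z1]) / A z1 (phi D) @[D --> F] --> k0 * hz z1 / hz z1.
  by apply: cvgM; [exact: lim|exact: cvgV].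
rewrite mulfK //; apply: cvg_trans; apply: near_eq_cvg; near=> D.
have <- : A z1 (phi D) = (rev_poly n (theta D)).[z1] * (theta D).[z1] by near: D; exact: Aphi.
rewrite mulfK //; near: D.
exact: cvgr_neq0 cA1 hz1.
Unshelve. all: by end_near.
Qed.

End SpectralLimit.

(** * The sampled process at high frequency *)

Section PolynomialIntegral.
Variable R : realType.
Implicit Types P Q : {poly R}.
Local Notation leb := (@lebesgue_measure R).

Definition primitive P : {poly R} := 'X * \poly_(i < size P) (P`_i / i.+1%:R).

Lemma coef_primitive P i : (primitive P)`_i = if i is j.+1 then P`_j / j.+1%:R else 0.
Proof.
rewrite coefXM; case: i => [|i] //=; rewrite coef_poly.
by case: ltnP => // Pi; rewrite nth_default // mul0r.
Qed.

Lemma deriv_primitive P : (primitive P)^`() = P.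
Proof.
apply/polyP => i; rewrite coef_deriv coef_primitive -[LHS]mulr_natr divfK //.
Qed.

Definition int01 P : R := (primitive P).[1].

Lemma primitiveD P Q : primitive (P + Q) = primitive P + primitive Q.
Proof.
apply/polyP => -[|i]; rewrite coefD !coef_primitive ?addr0 //.
by rewrite coefD mulrDl.
Qed.

Lemma primitiveZ c P : primitive (c *: P) = c *: primitive P.
Proof.
apply/polyP => -[|i]; rewrite coefZ !coef_primitive ?mulr0 //.
by rewrite coefZ mulrA.
Qed.

Lemma int01D P Q : int01 (P + Q) = int01 P + int01 Q.
Proof. by rewrite /int01 primitiveD hornerD. Qed.

Lemma int01Z c P : int01 (c *: P) = c * int01 P.
Proof. by rewrite /int01 primitiveZ hornerZ. Qed.

Lemma int01Xn i : int01 ('X^i) = i.+1%:R^-1.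
Proof.
rewrite /int01 (_ : primitive _ = i.+1%:R^-1 *: 'X^(i.+1)).
  by rewrite hornerZ hornerXn expr1n mulr1.
apply/polyP => -[|j]; rewrite coef_primitive coefZ !coefXn ?mulr0 // eqSS.
by case: eqP => [->|_]; rewrite ?mul0r ?mulr0 // mul1r mulr1.
Qed.

Lemma int01C c : int01 c%:P = c.
Proof. by rewrite -[c%:P]alg_polyC int01Z -(expr0 'X) int01Xn invr1 mulr1. Qed.

Lemma int01_sum (I : Type) (r : seq I) (F : I -> {poly R}) :
  int01 (\sum_(i <- r) F i) = \sum_(i <- r) int01 (F i).
Proof.
elim: r => [|i r IH]; last by rewrite !big_cons int01D IH.
by rewrite !big_nil -polyC0 int01C.
Qed.

Lemma integral_poly_cell P (a D : R) : 0 < D ->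
  leb.-integrable `[a, (a + D)%R[ (fun u => (P.[(a + D - u) / D])%R%:E) /\
  (\int[leb]_(u in `[a, (a + D)%R[) (P.[(a + D - u) / D])%R%:E = (D * int01 P)%:E)%E.
Proof.
move=> D0; have D0' : D != 0 by rewrite gt_eqF.
pose l : {poly R} := ((a + D) / D)%:P - D^-1 *: 'X.
have lE u : l.[u] = (a + D - u) / D.
  by rewrite /l !(hornerD, hornerN, hornerZ, hornerC, hornerX); field.
pose q := P \Po l; pose J := - D *: (primitive P \Po l).
have qE u : P.[(a + D - u) / D] = q.[u] by rewrite /q horner_comp lE.
have dl : l^`() = (- D^-1)%:P.
  by rewrite /l derivB derivC derivZ derivX sub0r alg_polyC polyCN.
have dJ : J^`() = q.
  rewrite /J derivZ deriv_comp deriv_primitive dl mulrC mul_polyC scalerA.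
  by rewrite mulrNN mulfV // scale1r.
have cq : {within `[a, a + D], continuous (horner q)}.
  by apply: continuous_subspaceT; exact: continuous_horner.
have aD : a < a + D by rewrite ltrDl.
have iq : leb.-integrable `[a, a + D] (EFin \o horner q).
  by apply: continuous_compact_integrable => //; exact: segment_compact.
have sub : `[a, (a + D)%R[ `<=` `[a, a + D] by apply: subset_itvl; rewrite bnd_simp.
split.
  have : leb.-integrable `[a, (a + D)%R[ (EFin \o horner q) by apply: integrableS iq => //; exact: sub.
  by apply: eq_integrable => // u _; rewrite qE.
under eq_integral do rewrite qE.
rewrite integral_itv_bndo_bndc; last first.
  apply/measurable_EFinP; apply: measurable_funTS.
  by apply: continuous_measurable_fun; exact: continuous_horner.
rewrite (continuous_FTC2 aD cq (F := horner J)); last 2 first.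
- split.
  + by move=> x _; exact: derivable_horner.
  + by apply: cvg_at_right_filter; exact: continuous_horner.
  + by apply: cvg_at_left_filter; exact: continuous_horner.
- by move=> x _; rewrite -derivE dJ.
rewrite -EFinB; congr EFin.
rewrite /J !hornerZ !horner_comp !lE subrr mul0r.
have -> : (a + D - a) / D = 1 by rewrite addrAC subrr add0r divff.
rewrite -/(int01 P) horner_coef0 coef_primitive; ring.
Qed.

(** On the cell [F] lies between the rescaled polynomials c P - e and c P + e, whose integrals are
    explicit. *)
Lemma integral_cell_approx (F : R -> R) P (a D c e : R) : 0 < D ->
  measurable_fun setT F -> (forall u, ~ (a <= u < a + D) -> F u = 0) ->
  (forall u, a <= u < a + D -> `|F u - c * P.[(a + D - u) / D]| <= e) ->
  `|fine (\int[leb]_u (F u)%:E) - c * D * int01 P| <= e * D.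
Proof.
move=> D0 mF F0 Fe.
have FC : (\int[leb]_u (F u)%:E = \int[leb]_(u in `[a, (a + D)%R[) (F u)%:E)%E.
  rewrite [RHS]integral_mkcond; apply: eq_integral => u _.
  rewrite patchE; case: ifPn => //; rewrite notin_setE /= in_itv /= => /F0 ->.
  by [].
have [i1 e1] := integral_poly_cell (c *: P + (- e)%:P) a D0.
have [i2 e2] := integral_poly_cell (c *: P + e%:P) a D0.
have bound u : a <= u < a + D -> (c *: P + (- e)%:P).[(a + D - u) / D] <= F u /\
    F u <= (c *: P + e%:P).[(a + D - u) / D].
  move=> /Fe; rewrite !hornerD !hornerZ !hornerC ler_norml => /andP[]; split; lra.
have iF : leb.-integrable `[a, (a + D)%R[ (EFin \o F).
  apply: le_integrable (integrableD _ (integrable_abse i1) (integrable_abse i2)) => //.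
    by apply/measurable_EFinP; exact: measurable_funTS.
  move=> u /= ua; rewrite lee_fin; have [b1 b2] := bound u ua.
  by rewrite [leRHS]ger0_norm ?addr_ge0 //; move: b1 b2; set x := _.[_]; set y := _.[_];
    have := ler_norm y; have := ler_norm (- x); rewrite normrN ler_norml;
    have := normr_ge0 x; have := normr_ge0 y; lra.
have l1 : (\int[leb]_(u in `[a, (a + D)%R[) ((c *: P + (- e)%:P).[(a + D - u) / D])%R%:E <=
    \int[leb]_(u in `[a, (a + D)%R[) (F u)%:E)%E.
  by apply: le_integral => // u; rewrite inE /= => /bound[]; rewrite lee_fin.
have l2 : (\int[leb]_(u in `[a, (a + D)%R[) (F u)%:E <=
    \int[leb]_(u in `[a, (a + D)%R[) ((c *: P + e%:P).[(a + D - u) / D])%R%:E)%E.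
  by apply: le_integral => // u; rewrite inE /= => /bound[]; rewrite lee_fin.
move: l1 l2; rewrite e1 e2 FC.
have <- : ((fine (\int[leb]_(u in `[a, (a + D)%R[) (F u)%:E))%:E = \int[leb]_(u in `[a, (a + D)%R[) (F u)%:E)%E.
  by rewrite fineK //; exact: integrable_fin_num.
rewrite !lee_fin !int01D !int01Z !int01C /= => l1 l2.
by rewrite ler_norml; apply/andP; split; lra.
Qed.

End PolynomialIntegral.

(** * The filtered kernel: support and limit for small sampling steps *)

Section FilteredKernel.
Variables (R : realType) (a b : {poly R}) (lam : seq R[i]) (p q : nat).
Hypotheses (bm : b \is monic) (bq : size b = q.+1) (lamp : size lam = p)
  (qp : (q < p)%N) (alam : polyC_of a = roots_poly lam).
Local Notation g := (carma_kernel a b lam).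
Local Notation k := (p - q)%N.

Definition ar_coef (D : R) j : R := complex.Re (ar_poly lam D)`_j.

Definition filtered_kernel (D t : R) : R :=
  \sum_(j < p.+1) ar_coef D j * g (t - j%:R * D).

Lemma filtered_kernel_le0 D t : 0 <= D -> t <= 0 -> filtered_kernel D t = 0.
Proof.
move=> D0 t0; rewrite /filtered_kernel big1 // => j _.
rewrite /carma_kernel ltNge subr_le0 (le_trans t0) ?mulr0 //.
by rewrite mulr_ge0.
Qed.

(** Beyond pD all shifted arguments are positive, so [g] may be replaced by its exponential sum,
    which the filter annihilates. *)
Lemma filtered_kernel_gt D t : 0 < D -> p%:R * D < t -> filtered_kernel D t = 0.
Proof.
move=> D0 pDt; have [ts [tslam gE _]] := kernel_near0 bm bq lamp qp alam.
transitivity (complex.Re (\sum_(j < (size lam).+1) (ar_poly lam D)`_j * kernel_sum ts (t - j%:R * D)%:C)).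
  rewrite raddf_sum /= lamp; apply: eq_bigr => j _; rewrite /ar_coef gE.
    have := ar_poly_real D j alam; case: (_`_j) => x y /= ->.
    by case: (kernel_sum _ _) => u v /=; rewrite mul0r subr0.
  have jp : (j%:R : R) <= p%:R by rewrite ler_nat -ltnS ltn_ord.
  by rewrite subr_gt0 (le_lt_trans _ pDt) // ler_pM2r.
by rewrite kernel_sum_annihil.
Qed.

Definition spline_coef (m : nat) (x : R) : R :=
  \sum_(j < m.+1) ((1 - 'X) ^+ p : {poly R})`_j * ((m - j)%:R + x) ^+ k.-1 / (k.-1)`!%:R.

Lemma filtered_kernel_limit e : 0 < e ->
  \forall D \near (0:R)^'+, forall m x, (m < p)%N -> 0 < x <= 1 ->
    `|filtered_kernel D (D * (m%:R + x)) - D ^+ k.-1 * spline_coef m x| <= e * D ^+ k.-1.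
Proof.
move=> e0; have [ts [_ _ [C [d [C0 d0 gC]]]]] := kernel_near0 bm bq lamp qp alam.
have k0 : (0 < k)%N by rewrite subn_gt0.
have p0 : 0 < p%:R :> R by rewrite ltr0n (leq_ltn_trans _ qp).
pose c j : R := ((1 - 'X) ^+ p : {poly R})`_j.
(* The two summands account for replacing the filter by (1-z)^p and [g] by its leading power. All
   rescaled arguments are at most [p], which makes the bound uniform in [m] and [x]. *)
pose err (D : R) := \sum_(j < p.+1) (`|ar_coef D j - c j| * p%:R ^+ k.-1 + `|ar_coef D j| * (C * p%:R ^+ k) * D).
have idcv : (D : R) @[D --> (0:R)^'+] --> (0:R) by exact: cvg_at_right_filter cvg_id.
have err0 : err D @[D --> (0:R)^'+] --> (0:R).
  rewrite [X in _ --> X](_ : 0 = \sum_(j < p.+1) (0 : R)); last by rewrite big1.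
  apply: cvg_sumr => j.
  have cj : ar_coef D j @[D --> (0:R)^'+] --> c j.
    by have [] := ar_poly_cvg lam j; rewrite lamp.
  have cd : ar_coef D j - c j @[D --> (0:R)^'+] --> c j - c j.
    by apply: cvgB; [exact: cj|exact: cvg_cst].
  rewrite [X in _ --> X](_ : 0 = `|c j - c j| * p%:R ^+ k.-1 + `|c j| * (C * p%:R ^+ k) * 0); last first.
    by rewrite subrr normr0 mul0r mulr0 addr0.
  apply: cvgD.
    by apply: cvgMr_tmp; apply: cvg_norm.
  by apply: cvgM => //; apply: cvgMr_tmp; apply: cvg_norm.
have small : \forall D \near (0:R)^'+, D < d / p%:R.
  by apply: nbhs_right_lt; rewrite divr_gt0.
near=> D => m x mp /andP[x0 x1].
have D0 : 0 < D by near: D; exact: nbhs_right_gt.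
have Dd : D < d / p%:R by near: D.
have errD : err D <= e.
  near: D; apply: filterS (cvgr_le _ err0 _ e0) => D //.
have Dk0 : 0 < D ^+ k.-1 by rewrite exprn_gt0.
apply: le_trans (ler_wpM2r (ltW Dk0) errD).
have mp1 : (m.+1 <= p.+1)%N by rewrite ltnS ltnW.
(* For j > m the argument D (m + x - j) is nonpositive, since x <= 1, and the kernel vanishes
   there. *)
have trunc : filtered_kernel D (D * (m%:R + x)) =
    \sum_(j < m.+1) ar_coef D j * g (D * ((m - j)%:R + x)).
  rewrite /filtered_kernel (bigID (fun j : 'I_p.+1 => (j < m.+1)%N)) /= [X in _ + X]big1 ?addr0; last first.
    move=> j; rewrite -leqNgt => mj; rewrite /carma_kernel ltNge.
    rewrite (_ : _ <= 0) ?mulr0 // [j%:R * D]mulrC -mulrBr pmulr_rle0 //.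
    have : (m.+1%:R : R) <= j%:R by rewrite ler_nat.
    by rewrite -natr1; lra.
  rewrite (big_ord_widen p.+1 (fun j => ar_coef D j * g (D * ((m - j)%:R + x))) mp1).
  apply: eq_bigr => j; rewrite ltnS => jm; congr (_ * g _).
  by rewrite natrB //; ring.
rewrite trunc /spline_coef mulr_sumr -sumrB (le_trans (ler_norm_sum _ _ _)) //.
rewrite /err mulr_suml.
rewrite [leRHS](bigID (fun j : 'I_p.+1 => (j < m.+1)%N)) /=.
set G := fun j : nat => (`|ar_coef D j - c j| * p%:R ^+ k.-1 + `|ar_coef D j| * (C * p%:R ^+ k) * D) * D ^+ k.-1.
have G0 j : 0 <= G j.
  have pp0 := ltW p0; apply: mulr_ge0; last exact: ltW.
  by apply: addr_ge0; rewrite !mulr_ge0 ?exprn_ge0 // ltW.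
rewrite -[leLHS]addr0 lerD //; last by apply: sumr_ge0 => j _; exact: G0.
rewrite -(big_ord_widen p.+1 G mp1).
apply: ler_sum => j _.
have jm : (j <= m)%N by rewrite -ltnS.
pose y : R := (m - j)%:R + x.
have y0 : 0 < y by rewrite /y ltr_wpDl.
have yp : y <= p%:R.
  have : ((m - j).+1%:R : R) <= p%:R by rewrite ler_nat (leq_ltn_trans _ mp) ?leq_subr.
  by rewrite -natr1 /y; lra.
have Dy : 0 < D * y < d.
  rewrite mulr_gt0 //=; have : D * y <= D * p%:R by rewrite ler_pM2l.
  by move: Dd; rewrite ltr_pdivlMr //; lra.
have gy := gC _ Dy.
rewrite -/y /G.
have -> : ar_coef D j * g (D * y) - D ^+ k.-1 * (c j * y ^+ k.-1 / (k.-1)`!%:R) =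
   (ar_coef D j - c j) * (y ^+ k.-1 / (k.-1)`!%:R) * D ^+ k.-1 +
   ar_coef D j * (g (D * y) - (D * y) ^+ k.-1 / (k.-1)`!%:R).
  by rewrite exprMn; ring.
rewrite (le_trans (ler_normD _ _)) // [leRHS]mulrDl lerD //.
  rewrite normrM normrM (ger0_norm (ltW Dk0)) ler_wpM2r ?(ltW Dk0) // ler_wpM2l //.
  rewrite ger0_norm; last by rewrite divr_ge0 ?exprn_ge0 ?(ltW y0).
  rewrite ler_pdivrMr ?ltr0n ?fact_gt0 //.
  rewrite (@le_trans _ _ (p%:R ^+ k.-1)) //.
    by rewrite lerXn2r ?nnegrE ?(ltW y0) ?(ltW p0).
  by rewrite ler_peMr ?exprn_ge0 // -[1]/(1%:R) ler_nat fact_gt0.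
have Dk : D ^+ k = D * D ^+ k.-1 by rewrite -exprS prednK.
rewrite normrM -[leRHS]mulrA -[leRHS]mulrA ler_wpM2l // (le_trans gy) //.
have yk : y ^+ k <= p%:R ^+ k by rewrite lerXn2r ?nnegrE ?(ltW y0) ?(ltW p0).
have DD : 0 <= C * (D * D ^+ k.-1) by rewrite !mulr_ge0 // ltW.
rewrite exprMn Dk.
have -> : C * (D * D ^+ k.-1 * y ^+ k) = C * (D * D ^+ k.-1) * y ^+ k by ring.
have -> : C * p%:R ^+ k * (D * D ^+ k.-1) = C * (D * D ^+ k.-1) * p%:R ^+ k by ring.
exact: ler_wpM2l.
Unshelve. all: by end_near.
Qed.

End FilteredKernel.

Lemma inner_sum2 d (T : measurableType d) (R : realType) (mu : {measure set T -> \bar R})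
    (I J : Type) (r : seq I) (s : seq J) (F : I -> T -> R) (G : J -> T -> R)
    (c : I -> R) (e : J -> R) :
  (forall i, sq_integrable mu (F i)) -> (forall j, sq_integrable mu (G j)) ->
  inner mu (fun x => \sum_(i <- r) c i * F i x) (fun x => \sum_(j <- s) e j * G j x) =
  \sum_(i <- r) \sum_(j <- s) c i * e j * inner mu (F i) (G j).
Proof.
move=> hF hG.
have hcF i := sq_integrableZ (c i) (hF i); have heG j := sq_integrableZ (e j) (hG j).
rewrite inner_suml //; last exact: sq_integrable_sum.
apply: eq_bigr => i _; rewrite inner_sumr //; apply: eq_bigr => j _.
by rewrite (innerZl _ (hF i) (heG j)) (innerZr _ (hG j) (hF i)) mulrA.
Qed.

(** * Autocovariances of the filtered sample, computed from the noise and from the kernel *)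

Section MovingAverage.
Context d (T : measurableType d) (R : realType) (P : probability T R).
Variables (L : R -> {RV P >-> R}) (sigma : R).
Hypothesis hL : levy_process L.
Hypothesis hmean : 'E_P[(L 1)%R]%E = 0%E.
Hypothesis hvar : 'E_P[fun w => (L 1 w ^+ 2)%R]%E = (sigma ^+ 2)%:E%E.
Variables (a b : {poly R}) (lam : seq R[i]) (Y : R -> {RV P >-> R}).
Hypothesis hY : carma_process L a b lam Y.
Variables (n : nat) (D : R) (theta : {poly R}) (Z : int -> {RV P >-> R}) (tau2 : R).
Hypothesis lamp : size lam = n.+1.
Hypothesis hMA : sampled_ma_representation n.+1 lam Y D theta Z tau2.
Local Notation leb := (@lebesgue_measure R).

Definition shifted_kernel (i : nat) (u : R) : R :=
  filtered_kernel a b lam n.+1 D (i%:R * D - u).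

Let time (i j : nat) : R := (i%:Z - j%:Z)%:~R * D.

Lemma noise_inner (k l : int) : sq_integrable P (Z k) /\
  inner P (Z k) (Z l) = tau2 * (k == l)%:R.
Proof.
have [_ _ _ [_ hv ho] _] := hMA.
have hZ m : sq_integrable P (Z m).
  apply: sq_integrableP; first exact: measurable_funPT.
  by have := hv m; rewrite unlock => ->; rewrite ltry.
split => //; apply: EFin_inj; have [->|kl] := eqVneq k l.
  by rewrite -integral_sqrE // mulr1; have := hv l; rewrite unlock.
by rewrite -integral_mulE // mulr0; have := ho k l kl; rewrite unlock.
Qed.

Lemma sampled_ae (i : nat) : {ae P, forall w,
  \sum_(j < n.+1) theta`_j * Z (i%:Z - j%:Z) w =
  \sum_(j < n.+2) ar_coef lam D j * Y (time i j) w}.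
Proof.
have [sz _ _ _ ae] := hMA; apply: filterS (ae i%:Z) => w.
rewrite /backshift => /(congr1 (@complex.Re R)) /= E.
rewrite (big_ord_widen _ (fun j => theta`_j * Z (i%:Z - j%:Z) w) sz) in E.
have szar : (size (ar_poly lam D) <= n.+2)%N.
  by rewrite ar_polyE (leq_trans (size_lag_poly _)) // size_map lamp.
rewrite (big_ord_widen _ (fun j => (ar_poly lam D)`_j * (Y (time i j) w)%:C) szar) in E.
rewrite [LHS](bigID (fun j : 'I_n.+1 => (j < size theta)%N)) /= E.
rewrite [X in _ + X]big1 ?addr0; last first.
  by move=> j; rewrite -leqNgt => h; rewrite nth_default // mul0r.
rewrite [RHS](bigID (fun j : 'I_n.+2 => (j < size (ar_poly lam D))%N)) /=.
rewrite [X in _ = _ + X]big1 ?addr0; last first.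
  by move=> j; rewrite -leqNgt => h; rewrite /ar_coef nth_default // mul0r.
rewrite raddf_sum; apply: eq_bigr => j _; rewrite /ar_coef.
by case: (_`_j) => x y /=; rewrite mulr0 subr0.
Qed.

Lemma process_inner s t : [/\ sq_integrable P (Y s),
    inner P (Y s) (Y t) = sigma ^+ 2 *
      inner leb (fun u => carma_kernel a b lam (s - u)) (fun u => carma_kernel a b lam (t - u)) &
    sq_integrable leb (fun u => carma_kernel a b lam (s - u))].
Proof.
have [h1 h2 _] := levy_integral_norm hL hmean hvar (hY s).
split => //; exact: (levy_isometry hL hmean hvar (hY s) (hY t)).
Qed.

Lemma shifted_kernelE i u : shifted_kernel i u =
  \sum_(j < n.+2) ar_coef lam D j * carma_kernel a b lam (time i j - u).
Proof.
apply: eq_bigr => j _; congr (_ * carma_kernel _ _ _ _).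
by rewrite /time rmorphB /= mulrBl; ring.
Qed.

Lemma sq_integrable_shifted_kernel i : sq_integrable leb (shifted_kernel i).
Proof.
have -> : shifted_kernel i = (fun u => \sum_(j < n.+2) ar_coef lam D j * carma_kernel a b lam (time i j - u)).
  by apply/funext => u; exact: shifted_kernelE.
apply: sq_integrable_sum => j; apply: sq_integrableZ.
by have [] := process_inner (time i j) 0.
Qed.

Lemma ma_cov_noise (i : nat) :
  inner P (fun w => \sum_(j < n.+1) theta`_j * Z (n%:Z - j%:Z) w)
          (fun w => \sum_(j < n.+1) theta`_j * Z (i%:Z - j%:Z) w) =
  tau2 * \sum_(j < n.+1) \sum_(l < n.+1) theta`_j * theta`_l * (n + l == i + j)%N%:R.
Proof.
have hZ k : sq_integrable P (Z k) by have [] := noise_inner k 0.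
rewrite inner_sum2 // mulr_sumr; apply: eq_bigr => j _; rewrite mulr_sumr.
apply: eq_bigr => l _; have [_ ->] := noise_inner (n%:Z - j%:Z) (i%:Z - l%:Z).
have -> : (n%:Z - j%:Z == i%:Z - l%:Z) = (n + l == i + j)%N by apply/eqP/eqP; lia.
by ring.
Qed.

Lemma ma_cov_kernel (i : nat) :
  inner P (fun w => \sum_(j < n.+2) ar_coef lam D j * Y (time n j) w)
          (fun w => \sum_(j < n.+2) ar_coef lam D j * Y (time i j) w) =
  sigma ^+ 2 * inner leb (shifted_kernel n) (shifted_kernel i).
Proof.
have E k : shifted_kernel k = (fun u => \sum_(j < n.+2) ar_coef lam D j * carma_kernel a b lam (time k j - u)).
  by apply/funext => u; exact: shifted_kernelE.
have hP s : sq_integrable P (Y s) by have [] := process_inner s 0.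
have hl s : sq_integrable leb (fun u => carma_kernel a b lam (s - u)) by have [] := process_inner s 0.
rewrite !E inner_sum2 // inner_sum2 // mulr_sumr; apply: eq_bigr => j _.
rewrite mulr_sumr; apply: eq_bigr => l _.
have [_ -> _] := process_inner (time n j) (time i l).
by rewrite mulrCA.
Qed.

Lemma ma_cov (i : nat) :
  tau2 * \sum_(j < n.+1) \sum_(l < n.+1) theta`_j * theta`_l * (n + l == i + j)%N%:R =
  sigma ^+ 2 * inner leb (shifted_kernel n) (shifted_kernel i).
Proof.
rewrite -ma_cov_noise -ma_cov_kernel.
have mZ (m : nat) : measurable_fun setT (fun w => \sum_(j < n.+1) theta`_j * Z (m%:Z - j%:Z) w).
  by apply: measurable_sum => j; apply: measurable_funM => //; exact: measurable_funPT.
have mY (m : nat) : measurable_fun setT (fun w => \sum_(j < n.+2) ar_coef lam D j * Y (time m j) w).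
  by apply: measurable_sum => j; apply: measurable_funM => //; exact: measurable_funPT.
by apply: inner_ae => //; exact: sampled_ae.
Qed.

(** The autocovariances between times n and i, weighted by z^i for 0 <= i <= 2n, cover all lags from
    -n to n. Their generating function is z^n times the spectral one, hence polynomial in z. *)
Lemma ma_spectral_identity z :
  tau2 * ((rev_poly n theta).[z] * theta.[z]) =
  sigma ^+ 2 * inner leb (shifted_kernel n)
    (fun u => \sum_(i < n.*2.+1) z ^+ i * shifted_kernel i u).
Proof.
have hs i := sq_integrable_shifted_kernel i.
rewrite inner_sumr //; last by move=> i; exact: sq_integrableZ.
have [sz _ _ _ _] := hMA.
have -> : \sum_(i < n.*2.+1) inner leb (shifted_kernel n) (fun u => z ^+ i * shifted_kernel i u) =
  \sum_(i < n.*2.+1) z ^+ i * inner leb (shifted_kernel n) (shifted_kernel i).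
  by apply: eq_bigr => i _; rewrite (innerZr _ (hs i) (hs n)).
rewrite mulr_sumr.
under eq_bigr do rewrite mulrCA -ma_cov mulrCA.
rewrite -mulr_sumr; congr (_ * _).
under eq_bigr do rewrite mulr_sumr.
rewrite exchange_big /= horner_poly mulr_suml.
rewrite [LHS](reindex_inj rev_ord_inj) /=; apply: eq_bigr => j _.
under eq_bigr do rewrite mulr_sumr.
rewrite exchange_big /= (horner_coef_wide _ sz) mulr_sumr; apply: eq_bigr => l _.
have jn : (j <= n)%N := leq_ord j; have ln : (l <= n)%N := leq_ord l.
have lt : (n + l - j < n.*2.+1)%N by lia.
rewrite (bigD1 (Ordinal lt)) //= big1 ?addr0; last first.
  move=> i; rewrite -val_eqE /= => ij.
  by rewrite (_ : (_ == _)%N = false) ?mulr0 //; apply/negbTE; apply: contra ij => /eqP; lia.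
rewrite (_ : (_ == _)%N = true); last by apply/eqP; lia.
rewrite mulr1 subSS subKn // (_ : (n + l - j = (n - j) + l)%N); last by lia.
by rewrite exprD; ring.
Qed.

End MovingAverage.

Lemma poly_bounded01 (R : realType) (P : {poly R}) :
  exists2 B, 0 <= B & forall x, 0 <= x <= 1 -> `|P.[x]| <= B.
Proof.
exists (\sum_(i < size P) `|P`_i|); first exact: sumr_ge0.
move=> x /andP[x0 x1]; rewrite horner_coef (le_trans (ler_norm_sum _ _ _)) //.
apply: ler_sum => i _; rewrite normrM normrX (ger0_norm x0) ler_piMr //.
by rewrite exprn_ile1.
Qed.

Lemma shift_index_lt (n m l : nat) : (m <= n)%N -> (l <= n)%N -> (n + l - m < n.*2.+1)%N.
Proof. by lia. Qed.

Lemma exprn_le_sum (R : realFieldType) (x : R) N i : 0 <= x -> (i < N)%N ->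
  x ^+ i <= \sum_(j < N) x ^+ j.
Proof.
move=> x0 iN; rewrite (bigD1 (Ordinal iN)) //= lerDl.
by apply: sumr_ge0 => j _; rewrite exprn_ge0.
Qed.

Lemma norm_sum_mul_le (R : realFieldType) N (w v : 'I_N -> R) W B :
  (forall l, `|w l| <= W) -> (forall l, `|v l| <= B) ->
  `|\sum_(l < N) w l * v l| <= N%:R * (W * B).
Proof.
move=> hw hv; rewrite (le_trans (ler_norm_sum _ _ _)) //.
rewrite (@le_trans _ _ (\sum_(l < N) W * B)) //.
  by apply: ler_sum => l _; rewrite normrM ler_pM.
by rewrite sumr_const card_ord mulr_natl.
Qed.

(** Split al be - c^2 A S as (al - cA)(be - cS) + (al - cA) cS + cA (be - cS). What matters is that
    the bound is linear in [ep] and scales like c^2; ep <= 1 absorbs the quadratic term. *)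
Lemma mul_approx (R : realFieldType) (c ep B W N al be A S : R) :
  0 < c -> 0 < ep -> ep <= 1 -> 0 <= B -> 0 <= W -> 0 <= N ->
  `|al - c * A| <= ep * c -> `|be - c * S| <= N * (W * (ep * c)) ->
  `|S| <= N * (W * B) -> `|A| <= B ->
  `|al * be - c * c * (A * S)| <= ep * (N * (W + 1) * (2 * B + 1)) * (c * c).
Proof.
move=> c0 ep0 ep1 B0 W0 N0 ha hb hS hA.
have -> : al * be - c * c * (A * S) =
  (al - c * A) * (be - c * S) + (al - c * A) * (c * S) + c * A * (be - c * S) by ring.
have cs : `|c * S| <= c * (N * (W * B)) by rewrite normrM (ger0_norm (ltW c0)) ler_pM2l.
have ca : `|c * A| <= c * B by rewrite normrM (ger0_norm (ltW c0)) ler_pM2l.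
have e1 := ler_pM (normr_ge0 _) (normr_ge0 _) ha hb.
have e2 := ler_pM (normr_ge0 _) (normr_ge0 _) ha cs.
have e3 := ler_pM (normr_ge0 _) (normr_ge0 _) ca hb.
rewrite -!normrM in e1 e2 e3.
apply: (@le_trans _ _ (ep * c * (N * (W * (ep * c))) + ep * c * (c * (N * (W * B))) +
    c * B * (N * (W * (ep * c))))).
  by rewrite (le_trans (ler_normD _ _)) // lerD // (le_trans (ler_normD _ _)) // lerD.
have -> : ep * c * (N * (W * (ep * c))) + ep * c * (c * (N * (W * B))) +
    c * B * (N * (W * (ep * c))) = (ep * (c * c) * N) * (W * (ep + 2 * B)) by ring.
have -> : ep * (N * (W + 1) * (2 * B + 1)) * (c * c) =
  (ep * (c * c) * N) * ((W + 1) * (2 * B + 1)) by ring.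
rewrite ler_wpM2l ?mulr_ge0 ?(ltW ep0) ?(ltW c0) //.
by rewrite ler_pM //; lra.
Qed.

Lemma convolution_approx (R : realFieldType) n m (z c ep B : R) (v s : nat -> R) :
  (m <= n)%N -> 0 < c -> 0 < ep -> ep <= 1 ->
  (forall l, (l <= n)%N -> `|v l - c * s l| <= ep * c) ->
  (forall l, (l <= n)%N -> `|s l| <= B) ->
  `|v m * (\sum_(l < n.+1) z ^+ (n + l - m) * v l) -
    c * c * (s m * \sum_(l < n.+1) z ^+ (n + l - m) * s l)| <=
  ep * (n.+1%:R * ((\sum_(i < n.*2.+1) `|z| ^+ i) + 1) * (2 * B + 1)) * (c * c).
Proof.
move=> mn c0 ep0 ep1 hv hs; set W := \sum_(i < n.*2.+1) _.
have W0 : 0 <= W by apply: sumr_ge0 => i _; rewrite exprn_ge0.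
have B0 : 0 <= B := le_trans (normr_ge0 _) (hs m mn).
have wl (l : 'I_n.+1) : `|z ^+ (n + l - m)| <= W.
  rewrite normrX; apply: exprn_le_sum; first exact: normr_ge0.
  exact: shift_index_lt mn (leq_ord l).
have hS : `|\sum_(l < n.+1) z ^+ (n + l - m) * s l| <= n.+1%:R * (W * B).
  by apply: norm_sum_mul_le wl _ => l; exact: hs (leq_ord l).
apply: mul_approx hS (hs m mn) => //; first exact: hv.
rewrite mulr_sumr -sumrB.
under eq_bigr do rewrite (mulrCA c) -mulrBr.
by apply: norm_sum_mul_le wl _ => l; exact: hv (leq_ord l).
Qed.

(** * Limit of the rescaled autocovariance generating function *)

Section GramLimit.
Variables (R : realType) (a b : {poly R}) (lam : seq R[i]) (n q : nat).
Hypotheses (bm : b \is monic) (bq : size b = q.+1) (lamp : size lam = n.+1)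
  (qn : (q < n.+1)%N) (alam : polyC_of a = roots_poly lam).
Variable spl : nat -> {poly R}.
Hypothesis splE : forall m x, (m <= n)%N -> 0 < x <= 1 -> spline_coef n.+1 q m x = (spl m).[x].
Hypothesis hs : forall D i, 0 < D ->
  sq_integrable (@lebesgue_measure R) (shifted_kernel a b lam n D i).
Local Notation leb := (@lebesgue_measure R).
Local Notation f := (filtered_kernel a b lam n.+1).
Local Notation k := (n.+1 - q)%N.

(** Shifting by (i - n) D moves a point of cell m to cell l = m + i - n, keeping its relative
    position [x]; cells outside 0, ..., n contribute 0. *)
Lemma filtered_kernel_shift_sum (D z x : R) m : 0 < D -> (m <= n)%N -> 0 < x <= 1 ->
  \sum_(i < n.*2.+1) z ^+ i * f D (D * (m%:R + x) + (i%:R - n%:R) * D) =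
  \sum_(l < n.+1) z ^+ (n + l - m) * f D (D * (l%:R + x)).
Proof.
move=> D0 mn /andP[x0 x1].
have E (i : nat) : f D (D * (m%:R + x) + (i%:R - n%:R) * D) =
    \sum_(l < n.+1) (m + i == n + l)%N%:R * f D (D * (l%:R + x)).
  have [ni|ni] := leqP n (m + i); last first.
    rewrite filtered_kernel_le0 ?(ltW D0) //; last first.
      have -> : D * (m%:R + x) + (i%:R - n%:R) * D = D * (m%:R + i%:R + x - n%:R) by ring.
      have : ((m + i).+1%:R : R) <= n%:R by rewrite ler_nat.
      by rewrite -natr1 natrD => h; rewrite pmulr_rle0 //; lra.
    rewrite big1 // => l _; rewrite (_ : (_ == _)%N = false) ?mul0r //.
    by apply/negbTE/eqP; lia.
  have [in2|in2] := leqP (m + i) (n + n); last first.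
    rewrite (filtered_kernel_gt bm bq lamp qn alam D0); last first.
      have -> : D * (m%:R + x) + (i%:R - n%:R) * D = (m%:R + i%:R + x - n%:R) * D by ring.
      have : ((n + n).+1%:R : R) <= (m + i)%:R by rewrite ler_nat.
      by rewrite -natr1 !natrD => h; rewrite ltr_pM2r // -natr1; lra.
    rewrite big1 // => l _; rewrite (_ : (_ == _)%N = false) ?mul0r //.
    by apply/negbTE/eqP; have := ltn_ord l; lia.
  have ln : (m + i - n < n.+1)%N by lia.
  rewrite (bigD1 (Ordinal ln)) //= big1 ?addr0; last first.
    move=> l; rewrite -val_eqE /= => ll.
    by rewrite (_ : (_ == _)%N = false) ?mul0r //; apply/negbTE; apply: contra ll => /eqP; lia.
  rewrite (_ : (_ == _)%N = true) ?mul1r; last by apply/eqP; lia.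
  have -> : (m + i - n)%:R = m%:R + i%:R - n%:R :> R by rewrite natrB // natrD.
  by rewrite (_ : D * (m%:R + x) + (i%:R - n%:R) * D = D * (m%:R + i%:R - n%:R + x)) //; ring.
under eq_bigr do rewrite E mulr_sumr.
rewrite exchange_big /=; apply: eq_bigr => l _.
have ll : (l <= n)%N := leq_ord l.
have lt := shift_index_lt mn ll.
rewrite (bigD1 (Ordinal lt)) //= big1 ?addr0; last first.
  move=> i; rewrite -val_eqE /= => ii.
  by rewrite (_ : (_ == _)%N = false) ?mul0r ?mulr0 //; apply/negbTE; apply: contra ii => /eqP; lia.
by rewrite (_ : (_ == _)%N = true) ?mul1r //; apply/eqP; lia.
Qed.

Definition gram_poly (z : R) m : {poly R} :=
  spl m * \sum_(l < n.+1) z ^+ (n + l - m) *: spl l.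

Lemma gram_limit z :
  inner leb (shifted_kernel a b lam n D n)
    (fun u => \sum_(i < n.*2.+1) z ^+ i * shifted_kernel a b lam n D i u) / D ^+ (k.-1 + k)
  @[D --> (0:R)^'+] --> int01 (\sum_(m < n.+1) gram_poly z m).
Proof.
have exB m : exists B, 0 <= B /\ forall x, 0 <= x <= 1 -> `|(spl m).[x]| <= B.
  by have [B B0 HB] := poly_bounded01 (spl m); exists B.
have [Bf HBf] := choice exB.
pose B := \sum_(m < n.+1) Bf m.
have Bf0 m : 0 <= Bf m by have [] := HBf m.
have B0 : 0 <= B by apply: sumr_ge0 => m _.
have splB (m : nat) x : (m <= n)%N -> 0 <= x <= 1 -> `|(spl m).[x]| <= B.
  move=> mn x01; have [_ /(_ _ x01) /le_trans] := HBf m; apply.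
  by rewrite /B (bigD1 (Ordinal (mn : (m < n.+1)%N))) //= lerDl sumr_ge0.
pose W := \sum_(i < n.*2.+1) `|z| ^+ i.
have W0 : 0 <= W by apply: sumr_ge0 => i _; rewrite exprn_ge0.
apply/cvgrPdist_le => e e0.
(* The n+1 cells each contribute the constant of [convolution_approx]; the final 1 keeps [M]
   positive. *)
pose M := n.+1%:R * (n.+1%:R * (W + 1) * (2 * B + 1)) + 1.
have M0 : 0 < M.
  by rewrite /M ltr_wpDl // !mulr_ge0 //; lra.
pose ep := Num.min 1 (e / M).
have ep0 : 0 < ep by rewrite lt_min ltr01 divr_gt0.
have ep1 : ep <= 1 by rewrite ge_min lexx.
have epe : ep * M <= e by rewrite -ler_pdivlMr // ge_min lexx orbT.
near=> D.
have D0 : 0 < D by near: D; exact: nbhs_right_gt.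
have lim : forall m x, (m < n.+1)%N -> 0 < x <= 1 ->
    `|f D (D * (m%:R + x)) - D ^+ k.-1 * spline_coef n.+1 q m x| <= ep * D ^+ k.-1.
  by near: D; exact: (filtered_kernel_limit bm bq lamp qn alam ep0).
pose c := D ^+ k.-1.
have c0 : 0 < c by rewrite exprn_gt0.
pose G u := \sum_(i < n.*2.+1) z ^+ i * shifted_kernel a b lam n D i u.
have hG : sq_integrable leb G.
  by apply: sq_integrable_sum => i; apply: sq_integrableZ; exact: hs.
(* The left end of the cell of those [u] for which nD - u lies in ]mD, (m+1)D]. *)
pose am (m : nat) : R := n%:R * D - m.+1%:R * D.
pose Fm (m : nat) (u : R) : R :=
  \1_(`[am m, am m + D[%classic) u * shifted_kernel a b lam n D n u.
have indE (m : nat) u : (\1_(`[am m, am m + D[%classic) u : R) = (am m <= u < am m + D)%R%:R.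
  by rewrite indicE mem_setE in_itv.
have decomp u : shifted_kernel a b lam n D n u = \sum_(m < n.+1) Fm m u.
  pose t := n%:R * D - u.
  have cellE (m : nat) : (\1_(`[am m, am m + D[%classic) u : R) =
      (m%:R * D < t)%R%:R - (m.+1%:R * D < t)%R%:R.
    rewrite indE /am /t -natr1.
    have -> : (n%:R * D - (m%:R + 1) * D <= u) = ~~ ((m%:R + 1) * D < n%:R * D - u).
      by rewrite -leNgt; apply/idP/idP => h; lra.
    have -> : (u < n%:R * D - (m%:R + 1) * D + D) = (m%:R * D < n%:R * D - u).
      by apply/idP/idP => h; lra.
    case: ltP => h1; case: ltP => h2 //=; rewrite ?subr0 ?subrr //.
    by exfalso; lra.
  (* Each indicator is a difference of two threshold indicators, so the sum telescopes to the
     indicator of ]0, (n+1)D], the support of the kernel. *)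
  have tele N : \sum_(m < N) (\1_(`[am m, am m + D[%classic) u : R) =
      (0 < t)%R%:R - (N%:R * D < t)%R%:R.
    elim: N => [|N IH]; first by rewrite big_ord0 mul0r subrr.
    by rewrite big_ord_recr /= IH cellE; ring.
  rewrite -mulr_suml tele /shifted_kernel -/t.
  have [t0|t0] := ltP 0 t; last first.
    by rewrite (filtered_kernel_le0 _ _ _ _ (ltW D0) t0) mulr0.
  have [tn|tn] := ltP (n.+1%:R * D) t; last by rewrite subr0 mul1r.
  by rewrite (filtered_kernel_gt bm bq lamp qn alam D0 tn) mulr0.
have hF m : sq_integrable leb (Fm m).
  apply: (sq_integrable_le _ (hs n D0)).
    apply: measurable_funM; first exact: measurable_indic.
    by have [] := hs n D0.
  move=> u; rewrite /Fm indE; case: (_ <= _ < _); rewrite ?mul1r // mul0r expr0n.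
  exact: sqr_ge0.
have inE : inner leb (shifted_kernel a b lam n D n) G = \sum_(m < n.+1) inner leb (Fm m) G.
  rewrite -inner_suml //; congr (inner _ _ _).
  by apply/funext => u; exact: decomp.
pose Kc := n.+1%:R * (W + 1) * (2 * B + 1).
have n1 : 0 <= n.+1%:R :> R by [].
have cell (m : nat) : (m <= n)%N ->
    `|inner leb (Fm m) G - c * c * D * int01 (gram_poly z m)| <= ep * Kc * (c * c) * D.
  move=> mn; rewrite /inner; apply: (@integral_cell_approx _ _ _ (am m)) => //.
  - apply: measurable_funM; [by have [] := hF m|by have [] := hG].
  - by move=> u /negP/negPf h; rewrite /Fm indE h mul0r mul0r.
  move=> u hu; rewrite /Fm indE hu mul1r.
  pose x := (am m + D - u) / D.
  have x01 : 0 < x <= 1.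
    move: hu => /andP[h1 h2]; rewrite divr_gt0 ?subr_gt0 //= ler_pdivrMr // mul1r.
    by lra.
  have uE (i : nat) : i%:R * D - u = D * (m%:R + x) + (i%:R - n%:R) * D.
    by rewrite /x /am -natr1; field; rewrite gt_eqF.
  have fE : shifted_kernel a b lam n D n u = f D (D * (m%:R + x)).
    by rewrite /shifted_kernel uE subrr mul0r addr0.
  have GE : G u = \sum_(l < n.+1) z ^+ (n + l - m) * f D (D * (l%:R + x)).
    rewrite -(filtered_kernel_shift_sum z D0 mn x01); apply: eq_bigr => i _.
    by rewrite /shifted_kernel uE.
  have x01' : 0 <= x <= 1 by move: x01 => /andP[/ltW -> ->].
  rewrite -/x fE GE /gram_poly hornerM horner_sum.
  have -> : \sum_(l < n.+1) (z ^+ (n + l - m) *: spl l).[x] =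
      \sum_(l < n.+1) z ^+ (n + l - m) * (spl l).[x].
    by apply: eq_bigr => l _; rewrite hornerZ.
  apply: (convolution_approx z mn c0 ep0 ep1
    (v := fun l => f D (D * (l%:R + x))) (s := fun l => (spl l).[x])) => l ln.
    by have := lim l x ln x01; rewrite (splE ln x01).
  exact: splB.
(* Each of the two kernels scales like D^(k-1), and the cell has length D. *)
have Dk : D ^+ (k.-1 + k) = c * c * D.
  by rewrite exprD -[in X in _ * D ^+ X](@prednK k) ?subn_gt0 // exprS /c; ring.
have ccD : 0 < c * c * D by rewrite !mulr_gt0.
rewrite Dk inE int01_sum.
have -> : \sum_(m < n.+1) int01 (gram_poly z m) - (\sum_(m < n.+1) inner leb (Fm m) G) / (c * c * D)
  = - (\sum_(m < n.+1) (inner leb (Fm m) G - c * c * D * int01 (gram_poly z m))) / (c * c * D).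
  by rewrite sumrB -mulr_sumr; field; rewrite !gt_eqF.
rewrite mulNr normrN normrM normfV (gtr0_norm ccD) ler_pdivrMr //.
rewrite (le_trans (ler_norm_sum _ _ _)) //.
rewrite (le_trans (_ : _ <= \sum_(m < n.+1) ep * Kc * (c * c) * D)) //.
  by apply: ler_sum => m _; apply: cell; exact: leq_ord.
rewrite sumr_const card_ord -mulr_natl.
have -> : n.+1%:R * (ep * Kc * (c * c) * D) = (ep * (n.+1%:R * Kc)) * (c * c * D) by ring.
rewrite ler_pM2r // (le_trans _ epe) // ler_pM2l // /M -/Kc.
by lra.
Unshelve. all: by end_near.
Qed.

End GramLimit.

Lemma ma_admissible_mul (R : realType) m n (p q : {poly R}) :
  ma_admissible m p -> ma_admissible n q -> ma_admissible (m + n) (p * q).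
Proof.
move=> [sp p0 rp] [sq q0 rq]; split.
- by rewrite (leq_trans (size_polyMleq _ _)) //; lia.
- by rewrite hornerM p0 q0 mulr1.
- move=> z z1; rewrite /polyC_of rmorphM rootM negb_or.
  by rewrite rp ?rq.
Qed.

Lemma ma_admissible_1subX (R : realType) q : ma_admissible q ((1 - 'X) ^+ q : {poly R}).
Proof.
elim: q => [|q IH].
  split; first by rewrite expr0 size_poly1.
    by rewrite expr0 hornerC.
  by move=> z _; rewrite expr0 /polyC_of rmorph1 root1.
rewrite exprS -add1n; apply: ma_admissible_mul IH; split.
- by rewrite (leq_trans (size_polyD _ _)) // size_polyN size_poly1 size_polyX.
- by rewrite !hornerE subr0.
- move=> z z1; rewrite /polyC_of rmorphB rmorph1 /= map_polyX rootE !hornerE subr_eq0.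
  by apply/eqP => E; rewrite -E normr1 ltxx in z1.
Qed.

(** * From the generating polynomial N_x to the limiting spectral function *)

Section Splines.
Variables (R : realType) (n q : nat) (NN : {poly {poly R}}).
Hypothesis qn : (q < n.+1)%N.
Local Notation k := (n.+1 - q)%N.

(** The series of the (j+x)^(k-1)/(k-1)! z^j cut at degree [n]. The cut affects no coefficient of
    degree at most [n] in a product, which is why [NNE] is restricted to i <= n. *)
Definition power_series_trunc (x : R) : {poly R} :=
  \poly_(j < n.+1) ((j%:R + x) ^+ k.-1 / (k.-1)`!%:R).

Hypothesis NNE : forall i x, (i <= n)%N ->
  ((1 - 'X) ^+ k * power_series_trunc x)`_i = (NN`_i).[x].
Hypothesis NNs : (size NN <= k)%N.

Definition spline_poly : {poly {poly R}} := map_poly polyC ((1 - 'X) ^+ q) * NN.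

Lemma spline_coefE m x : (m <= n)%N -> spline_coef n.+1 q m x = (spline_poly`_m).[x].
Proof.
move=> mn; transitivity (((1 - 'X) ^+ n.+1 * power_series_trunc x)`_m).
  rewrite coefM; apply: eq_bigr => j _; rewrite coef_poly ifT ?mulrA //.
  by rewrite ltnS (leq_trans (leq_subr _ _)).
have -> : n.+1 = (q + k)%N by rewrite subnKC // ltnW.
rewrite exprD -mulrA coefM /spline_poly coefM horner_sum; apply: eq_bigr => j _.
rewrite hornerM coef_map hornerC NNE //.
by rewrite (leq_trans (leq_subr _ _)).
Qed.

Lemma size_spline_poly : (size spline_poly <= n.+1)%N.
Proof.
apply: leq_trans (size_polyMleq _ _) _.
have h : (size (map_poly polyC ((1 - 'X) ^+ q : {poly R})) <= q.+1)%N.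
  by rewrite (leq_trans (size_poly _ _)) //; have [] := ma_admissible_1subX R q.
by apply: (leq_trans (n := (q.+1 + k).-1)); [rewrite -!subn1 leq_sub2r // leq_add|lia].
Qed.

(** The double sum factors because the weight z^(n+l-m) is z^n z^-m z^l. *)
Lemma sum_gram_poly (z : R) : z != 0 ->
  \sum_(m < n.+1) gram_poly n (fun m => spline_poly`_m) z m =
  z ^+ n *: (spline_poly.[(z^-1)%:P] * spline_poly.[z%:P]).
Proof.
move=> z0; rewrite !(horner_coef_wide _ size_spline_poly) mulr_suml scaler_sumr.
apply: eq_bigr => m _; rewrite /gram_poly -mulrA scalerAr; congr (_ * _).
rewrite mulr_sumr scaler_sumr; apply: eq_bigr => l _.
have mn : (m <= n)%N := leq_ord m.
rewrite -!polyC_exp [_ * (z ^+ l)%:P]mulrC !mul_polyC !scalerA.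
congr (_ *: _); rewrite -addnBAC // exprD exprVn; congr (_ * _).
by apply: (mulIf (expf_neq0 m z0)); rewrite divfK ?expf_neq0 // -exprD subnK.
Qed.

Lemma int01_spline_gram (z : R) : z != 0 ->
  int01 (\sum_(m < n.+1) gram_poly n (fun m => spline_poly`_m) z m) =
  z ^+ n * (((1 - z^-1) * (1 - z)) ^+ q * int01 (NN.[(z^-1)%:P] * NN.[z%:P])).
Proof.
move=> z0; rewrite sum_gram_poly // int01Z; congr (_ * _).
rewrite /spline_poly !hornerM !horner_map !horner_exp !hornerE /=.
by rewrite -mulrA mulrACA -polyCM mul_polyC int01Z exprMn.
Qed.

End Splines.

Section Generic.
Context d (T : measurableType d) (R : realType) (P : probability T R).
Variables (L : R -> {RV P >-> R}) (sigma : R) (n q : nat).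
Hypotheses (hL : levy_process L) (hmean : 'E_P[(L 1)%R]%E = 0%E) (hsigma : 0 < sigma)
  (hvar : 'E_P[fun w => (L 1 w ^+ 2)%R]%E = (sigma ^+ 2)%:E%E)
  (qn : (q < n.+1)%N).
Variables (a b : {poly R}) (lam : seq R[i]) (Y : R -> {RV P >-> R}).
Hypotheses (hb : b \is monic) (hsb : size b = q.+1) (hsl : size lam = n.+1)
  (alam : polyC_of a = roots_poly lam) (hY : carma_process L a b lam Y).
Variables (theta : R -> {poly R}) (Z : R -> int -> {RV P >-> R}) (tau2 : R -> R).
Hypothesis hMA : forall D : R, 0 < D ->
  sampled_ma_representation n.+1 lam Y D (theta D) (Z D) (tau2 D).
Local Notation k := (n.+1 - q)%N.

(** Reduces each case to a factorization of the integral of N_x(1/z) N_x(z): divided by sigma^2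
    D^(2k-1), [tau2] plays the part of [kappa] in [spectral_limit], and the hypothesis there follows
    from [ma_spectral_identity] and [gram_limit]. *)
Lemma sampled_ma_limit (NN : {poly {poly R}}) (eta : {poly R}) (k0 : R) :
  (forall i x, (i <= n)%N ->
    ((1 - 'X) ^+ k * power_series_trunc n q x)`_i = (NN`_i).[x]) ->
  (size NN <= k)%N -> k0 != 0 -> ma_admissible k.-1 eta ->
  (forall z : R, z != 0 -> int01 (NN.[(z^-1)%:P] * NN.[z%:P]) = k0 * (eta.[z^-1] * eta.[z])) ->
  cvg_coefs n.+1 theta (eta * (1 - 'X) ^+ q) /\
  tau2 D / (sigma ^+ 2 * D ^+ (k.-1 + k)) @[D --> 0^'+] --> k0.
Proof.
move=> NNE NNs k00 aeta etaE.
have adm : ma_admissible n (eta * (1 - 'X) ^+ q).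
  have := ma_admissible_mul aeta (ma_admissible_1subX R q).
  by rewrite (_ : (k.-1 + q)%N = n) //; lia.
have [sq0 _ _] := adm.
have gl z := gram_limit hb hsb hsl qn alam
  (fun m x mn _ => spline_coefE qn NNE x mn)
  (fun D i D0 => sq_integrable_shifted_kernel hL hmean hvar hY n D i) z.
suff [h1 h2] : (forall j, (theta D)`_j @[D --> (0:R)^'+] --> (eta * (1 - 'X) ^+ q)`_j) /\
    tau2 D / (sigma ^+ 2 * D ^+ (k.-1 + k)) @[D --> (0:R)^'+] --> k0.
  by split => // j _; exact: h1.
apply: (spectral_limit (n := n) _ k00 adm).
  near=> D; have D0 : 0 < D by near: D; exact: nbhs_right_gt.
  by have [s1 s2 s3 _ _] := hMA D0; split.
move=> z z0.
have -> : k0 * ((rev_poly n (eta * (1 - 'X) ^+ q)).[z] * (eta * (1 - 'X) ^+ q).[z]) =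
    int01 (\sum_(m < n.+1) gram_poly n (fun m => (spline_poly q NN)`_m) z m).
  rewrite int01_spline_gram // etaE // horner_rev_poly //.
  have E x : (1 - 'X : {poly R}).[x] = 1 - x by rewrite !hornerE.
  by rewrite !hornerM !horner_exp !E exprMn; ring.
apply: cvg_trans (gl z); apply: near_eq_cvg; near=> D.
have D0 : 0 < D by near: D; exact: nbhs_right_gt.
have E := ma_spectral_identity hL hmean hvar hY hsl (hMA D0) z.
rewrite mulrAC E; field.
by rewrite expf_neq0 ?gt_eqF.
Unshelve. all: by end_near.
Qed.

End Generic.

(** * The limiting polynomials *)

(** In the open disc |z c(z)| <= |z| < 1, so 1 + z c(z) cannot vanish. *)
Lemma ma_admissible_small (R : realType) n (c : {poly R}) :
  (size c <= n)%N -> \sum_(i < n) `|c`_i| <= 1 -> ma_admissible n (1 + c * 'X).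
Proof.
move=> cn c1; split.
- apply: (leq_trans (size_polyD _ _)); rewrite size_poly1 geq_max /=.
  by rewrite (leq_trans (size_polyMleq _ _)) // size_polyX addn2.
- by rewrite hornerD hornerM hornerX mulr0 addr0 hornerC.
- move=> z z1; rewrite rootE /polyC_of rmorphD rmorphM rmorph1 /= map_polyX hornerD hornerM.
  rewrite hornerX hornerC addr_eq0; apply/negP => /eqP /(congr1 (@modulus R)).
  rewrite modulus1 modulusN modulusM.
  have {}z1 : modulus z < 1 by rewrite -ltcR modulusE.
  have z0 := modulus_ge0 z.
  have : modulus (map_poly (real_complex R) c).[z] <= 1.
    rewrite (horner_coef_wide (n := n)); last by rewrite (leq_trans (size_poly _ _)).
    apply: le_trans c1; apply: (le_trans (ler_modulus_sum _ _)).
    apply: ler_sum => i _; rewrite coef_map modulusM modulusX modulus_real.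
    by rewrite ler_piMr // exprn_ile1 // ltW.
  by have := modulus_ge0 (map_poly (real_complex R) c).[z]; nra.
Qed.

Lemma equiv0_of_cvg (R : realType) (f g h : R -> R) (k0 : R) : k0 != 0 ->
  (forall D, h D = g D * k0) -> f D / g D @[D --> 0^'+] --> k0 -> equiv0 f h.
Proof.
move=> k00 hE lim; rewrite /equiv0 -[X in _ --> X](divff k00).
have -> : (fun D => f D / h D) = (fun D => f D / g D * k0^-1).
  by apply/funext => D; rewrite hE invfM mulrA.
exact: (cvgMr_tmp lim).
Qed.

Section CardinalSplines.
Variable R : realType.
Implicit Types (x w z : R).

(* The polynomial N_x(z) for k = 1, 2, 3, as a polynomial in z whose coefficients
   are polynomials in x. *)
Definition spline_gen1 : {poly {poly R}} := 1.

Definition spline_gen2 : {poly {poly R}} := Poly [:: 'X; 1 - 'X].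

Definition spline_gen3 : {poly {poly R}} :=
  Poly [:: 2^-1%:P * 'X^2; 2^-1%:P * (1 + 2%:P * 'X - 2%:P * 'X^2); 2^-1%:P * (1 - 'X) ^+ 2].

Lemma spline_gen1E n q x i : (n.+1 - q = 1)%N -> (i <= n)%N ->
  ((1 - 'X) ^+ (n.+1 - q) * power_series_trunc n q x)`_i = (spline_gen1`_i).[x].
Proof.
move=> nq; rewrite nq expr1 mulrBl mul1r coefB coefXM !coef_poly nq coef1.
case: i => [|i] ni; rewrite ?ltnS ni ?(ltnW ni) /= ?subr0.
  by rewrite expr0 divr1 !hornerE.
by rewrite !expr0 subrr horner0.
Qed.

Lemma spline_gen2E n q x i : (n.+1 - q = 2)%N -> (i <= n)%N ->
  ((1 - 'X) ^+ (n.+1 - q) * power_series_trunc n q x)`_i = (spline_gen2`_i).[x].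
Proof.
move=> nq ni; rewrite nq; set p := power_series_trunc n q x.
have pE j : (j <= n)%N -> p`_j = j%:R + x.
  by move=> jn; rewrite coef_poly ltnS jn nq /= expr1 divr1.
have -> : (1 - 'X) ^+ 2 * p = p - 'X * p - 'X * p + 'X * ('X * p) by ring.
rewrite !(coefD, coefN, coefXM) coef_Poly.
case: i ni => [|[|i]] ni /=; rewrite ?coefXM /= !pE; try lia.
- by rewrite hornerX; ring.
- by rewrite !hornerE; ring.
- by rewrite nth_nil horner0 -!(natr1, natrD); ring.
Qed.

(** In degree at least 3 the coefficient is a third difference of the quadratic (j+x)^2/2, hence
    0. *)
Lemma spline_gen3E n q x i : (n.+1 - q = 3)%N -> (i <= n)%N ->
  ((1 - 'X) ^+ (n.+1 - q) * power_series_trunc n q x)`_i = (spline_gen3`_i).[x].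
Proof.
move=> nq ni; rewrite nq; set p := power_series_trunc n q x.
have pE j : (j <= n)%N -> p`_j = (j%:R + x) ^+ 2 / 2.
  by move=> jn; rewrite coef_poly ltnS jn nq.
have -> : (1 - 'X) ^+ 3 * p = p - 'X * p - 'X * p - 'X * p +
  ('X * ('X * p) + 'X * ('X * p) + 'X * ('X * p)) - 'X * ('X * ('X * p)) by ring.
rewrite !(coefD, coefN, coefXM) coef_Poly.
case: i ni => [|[|[|i]]] ni /=; rewrite ?coefXM /= ?coefXM /= !pE; try lia.
- by rewrite !(hornerD, hornerN, hornerM, horner_exp, hornerX, hornerC); field.
- by rewrite !(hornerD, hornerN, hornerM, horner_exp, hornerX, hornerC); field.
- by rewrite !(hornerD, hornerN, hornerM, horner_exp, hornerX, hornerC); field.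
- by rewrite nth_nil horner0 -!(natr1, natrD); field.
Qed.

Lemma int01_quartic (c0 c1 c2 c3 c4 : R) :
  int01 (c0%:P + c1%:P * 'X + c2%:P * 'X^2 + c3%:P * 'X^3 + c4%:P * 'X^4) =
  c0 + c1 / 2 + c2 / 3 + c3 / 4 + c4 / 5.
Proof. by rewrite !int01D !mul_polyC !int01Z int01C -['X]expr1 !int01Xn. Qed.

Lemma int01_gen1 w z : int01 (spline_gen1.[w%:P] * spline_gen1.[z%:P]) = 1.
Proof. by rewrite /spline_gen1 !hornerC mulr1 -polyC1 int01C. Qed.

Lemma int01_gen2 w z : w * z = 1 ->
  int01 (spline_gen2.[w%:P] * spline_gen2.[z%:P]) = (4 + (w + z)) / 6.
Proof.
move=> wz; pose s := w + z.
have -> : spline_gen2.[w%:P] * spline_gen2.[z%:P] =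
    (w * z)%:P + (s - 2 * (w * z))%:P * 'X + (1 + w * z - s)%:P * 'X^2 + 0%:P * 'X^3 + 0%:P * 'X^4.
  rewrite !horner_Poly /= /s; ring.
by rewrite int01_quartic wz /s; field.
Qed.

Lemma int01_gen3 w z : w * z = 1 ->
  int01 (spline_gen3.[w%:P] * spline_gen3.[z%:P]) =
  (66 + 26 * (w + z) + (w ^+ 2 + z ^+ 2)) / 120.
Proof.
(* In terms of the symmetric quantities the integrand is an identity valid for all [w] and [z]; the
   relation w z = 1 enters only after integration. *)
move=> wz; pose r := w * z; pose s := w + z; pose t := w ^+ 2 + z ^+ 2.
have -> : spline_gen3.[w%:P] * spline_gen3.[z%:P] =
    (2^-1 ^+ 2 * (r + r ^+ 2 + r * s))%:P +
    (2^-1 ^+ 2 * (4 * r - 4 * r ^+ 2))%:P * 'X +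
    (2^-1 ^+ 2 * (6 * r ^+ 2 + s - 5 * (r * s) + t))%:P * 'X^2 +
    (2^-1 ^+ 2 * (2 * s + 6 * (r * s) - 8 * r - 4 * r ^+ 2 - 2 * t))%:P * 'X^3 +
    (2^-1 ^+ 2 * (1 + 4 * r + r ^+ 2 - 2 * s - 2 * (r * s) + t))%:P * 'X^4.
  rewrite !horner_Poly /= /r /s /t; move: (2^-1 : R) => h; ring.
by rewrite int01_quartic /r wz /s /t; field.
Qed.

End CardinalSplines.

(** * The constants of the spectral factorizations *)

Section Constants.
Variable R : realType.

(** The two equations compare the coefficients of k0 (1 + th/z)(1 + th z) and (4 + z + 1/z)/6. They
    force th^2 - 4 th + 1 = 0, whose root in [0, 1] is taken, and k0 = 1/(6 th). *)
Lemma gen2_constants (th : R := 2 - Num.sqrt 3) (k0 : R := (2 + Num.sqrt 3) / 6) :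
  [/\ 0 <= th <= 1, 0 < k0, k0 * th = 1 / 6 & k0 * (1 + th ^+ 2) = 4 / 6].
Proof.
have r2 : Num.sqrt 3 ^+ 2 = 3 :> R by rewrite sqr_sqrtr.
have r0 : 0 <= Num.sqrt 3 :> R by exact: sqrtr_ge0.
have [r1 r3] : 1 <= Num.sqrt 3 :> R /\ Num.sqrt 3 <= 2 :> R by split; nra.
rewrite /th /k0; split; first by apply/andP; split; lra.
- by rewrite divr_gt0 //; lra.
- by field: r2.
- by field: r2.
Qed.

(** Comparing coefficients with (66 + 26 (z + 1/z) + z^2 + z^-2)/120 and eliminating [th1] gives s^2
    - 64 s + 544 = 0 for s = th2 + 1/th2. The larger root s = 32 + 4 sqrt 30 is used, and [th2] is
    the smaller solution of th2 + 1/th2 = s. *)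
Lemma gen3_constants (th2 : R := 2 * (8 + Num.sqrt 30) - Num.sqrt (375 + 64 * Num.sqrt 30))
    (th1 : R := 26 * th2 / (1 + th2))
    (k0 : R := (2 * (8 + Num.sqrt 30) + Num.sqrt (375 + 64 * Num.sqrt 30)) / 120) :
  [/\ 0 < th2, 0 < th1, th1 + th2 <= 1, 0 < k0 &
   [/\ k0 * th2 = 1 / 120, k0 * (th1 + th1 * th2) = 26 / 120,
       k0 * (1 + th1 ^+ 2 + th2 ^+ 2) = 66 / 120 &
       th1 = 13 - Num.sqrt (135 + 4 * Num.sqrt 30)]].
Proof.
pose r : R := Num.sqrt 30; pose S : R := Num.sqrt (375 + 64 * r).
have r0 : 0 <= r := sqrtr_ge0 _; have S0 : 0 <= S := sqrtr_ge0 _.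
have r2 : r ^+ 2 = 30 by rewrite sqr_sqrtr.
have S2 : S ^+ 2 = 375 + 64 * r by rewrite sqr_sqrtr; lra.
have r5 : 5 <= r by nra.
have S19 : 19 <= S by nra.
(* The second factor is the other root 1/th2 of the quadratic, so k0 = 1/(120 th2). *)
have prod : th2 * (2 * (8 + r) + S) = 1.
  rewrite /th2 -/r -/S; ring: r2 S2.
have U0 : 0 < 2 * (8 + r) + S by lra.
have t0 : 0 < th2 by rewrite -(pmulr_lgt0 _ U0) prod.
(* Since th1 <= 26 th2, this is what yields th1 + th2 <= 1, the criterion of
   [ma_admissible_small]. *)
have t27 : 27 * th2 <= 1 by rewrite -prod; nra.
have quad : th2 ^+ 2 = 2 * (16 + 2 * r) * th2 - 1.
  have SE : S = 2 * (8 + r) - th2 by rewrite /th2 -/r -/S; ring.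
  by move: prod; rewrite SE; lra.
have d0 : 1 + th2 != 0 by rewrite gt_eqF //; lra.
have t1 : 0 < th1 by rewrite divr_gt0 ?mulr_gt0 //; lra.
have t1E : th1 * (1 + th2) = 26 * th2 by rewrite /th1 divfK.
have t1le : th1 <= 26 * th2 by rewrite -t1E; nra.
have sum66 : 1 + th1 ^+ 2 + th2 ^+ 2 = 66 * th2.
  have dd : (1 + th2) ^+ 2 != 0 by rewrite expf_neq0.
  apply: (mulIf dd).
  have -> : (1 + th1 ^+ 2 + th2 ^+ 2) * (1 + th2) ^+ 2 =
    (1 + th2 ^+ 2) * (1 + th2) ^+ 2 + (th1 * (1 + th2)) ^+ 2 by ring.
  have e1 : 1 + th2 ^+ 2 = (32 + 4 * r) * th2 by rewrite quad; ring.
  have e2 : (1 + th2) ^+ 2 = (34 + 4 * r) * th2.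
    have -> : (1 + th2) ^+ 2 = (1 + th2 ^+ 2) + 2 * th2 by ring.
    by rewrite e1; ring.
  rewrite t1E e1 e2; ring: r2.
have k0E : k0 * th2 = 1 / 120.
  by rewrite /k0 -/r -/S mulrAC [_ * th2]mulrC prod.
split => //.
- by lra.
- by rewrite divr_gt0.
split => //.
- have -> : th1 + th1 * th2 = 26 * th2 by rewrite -t1E; ring.
  by rewrite mulrCA k0E; field.
- by rewrite sum66 mulrCA k0E; field.
- have h13 : 0 <= 13 - th1 by lra.
  have sq : (13 - th1) ^+ 2 = 135 + 4 * r.
    have dd : (1 + th2) ^+ 2 != 0 by rewrite expf_neq0.
    apply: (mulIf dd).
    have -> : (13 - th1) ^+ 2 * (1 + th2) ^+ 2 = (13 * (1 + th2) - th1 * (1 + th2)) ^+ 2 by ring.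
    rewrite t1E; ring: quad r2.
  by rewrite -/r -sq sqrtr_sqr ger0_norm //; ring.
Qed.

End Constants.

Theorem corollary3p4 (d : measure_display) (T : measurableType d) (R : realType)
  (P : probability T R)
  (L : R -> {RV P >-> R}) (sigma : R)
  (hL : levy_process L)
  (hmean : 'E_P[(L 1)%R]%E = 0%E)
  (hsigma : 0 < sigma)
  (hvar : 'E_P[fun w => (L 1 w ^+ 2)%R]%E = (sigma ^+ 2)%:E%E)
  (p q : nat) (hqp : (q < p)%N)
  (a b : {poly R})
  (ha : a \is monic) (hsa : size a = p.+1)
  (hb : b \is monic) (hsb : size b = q.+1)
  (hab : forall z : R[i], ~~ (root (polyC_of a) z && root (polyC_of b) z))
  (lam : p.-tuple R[i])
  (hlam : polyC_of a = \prod_(l <- lam) ('X - l%:P))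
  (hre : forall l : R[i], l \in lam -> complex.Re l < 0)
  (Y : R -> {RV P >-> R})
  (hY : carma_process L a b lam Y)
  (theta : R -> {poly R}) (Z : R -> int -> {RV P >-> R}) (tau2 : R -> R)
  (hMA : forall D : R, 0 < D ->
     sampled_ma_representation p lam Y D (theta D) (Z D) (tau2 D)) :
  [/\ (p - q = 1)%N ->
        cvg_coefs p theta ((1 - 'X) ^+ q) /\
        equiv0 tau2 (fun D => sigma ^+ 2 * D),
      (p - q = 2)%N ->
        let th : R := 2 - Num.sqrt 3 in
        cvg_coefs p theta ((1 + th%:P * 'X) * (1 - 'X) ^+ q) /\
        equiv0 tau2 (fun D => sigma ^+ 2 * D ^+ 3 * (2 + Num.sqrt 3) / 6) &
      (p - q = 3)%N ->
        let th2 : R := 2 * (8 + Num.sqrt 30) - Num.sqrt (375 + 64 * Num.sqrt 30) in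
        let th1 : R := 26 * th2 / (1 + th2) in
        [/\ th1 = 13 - Num.sqrt (135 + 4 * Num.sqrt 30),
            cvg_coefs p theta
              ((1 + th1%:P * 'X + th2%:P * 'X^2) * (1 - 'X) ^+ q) &
            equiv0 tau2 (fun D =>
              (2 * (8 + Num.sqrt 30) + Num.sqrt (375 + 64 * Num.sqrt 30))
                * D ^+ 5 * sigma ^+ 2 / 120)]].
Proof.
have hsl : size lam = p := size_tuple lam.
move: lam hlam hre hY hMA hsl; case: p hqp hsa => [//|n] qn hsa lam hlam _ hY hMA hsl.
have main := sampled_ma_limit hL hmean hsigma hvar qn hb hsb hsl hlam hY hMA.
split => nq.
- have [] := main (spline_gen1 R) 1 1.
  + by move=> i x; exact: spline_gen1E.
  + by rewrite nq size_poly1.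
  + exact: oner_neq0.
  (* The constant 1 is written as 1 + 0 X to fit the criterion with n = 0. *)
  + by rewrite nq -[1]addr0 -[X in 1 + X](mul0r 'X); apply: ma_admissible_small; rewrite ?size_poly0 ?big_ord0.
  + by move=> z _; rewrite int01_gen1 !hornerC !mulr1.
  by rewrite mul1r nq.
- move=> th; have [/andP[th0 th1] k0 e1 e2] := gen2_constants R.
  have [] := main (spline_gen2 R) (1 + th%:P * 'X) ((2 + Num.sqrt 3) / 6).
  + by move=> i x; exact: spline_gen2E.
  + by rewrite nq; exact: size_Poly.
  + by rewrite gt_eqF.
  + rewrite nq; apply: ma_admissible_small; first exact: size_polyC_leq1.
    by rewrite big_ord1 coefC /= ger0_norm.
  + move=> z z0; rewrite int01_gen2 ?mulVf // !(hornerD, hornerM, horner_exp, hornerX, hornerC).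
    (* The product z^-1 z is kept visible so that [ring] proves the expansion formally; it is
       replaced by 1 afterwards. *)
    transitivity ((2 + Num.sqrt 3) / 6 * (1 + th ^+ 2 * (z^-1 * z)) +
      (2 + Num.sqrt 3) / 6 * th * (z^-1 + z)); last by ring.
    by rewrite mulVf // mulr1 e1 e2; field.
  rewrite nq /= => h1 h2; split=> //.
  by apply: (equiv0_of_cvg _ _ h2) => [|D]; [by rewrite gt_eqF|ring].
- move=> th2 th1; have [th20 th10 s1 k0 [e1 e2 e3 e4]] := gen3_constants R.
  pose k := (2 * (8 + Num.sqrt 30) + Num.sqrt (375 + 64 * Num.sqrt 30)) / 120 : R.
  have etaE : 1 + th1%:P * 'X + th2%:P * 'X^2 = 1 + (th1%:P + th2%:P * 'X) * 'X by ring.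
  have [] := main (spline_gen3 R) (1 + th1%:P * 'X + th2%:P * 'X^2) k.
  + by move=> i x; exact: spline_gen3E.
  + by rewrite nq; exact: size_Poly.
  + by rewrite gt_eqF.
  + rewrite nq etaE; apply: ma_admissible_small.
      rewrite (leq_trans (size_polyD _ _)) // geq_max (leq_trans (size_polyC_leq1 _)) //=.
      by rewrite (leq_trans (size_polyMleq _ _)) // size_polyX addn2 /= ltnS size_polyC_leq1.
    rewrite !big_ord_recl big_ord0 /= !coefD !coefMX !coefC /= add0r !addr0.
    by rewrite (ger0_norm (ltW th10)) (ger0_norm (ltW th20)).
  + move=> z z0; rewrite int01_gen3 ?mulVf // !(hornerD, hornerM, horner_exp, hornerX, hornerC).
    transitivity (k * (1 + th1 ^+ 2 * (z^-1 * z) + th2 ^+ 2 * (z^-1 * z) ^+ 2) +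
      k * (th1 + th1 * th2 * (z^-1 * z)) * (z^-1 + z) + k * th2 * (z^-1 ^+ 2 + z ^+ 2)); last by ring.
    by rewrite mulVf // expr1n !mulr1 e1 e2 e3; field.
  rewrite nq /= => h1 h2; split=> //.
  by apply: (equiv0_of_cvg _ _ h2) => [|D]; [by rewrite gt_eqF|rewrite /k; field].
Qed.
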